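(* Let $m$ be a locally finite nonnegative Borel measure on $\mathbb{R}$ such that $\operatorname{supp} m\cap(-\infty,-b]\neq\emptyset$ and $\operatorname{supp} m\cap[b,\infty)\neq\emptyset$ for all $b>0$, let $\Psi$ be the convex function associated with $m$, and let $g:\mathbb{R}\to\mathbb{R}$ be continuous with $g(x)=o(\Psi(x))$ as $|x|\to\infty$. Let $U:\mathbb{R}\times[0,\infty)\to\mathbb{R}$ be the unique continuous function such that $U(x,t)=o(\Psi(x))$ as $|x|\to\infty$ locally uniformly in $t$, $2mU_t=U_{xx}$ in the sense of distributions on $\mathbb{R}\times(0,\infty)$, and $U(x,0)=\overline g(x)$. Then $U$ is infinitely differentiable in $t$ on $\mathbb{R}\times(0,\infty)$; moreover, $U$ and all its derivatives with respect to $t$ are locally Lipschitz on $\mathbb{R}\times(0,\infty)$.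
   Context: Function $\Psi$: define $\Phi(x):=2\int_{[0,x)}y\,m(dy)$ for $x\ge 0$, $\Phi(x):=2\int_{[x,0)}y\,m(dy)$ for $x<0$, and $\Psi(x):=\int_0^x\Phi(y)\,dy$. Function $\overline g$: the continuous function that agrees with $g$ on $\operatorname{supp} m$ and is affine on each connected component of $\mathbb{R}\setminus\operatorname{supp} m$. Distributional equation: $2mU_t=U_{xx}$ means $$-2\iint U\varphi_t\,m(dx)\,dt=\iint U\varphi_{xx}\,dx\,dt\quad\text{for all }\varphi\in C_c^\infty(\mathbb{R}\times(0,\infty)).$$ Such a $U$ exists, is unique, and is given by $U(x,t)=\mathbb{E}\,g(X^x_t)$, where $X^x$ is the generalized diffusion with speed measure $m$ started at $x$: with $B$ a standard Brownian motion, $B_0=0$, with local time $L^y_u$ (jointly continuous occupation density with respect to Lebesgue measure), $\Gamma^x_u:=\int_{\mathbb{R}}L^{y-x}_u\,m(dy)$, $A^x_t:=\inf\{u:\Gamma^x_u>t\}$, $X^x_t:=x+B_{A^x_t}$. *)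

(* Defs.v *)
From mathcomp Require Export all_boot all_order all_algebra.
From mathcomp Require Export all_classical all_reals all_analysis.

Set Implicit Arguments.
Unset Strict Implicit.
Unset Printing Implicit Defensive.

Export Order.TTheory GRing.Theory Num.Theory.
Export numFieldNormedType.Exports.

Local Open Scope classical_set_scope.
Local Open Scope ring_scope.

Section SpeedMeasure.
Context {R : realType} (m : {measure set (measurableTypeR R) -> \bar R}).

Definition locally_finite : Prop :=
  forall x : R, exists2 V : set R, open_nbhs x V & (m V < +oo)%E.

Definition msupport : set R :=
  [set x : R | forall V : set R, open_nbhs x V -> (0 < m V)%E].

Definition Phi (x : R) : R :=
  if 0 <= x then 2 * \int[m]_(y in `[0, x[) y
  else 2 * \int[m]_(y in `[x, 0[) y.

(* For [x < 0], the integral from 0 to x is minus the integral over [x, 0]. *)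
Definition Psi (x : R) : R :=
  if 0 <= x then \int[lebesgue_measure]_(y in `[0, x]) Phi y
  else - \int[lebesgue_measure]_(y in `[x, 0]) Phi y.

(* [gbar] is the function written g with a bar; when the support of [m] is
   unbounded in both directions, it is determined by [g]. *)
Definition affine_interpolation (g gbar : R -> R) : Prop :=
  [/\ continuous gbar,
      {in msupport, gbar =1 g} &
      forall x, ~ msupport x -> exists a b : R,
        forall y, connected_component (~` msupport) x y ->
          gbar y = a * y + b].

End SpeedMeasure.

Section TestFunctions.
Context {R : realType}.

Definition dx (f : R * R -> R) : R * R -> R := 'D_((1, 0) : R * R) f.
Definition dt (f : R * R -> R) : R * R -> R := 'D_((0, 1) : R * R) f.

Fixpoint Ck (k : nat) (f : R * R -> R) : Prop :=
  continuous f /\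
  if k is k'.+1 then
    [/\ forall p, derivable f p ((1, 0) : R * R),
        forall p, derivable f p ((0, 1) : R * R),
        Ck k' (dx f) & Ck k' (dt f)]
  else True.

Definition smooth (f : R * R -> R) : Prop := forall k, Ck k f.

Definition upper_half_plane : set (R * R) := [set p | 0 < p.2].

(* Elements of C_c^oo of the open half-plane, extended by 0 to the plane. *)
Definition test_function (phi : R * R -> R) : Prop :=
  [/\ smooth phi,
      compact (closure [set p | phi p != 0]) &
      closure [set p | phi p != 0] `<=` upper_half_plane].

End TestFunctions.

Section Equation.
Context {R : realType} (m : {measure set (measurableTypeR R) -> \bar R}).

(* Functions on R x [0, oo) are represented by total functions on [R * R];
   their values at negative times are irrelevant in everything below. *)

Definition distributional_solution (U : R * R -> R) : Prop :=
  forall phi : R * R -> R, test_function phi ->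
    - 2 * \int[lebesgue_measure]_(t in `]0, +oo[)
            \int[m]_x (U (x : R, t : R) * dt phi (x : R, t : R))
    = \int[lebesgue_measure]_(t in `]0, +oo[)
        \int[lebesgue_measure]_x
          (U (x : R, t : R) * dx (dx phi) (x : R, t : R)).

Definition littleo_infty (f e : R -> R) : Prop :=
  f =o_ (FilterType (pinfty_nbhs R) _) e /\ f =o_ (FilterType (ninfty_nbhs R) _) e.

Definition littleo_infty_locally_uniformly (U : R * R -> R) (e : R -> R)
    : Prop :=
  forall t0 : R, 0 <= t0 -> exists2 V : set R, nbhs t0 V &
    forall eps : R, 0 < eps ->
      (\forall x \near pinfty_nbhs R, forall t, V t -> 0 <= t ->
         `|U (x, t)| <= eps * `|e x|) /\
      (\forall x \near ninfty_nbhs R, forall t, V t -> 0 <= t ->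
         `|U (x, t)| <= eps * `|e x|).

(* The n-th derivative of [U] in its second variable. *)
Definition dtn (n : nat) (U : R * R -> R) (p : R * R) : R :=
  derive1n n (fun s => U (p.1, s)) p.2.

Definition infinitely_differentiable_in_t (U : R * R -> R) : Prop :=
  forall (n : nat) (x t : R), 0 < t ->
    derivable (fun s => dtn n U (x, s)) t 1.

Definition locally_lipschitz (D : set (R * R)) (f : R * R -> R) : Prop :=
  forall p, D p -> exists2 V, nbhs p V & [lipschitz f q | q in V `&` D].

End Equation.

(* Main.v *)
(* Convolving [U] in time with a bump gives functions that are smooth in time,
   solve the same equation and converge to [U] as the bump concentrates.  It is
   therefore enough to bound each time derivative of such a solution [v] on a
   compact set by the supremum of [v] on a larger one, uniformly in the bump;
   the Lipschitz bound in [x] then comes from [v_xx = 2 m v_t].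

   Testing the equation with [v] times a cutoff controls [v_x], and testing it
   with [v_t] times a cutoff controls [v_t], but only by interpolation:
   [|v_t|^2 <= C (|v|^2 / theta + theta |v_t|^2)] in L^2 of a larger box, for all
   [theta > 0].  Applied to the average of [v] over [[t, t + h]], with
   [theta = h], this gives [D_h v = O(h^(1/2))] for the time difference [D_h v].
   Three iterations give [D_h^3 v = O(h^(3/2))], whence [D_h v = O(h)] by
   Marchaud's inequality, and the resulting bound on [v_t] can be iterated.
   Bounds in L^2(m) become pointwise because [v^2] is dominated, up to such
   terms, by its averages over the two far regions charged by [m]. *)

(* Since [m] may have atoms, gaps and a singular part, [v_xx] need not be a function. At a fixed
   time the equation is therefore kept as an identity between values of [v] and integrals of [v_t]
   against [m] over hat functions; [v_x] is then, up to a constant, twice the [m]-primitive of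
   [v_t]. The interpolation inequality does not bound [v_t] by absorption, because the term with the
   factor [theta] lives on a larger box than the left side. Instead it is applied to a function
   whose time derivative is already bounded: the integral of [v] over [[t, t + h]] has size [h] and
   derivative [D_h v], hence half a power of [h] per difference. Two differences would only give
   [O(h)], the borderline case in which Marchaud's inequality loses a logarithm; three give an
   exponent above 1. The mollifying kernels are supported in [[0, e]] and look only forward in time,
   so the mollified equation holds at every positive time. Squared norms are compared with squares
   of constants, so that no square root occurs. *)
Require Import Defs.
From mathcomp Require Import all_boot all_order all_algebra.
From mathcomp Require Import finmap.
From mathcomp Require Import all_classical all_reals all_analysis.
From HB Require Import structures.
From mathcomp Require Import measurable_realfun.
From mathcomp Require Import ring lra.

Set Implicit Arguments.
Unset Strict Implicit.
Unset Printing Implicit Defensive.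

Import Order.TTheory GRing.Theory Num.Theory numFieldNormedType.Exports.

Local Open Scope classical_set_scope.
Local Open Scope ring_scope.

(** * Integrals of locally bounded functions against a locally finite measure *)

Section LocallyBounded.
Context {R : realType}.
Implicit Types (f g : R -> R) (h : R * R -> R) (mu : {measure set (measurableTypeR R) -> \bar R}).

(** Boundedness is required on bounded sets only. The class is stable under sums, products, cut-offs
    and parameter integrals, and its members are integrable over compact intervals for every locally
    finite measure, so [lbm] takes the place of integrability side conditions. [lbm2] does the same
    for Fubini's theorem. *)
Definition lbm f := measurable_fun setT f /\
  forall r : R, exists M : R, forall x, `|x| <= r -> `|f x| <= M.

Definition lbm2 h := measurable_fun setT h /\
  forall r : R, exists M : R, forall x y, `|x| <= r -> `|y| <= r -> `|h (x, y)| <= M.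

Lemma lbm_bounded (a b : R) f : lbm f -> exists2 M : R, 0 < M &
  forall x, a <= x <= b -> `|f x| <= M.
Proof.
move=> [_ bf]; have [M hM] := bf (Num.max `|a| `|b|).
exists (`|M| + 1); first by rewrite ltr_wpDl.
move=> x /andP[ax xb]; apply: (@le_trans _ _ M); last first.
  by rewrite (le_trans (ler_norm _))// lerDl.
apply: hM; rewrite le_max; have [x0|x0] := leP 0 x.
  by apply/orP; right; rewrite ger0_norm// (le_trans xb)// ler_norm.
apply/orP; left; rewrite ltr0_norm// (@le_trans _ _ (- a)) ?lerN2//.
by rewrite -normrN ler_norm.
Qed.

Lemma lbm_cst (c : R) : lbm (fun=> c).
Proof. by split; [exact: measurable_cst|move=> r; exists `|c|]. Qed.

Lemma lbmD f g : lbm f -> lbm g -> lbm (fun x => f x + g x).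
Proof.
move=> [mf bf] [mg bg]; split; first exact: measurable_funD.
move=> r; have [M hM] := bf r; have [N hN] := bg r; exists (M + N) => x xr.
by rewrite (le_trans (ler_normD _ _))// lerD ?hM ?hN.
Qed.

Lemma lbmM f g : lbm f -> lbm g -> lbm (fun x => f x * g x).
Proof.
move=> [mf bf] [mg bg]; split; first exact: measurable_funM.
move=> r; have [M hM] := bf r; have [N hN] := bg r; exists (M * N) => x xr.
by rewrite normrM ler_pM ?hM ?hN.
Qed.

Lemma lbmZ (c : R) f : lbm f -> lbm (fun x => c * f x).
Proof. by move=> hf; apply: lbmM => //; exact: lbm_cst. Qed.

Lemma lbmN f : lbm f -> lbm (fun x => - f x).
Proof.
move=> hf; rewrite (_ : (fun x => - f x) = fun x => -1 * f x); last first.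
  by apply/funext => x; rewrite mulN1r.
exact: lbmZ.
Qed.

Lemma lbmB f g : lbm f -> lbm g -> lbm (fun x => f x - g x).
Proof. by move=> hf hg; apply: lbmD => //; exact: lbmN. Qed.

Lemma lbmX f n : lbm f -> lbm (fun x => f x ^+ n).
Proof.
move=> hf; elim: n => [|n ih]; first exact: lbm_cst.
by under eq_fun do rewrite exprS; exact: lbmM.
Qed.

Lemma lbm_norm f : lbm f -> lbm (fun x => `|f x|).
Proof.
move=> [mf bf]; split; first exact: measurableT_comp.
by move=> r; have [M hM] := bf r; exists M => x xr; rewrite normr_id hM.
Qed.

Lemma continuous_lbm f : continuous f -> lbm f.
Proof.
move=> cf; split; first exact: continuous_measurable_fun.
move=> r; have [r0|r0] := ltP r 0.
  by exists 0 => x xr; have := le_lt_trans xr r0; rewrite ltNge normr_ge0.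
have cNr : {within `[-r, r], continuous (fun x => `|f x|)}.
  apply: continuous_subspaceT => x.
  by apply: continuous_comp; [exact: cf|exact: norm_continuous].
have [|c _ hc] := EVT_max _ cNr; first by rewrite ge0_cp.
by exists `|f c| => x; rewrite ler_norml => xr; apply: hc; rewrite in_itv.
Qed.

Lemma lbm_if (c : R) f g : lbm f -> lbm g ->
  lbm (fun x => if x < c then f x else g x).
Proof.
move=> [mf bf] [mg bg]; split.
  apply: measurable_fun_ifT => //=.
  by apply: measurable_fun_ltr => //; exact: measurable_id.
move=> r; have [M hM] := bf r; have [N hN] := bg r; exists (Num.max M N) => x xr.
by case: ifP => _; rewrite le_max ?hM ?hN ?orbT.
Qed.

Lemma lbm_lt (c : R) f : lbm f -> lbm (fun x : R => (x < c)%R%:R * f x).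
Proof.
move=> hf; rewrite (_ : (fun _ => _) = fun x => if x < c then f x else 0).
  by apply: lbm_if => //; exact: lbm_cst.
by apply/funext => x; case: ifP => _; rewrite ?mul1r ?mul0r.
Qed.

Lemma lbm_le (c : R) f : lbm f -> lbm (fun x : R => (x <= c)%R%:R * f x).
Proof.
move=> hf; apply: lbmM => //; split.
  rewrite (_ : (fun _ => _) = fun x : R => if x <= c then 1 else 0); last first.
    by apply/funext => x; case: ifP.
  apply: measurable_fun_ifT => //=.
  by apply: measurable_fun_ler => //; exact: measurable_id.
by move=> r; exists 1 => x _; case: (x <= c); rewrite ?normr1 ?normr0.
Qed.

(** By density of the rationals, an open set is the countable union of the rational boxes it
    contains, and boxes lie in the product sigma-algebra. *)
Lemma measurable_rectangle_open (O : set (R * R)) : open O ->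
  measurable (O : set (measurableTypeR R * measurableTypeR R)%type).
Proof.
move=> oO.
pose box (a b c d : rat) : set (R * R) :=
  `](ratr a), (ratr b)[ `*` `](ratr c), (ratr d)[.
(* Boxes that leave [O] are replaced by the empty set, so that the union can run over all quadruples
   of rationals. *)
pose B a b c d : set (R * R) := if `[< box a b c d `<=` O >] then box a b c d else set0.
have -> : O = \bigcup_a \bigcup_b \bigcup_c \bigcup_d B a b c d.
  apply/seteqP; split => [[x y] Oxy|p]; last first.
    move=> [a _ [b _ [c _ [d _]]]]; rewrite /B; case: ifPn => // /asboolP H; exact: H.
  have := oO; rewrite openE => /(_ _ Oxy)[[A1 A2] /= [/= n1 n2]] sub.
  have /nbhs_ballP[e1 /= e10 b1] := n1; have /nbhs_ballP[e2 /= e20 b2] := n2.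
  have [a /[!in_itv]/= /andP[xa ax]] : exists q : rat, ratr q \in `]x - e1, x[.
    by apply: rat_in_itvoo; rewrite ltrBlDr ltrDl.
  have [b /[!in_itv]/= /andP[xb bx]] : exists q : rat, ratr q \in `]x, x + e1[.
    by apply: rat_in_itvoo; rewrite ltrDl.
  have [c /[!in_itv]/= /andP[yc cy]] : exists q : rat, ratr q \in `]y - e2, y[.
    by apply: rat_in_itvoo; rewrite ltrBlDr ltrDl.
  have [d /[!in_itv]/= /andP[yd dy]] : exists q : rat, ratr q \in `]y, y + e2[.
    by apply: rat_in_itvoo; rewrite ltrDl.
  exists a => //; exists b => //; exists c => //; exists d => //; rewrite /B.
  rewrite ifT; first by rewrite /box /= !in_itv /= ax xb cy yd.
  apply/asboolP => -[u v] [] /=; rewrite !in_itv/= => /andP[u1 u2] /andP[v1 v2].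
  by apply: sub; split; [apply: b1|apply: b2]; rewrite /ball/= ltr_norml; lra.
apply: bigcupT_measurable_rat => a; apply: bigcupT_measurable_rat => b.
apply: bigcupT_measurable_rat => c; apply: bigcupT_measurable_rat => d.
rewrite /B; case: ifPn => _; last exact: measurable0.
by apply: measurableX; exact: measurable_itv.
Qed.

Lemma lbm2_bounded (r : R) h : lbm2 h -> exists2 M : R, 0 < M &
  forall x y, `|x| <= r -> `|y| <= r -> `|h (x, y)| <= M.
Proof.
move=> [_ bh]; have [M hM] := bh r; exists (`|M| + 1); first by rewrite ltr_wpDl.
move=> x y xr yr; apply: le_trans (hM x y xr yr) _.
by rewrite (le_trans (ler_norm _))// lerDl.
Qed.

Lemma continuous_lbm2 h : continuous h -> lbm2 h.
Proof.
move=> ch; split.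
  apply: (measurability _ (RGenOpens.measurableE R)) => /= _ [_ [a [b ->] <-]].
  rewrite setTI; apply: measurable_rectangle_open.
  by move/continuousP : ch; apply; exact: interval_open.
move=> r; have [r0|r0] := ltP r 0.
  by exists 0 => x y xr; have := le_lt_trans xr r0; rewrite ltNge normr_ge0.
have cK : compact (`[-r, r] `*` `[-r, r] : set (R * R)).
  by apply: compact_setX; exact: segment_compact.
have : compact (h @` (`[-r, r] `*` `[-r, r])).
  by apply: continuous_compact => //; exact: continuous_subspaceT.
move=> /compact_bounded [M [_ HM]]; exists (M + 1) => x y xr yr.
apply: (HM (M + 1)); first by rewrite ltrDl.
by exists (x, y) => //; split; rewrite /= in_itv/= -ler_norml.
Qed.

Lemma lbm2M h k : lbm2 h -> lbm2 k -> lbm2 (fun p => h p * k p).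
Proof.
move=> [mf bf] [mg bg]; split; first exact: measurable_funM.
move=> r; have [M hM] := bf r; have [N hN] := bg r; exists (M * N) => x y xr yr.
by rewrite normrM ler_pM ?hM ?hN.
Qed.

Lemma lbm2_fst f : lbm f -> lbm2 (fun p => f p.1).
Proof.
move=> [mf bf]; split; first exact: measurableT_comp.
by move=> r; have [M hM] := bf r; exists M => x y xr _; exact: hM.
Qed.

Lemma lbm2_snd f : lbm f -> lbm2 (fun p => f p.2).
Proof.
move=> [mf bf]; split; first exact: measurableT_comp.
by move=> r; have [M hM] := bf r; exists M => x y _; exact: hM.
Qed.

Lemma lbm2_lt : lbm2 (fun p : R * R => (p.2 < p.1)%R%:R : R).
Proof.
split.
  rewrite (_ : (fun _ => _) = fun p : R * R => if p.2 < p.1 then 1 else 0); last first.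
    by apply/funext => p; case: ifP.
  apply: measurable_fun_ifT => //=.
  by apply: measurable_fun_ltr.
by move=> r; exists 1 => x y _ _; case: (_ < _); rewrite ?normr1 ?normr0.
Qed.

Lemma lbm2_swap h : lbm2 h -> lbm2 (fun p => h (p.2, p.1)).
Proof.
move=> [mf bf]; split.
  apply: measurableT_comp mf _.
  by apply: measurable_fun_pair.
by move=> r; have [M hM] := bf r; exists M => x y xr yr; exact: hM.
Qed.

Lemma lbm2_row h x : lbm2 h -> lbm (fun y => h (x, y)).
Proof.
move=> [mf bf]; split; first by apply: measurableT_comp mf _; exact: measurable_pair1.
move=> r; have [M hM] := bf (Num.max `|x| r); exists M => y yr.
by apply: hM; rewrite le_max ?lexx ?yr ?orbT.
Qed.

(** Compactness: finitely many neighbourhoods of finite measure cover the interval. *)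
Lemma locally_finite_itv mu (a b : R) : locally_finite mu ->
  (mu [set` `[a, b]] < +oo)%E.
Proof.
move=> lf.
have cK : compact (`[a, b] : set R) by exact: segment_compact.
move: cK; rewrite compact_cover.
pose V (x : R) := projT1 (cid2 (lf x)).
have oV x : open_nbhs x (V x) by rewrite /V; case: cid2.
have mV x : (mu (V x) < +oo)%E by rewrite /V; case: cid2.
case/(_ R setT V) => [x _|x _|D _ cov].
- by have [] := oV x.
- by exists x => //; have [] := oV x.
have meV i : measurable (V i : set (measurableTypeR R)).
  by apply: open_measurable; have [] := oV i.
have /(_ _ _) := @content_sub_fsum _ _ _ mu _ [set` D] [set` `[a, b]] V.
move=> /(_ (finite_fset D) (fun i _ => meV i) (measurable_itv _) cov).
move=> /le_lt_trans; apply; rewrite fsbig_finite//=.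
by apply: lte_sum_pinfty => i _; exact: mV.
Qed.

Lemma locally_finite_lebesgue : locally_finite (@lebesgue_measure R).
Proof.
move=> x; exists [set` `]x - 1, x + 1[].
  split; first exact: interval_open.
  by rewrite /= in_itv/= ltrBlDr ltrDl ltr01.
have /= := @lebesgue_measure_itv R `]x - 1, x + 1[.
by move=> ->; rewrite lte_fin ifT ?ltry//; lra.
Qed.


(** Both ends are included, so atoms of [mu] at [a] and [b] count; for [b < a] the interval is empty
    and the integral is 0. *)
Definition itg mu (a b : R) f := \int[mu]_(x in [set` `[a, b]]) f x.

Lemma Rintegral_support mu (D : set R) (c d : R) f :
  (forall x, ~~ (c <= x <= d) -> f x = 0) -> [set` `[c, d]] `<=` D ->
  \int[mu]_(x in D) f x = itg mu c d f.
Proof.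
move=> f0 sub; rewrite /itg Rintegral_mkcond [in RHS]Rintegral_mkcond.
apply: eq_Rintegral => x _; rewrite !patchE mem_setE in_itv/=.
have [xcd|xcd] := boolP (c <= x <= d); first by rewrite mem_set//; apply: sub; rewrite /= in_itv.
by rewrite f0//; case: ifP.
Qed.

Section Integral.
Variable mu : {measure set (measurableTypeR R) -> \bar R}.
Hypothesis mu_lf : locally_finite mu.

Lemma lbm_integrable (a b : R) f : lbm f -> mu.-integrable [set` `[a, b]] (EFin \o f).
Proof.
move=> [mf bf]; apply: measurable_bounded_integrable => //.
- exact: locally_finite_itv.
- exact: measurable_funTS.
have [M hM] := bf (Num.max `|a| `|b|).
exists M; split; first exact: num_real.
move=> N MN x /=; rewrite in_itv/= => /andP[ax xb].
apply: le_trans (ltW MN); apply: hM.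
rewrite le_max; have [x0|x0] := leP 0 x.
  by apply/orP; right; rewrite ger0_norm// (le_trans xb)// ler_norm.
apply/orP; left; rewrite ltr0_norm// (@le_trans _ _ (- a)) ?lerN2//.
by rewrite -normrN ler_norm.
Qed.

Lemma eq_itg (a b : R) f g : (forall x, a <= x <= b -> f x = g x) -> itg mu a b f = itg mu a b g.
Proof. by move=> fg; apply: eq_Rintegral => x /[!inE]/=; rewrite in_itv/= => /fg. Qed.

Lemma itgD (a b : R) f g : lbm f -> lbm g ->
  itg mu a b (fun x => f x + g x) = itg mu a b f + itg mu a b g.
Proof. by move=> hf hg; rewrite /itg RintegralD//; exact: lbm_integrable. Qed.

Lemma itgB (a b : R) f g : lbm f -> lbm g ->
  itg mu a b (fun x => f x - g x) = itg mu a b f - itg mu a b g.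
Proof. by move=> hf hg; rewrite /itg RintegralB//; exact: lbm_integrable. Qed.

Lemma itgZ (a b c : R) f : lbm f ->
  itg mu a b (fun x => c * f x) = c * itg mu a b f.
Proof. by move=> hf; rewrite /itg RintegralZl//; exact: lbm_integrable. Qed.

Lemma itgN (a b : R) f : lbm f ->
  itg mu a b (fun x => - f x) = - itg mu a b f.
Proof.
move=> hf; rewrite -mulN1r -itgZ//; apply: eq_itg => x _; by rewrite mulN1r.
Qed.

Lemma itg_cst (a b c : R) : itg mu a b (fun=> c) = c * itg mu a b (fun=> 1).
Proof.
by rewrite -(itgZ _ _ _ (lbm_cst 1)); apply: eq_itg => x _; rewrite mulr1.
Qed.

Lemma itg_le (a b : R) f g : lbm f -> lbm g -> (forall x, a <= x <= b -> f x <= g x) ->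
  itg mu a b f <= itg mu a b g.
Proof.
move=> hf hg fg; apply: le_Rintegral => //; try exact: lbm_integrable.
Qed.

Lemma itg_ge0 (a b : R) f : (forall x, a <= x <= b -> 0 <= f x) -> 0 <= itg mu a b f.
Proof. by move=> f0; apply: Rintegral_ge0 => x /=; rewrite in_itv/= => /f0. Qed.

Lemma itg_norm (a b : R) f : lbm f -> `|itg mu a b f| <= itg mu a b (fun x => `|f x|).
Proof. by move=> hf; apply: le_normr_Rintegral => //; exact: lbm_integrable. Qed.

Lemma itg_bound (a b M : R) f : lbm f -> (forall x, a <= x <= b -> `|f x| <= M) ->
  `|itg mu a b f| <= M * itg mu a b (fun=> 1).
Proof.
move=> hf fM; rewrite -itg_cst (le_trans (itg_norm _ _ hf))//.
by apply: itg_le => //; [exact: lbm_norm|exact: lbm_cst].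
Qed.

Lemma itg_subset (a b c d : R) f : lbm f -> a <= c -> d <= b -> (forall x, a <= x <= b -> 0 <= f x) ->
  itg mu c d f <= itg mu a b f.
Proof.
move=> hf ac db f0.
rewrite /itg -lee_fin /Rintegral !fineK; last 2 first.
- by apply: integrable_fin_num => //; exact: lbm_integrable.
- by apply: integrable_fin_num => //; exact: lbm_integrable.
apply: ge0_subset_integral => //.
- by apply/measurable_EFinP; apply: measurable_funTS; case: hf.
- by apply: subset_itv; rewrite bnd_simp.
Qed.

End Integral.

Section FubiniLocal.
Variables mu nu : {measure set (measurableTypeR R) -> \bar R}.
Hypotheses (mu_lf : locally_finite mu) (nu_lf : locally_finite nu).

Lemma lbm_restrict (a b : R) h : lbm2 h ->
  measurable_fun setT (fun p : R * R => (h p * \1_([set` `[a, b]]) p.2)%:E).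
Proof.
move=> [mh _]; apply/measurable_EFinP; apply: measurable_funM => //.
apply: (measurableT_comp _ measurable_snd).
by apply: measurable_indic.
Qed.

Lemma itgE mu0 (a b : R) f :
  itg mu0 a b f = fine (\int[mu0]_x (f x * \1_([set` `[a, b]]) x)%:E)%E.
Proof.
rewrite /itg Rintegral_mkcond /Rintegral; congr fine.
by apply: eq_integral => x _; rewrite patch_indic.
Qed.

Lemma sigma_finite_locally_finite mu0 : locally_finite mu0 -> sigma_finite setT mu0.
Proof.
move=> lf; exists (fun n => [set` `[- n%:R : R, n%:R]]).
  apply/esym; rewrite -subTset => x _ /=.
  exists (Num.truncn `|x|).+1 => //=; rewrite in_itv/= -ler_norml.
  by apply: ltW; exact: truncnS_gt.
by move=> n; split => //; exact: locally_finite_itv.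
Qed.

(** The sigma-finite structure required by Fubini's theorem is packed onto the same measure, so that
    results about [mu'] transfer to [mu0] by rewriting. *)
Lemma sigma_finite_version mu0 : locally_finite mu0 ->
  exists mu' : {sigma_finite_measure set (measurableTypeR R) -> \bar R},
    (mu' : {measure set (measurableTypeR R) -> \bar R}) = mu0.
Proof.
case: mu0 => s [c1 c2]; set mu0 := (X in locally_finite X) => lf.
have sf := sigma_finite_locally_finite lf.
pose H := @isSFinite.Build _ _ _ mu0 (sfinite_measure_sigma_finite sf).
pose H' := @isSigmaFinite.Build _ _ _ mu0 sf.
pose mu' : {sigma_finite_measure set (measurableTypeR R) -> \bar R} := HB.pack (Measure.sort mu0) H H'.
by exists mu'.
Qed.

Lemma lbm2_itg (a b : R) h : lbm2 h -> lbm (fun x => itg nu a b (fun y => h (x, y))).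
Proof.
move=> hh; split.
  have [nu' nu'E] := sigma_finite_version nu_lf.
  rewrite -nu'E; under eq_fun do rewrite itgE.
  apply: measurableT_comp; first exact: fine_measurable.
  under eq_fun do rewrite integralE.
  have key (k : measurableTypeR R * measurableTypeR R -> \bar R) :
      measurable_fun (setT : set (measurableTypeR R * measurableTypeR R)) k ->
      (forall p, (0 <= k p)%E) ->
      measurable_fun (setT : set (measurableTypeR R)) (fun x => \int[nu']_y k (x, y))%E.
    by move=> mk k0; have := @measurable_fun_fubini_tonelli_F _ _ _ _ _ nu' k mk k0.
  apply: emeasurable_funB.
    have mp := measurable_funepos (lbm_restrict a b hh).
    by have := key _ mp (funepos_ge0 _); rewrite !funepos.unlock.
  have mp := measurable_funeneg (lbm_restrict a b hh).
    by have := key _ mp (funeneg_ge0 _); rewrite !funeneg.unlock.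
move=> r; have [M hM] := hh.2 (Num.max r (Num.max `|a| `|b|)).
exists (M * itg nu a b (fun=> 1)) => x xr.
apply: itg_bound => //; first exact: lbm2_row.
move=> y /andP[ay yb]; apply: hM; first by rewrite le_max xr.
rewrite !le_max; have [y0|y0] := leP 0 y.
  by apply/orP; right; apply/orP; right; rewrite ger0_norm// (le_trans yb)// ler_norm.
apply/orP; right; apply/orP; left; rewrite ltr0_norm// (@le_trans _ _ (- a)) ?lerN2//.
by rewrite -normrN ler_norm.
Qed.

(** The rectangle has finite product measure and [h] is bounded on it, so the truncated function [k]
    is integrable; each indicator is then moved to the integral it belongs to. *)
Lemma itg_fubini (a b c d : R) h : lbm2 h ->
  itg mu a b (fun x => itg nu c d (fun y => h (x, y))) =
  itg nu c d (fun y => itg mu a b (fun x => h (x, y))).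
Proof.
move=> hh.
have [mu' mu'E] := sigma_finite_version mu_lf.
have [nu' nu'E] := sigma_finite_version nu_lf.
pose A := [set` `[a, b]]; pose B := [set` `[c, d]].
pose k := ((EFin \o h) \_ (A `*` B))%E.
have kE x y : (k (x, y) = (\1_A x)%:E * (h (x, y) * \1_B y)%:E)%E.
  rewrite /k patchE !indicE in_setX /=.
  by case: (x \in A); case: (y \in B); rewrite ?mulr1 ?mulr0 ?mul1e ?mul0e.
have ik : (mu' \x nu')%E.-integrable setT k.
  have mAB : measurable (A `*` B : set (measurableTypeR R * measurableTypeR R)).
    by apply: measurableX; exact: measurable_itv.
  apply: (integrable_mkcond (mu := (mu' \x nu')%E) (EFin \o h) mAB).1.
  apply: measurable_bounded_integrable => //.
  - rewrite (_ : _ (A `*` B) = mu' A * nu' B)%E; last first.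
      by apply: product_measure1E; exact: measurable_itv.
    have -> : mu' A = mu A by rewrite -[in RHS]mu'E.
    have -> : nu' B = nu B by rewrite -[in RHS]nu'E.
    apply: lte_mul_pinfty => //; first by rewrite ge0_fin_numE ?locally_finite_itv.
    exact: locally_finite_itv.
  - by apply: measurable_funTS; case: hh.
  have [M hM] := hh.2 (Num.max (Num.max `|a| `|b|) (Num.max `|c| `|d|)).
  exists M; split; first exact: num_real.
  have aux (u v x : R) : u <= x <= v -> `|x| <= Num.max `|u| `|v|.
    move=> /andP[ux xv]; rewrite le_max; have [x0|x0] := leP 0 x.
      by apply/orP; right; rewrite ger0_norm// (le_trans xv)// ler_norm.
    apply/orP; left; rewrite ltr0_norm// (@le_trans _ _ (- u)) ?lerN2//.
    by rewrite -normrN ler_norm.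
  move=> N MN [x y] /= []; rewrite /A /B/= !in_itv/= => /aux xA /aux yB.
  by apply: le_trans (ltW MN); apply: hM; rewrite le_max ?xA ?yB ?orbT.
have i1 x : mu.-integrable setT (fun y => (h (y, x) * \1_A y)%:E).
  have := (integrable_mkcond (mu := mu) (EFin \o (fun y => h (y, x))) (measurable_itv `[a, b])).1
    (lbm_integrable mu_lf a b (lbm2_row x (lbm2_swap hh))).
  apply: eq_integrable => // y _; rewrite patchE indicE.
  by case: (_ \in _); rewrite ?mulr1 ?mulr0.
have i2 x : nu.-integrable setT (fun y => (h (x, y) * \1_B y)%:E).
  have := (integrable_mkcond (mu := nu) (EFin \o (fun y => h (x, y))) (measurable_itv `[c, d])).1
    (lbm_integrable nu_lf c d (lbm2_row x hh)).
  apply: eq_integrable => // y _; rewrite patchE indicE.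
  by case: (_ \in _); rewrite ?mulr1 ?mulr0.
have FU : (\int[mu]_x \int[nu]_y k (x, y) = \int[nu]_y \int[mu]_x k (x, y))%E.
  by rewrite -mu'E -nu'E; have := Fubini ik.
rewrite itgE [RHS]itgE; congr fine; transitivity (\int[mu]_x \int[nu]_y k (x, y))%E.
  apply: eq_integral => x _; under [RHS]eq_integral do rewrite kE.
  rewrite integralZl// itgE -[in RHS](fineK (integrable_fin_num _ (i2 x)))//.
  by rewrite -EFinM mulrC.
rewrite FU; apply: eq_integral => y _.
transitivity (\int[mu]_x ((\1_B y)%:E * (h (x, y) * \1_A x)%:E))%E.
  apply: eq_integral => x _; rewrite kE -!EFinM; congr EFin; ring.
rewrite integralZl// itgE -[in LHS](fineK (integrable_fin_num _ (i1 y)))//.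
by rewrite -EFinM mulrC.
Qed.

End FubiniLocal.
End LocallyBounded.

#[global] Opaque lbm lbm2.

(** * The equation at a fixed time, tested with hat functions *)

Section Primitives.
Context {R : realType}.
Implicit Types (f g : R -> R) (mu : {measure set (measurableTypeR R) -> \bar R}).

Definition leb : {measure set (measurableTypeR R) -> \bar R} := @lebesgue_measure R.

Lemma leb_lf : locally_finite leb.
Proof. exact: locally_finite_lebesgue. Qed.

(** The strict cut-off leaves out an atom at [x]. Keeping the interval fixed and cutting inside the
    integrand makes the primitive a parameter integral of an [lbm2] function, hence measurable in
    [x]. *)
Definition prim mu (c d : R) f (x : R) : R :=
  itg mu c d (fun y => (y < x)%R%:R * f y).

Lemma itg_le_cut mu (c d x : R) f : x <= d ->
  itg mu c d (fun y => (y <= x)%R%:R * f y) = itg mu c x f.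
Proof.
move=> xd; rewrite /itg.
transitivity (\int[mu]_(y in [set` `[c, d]] `&` [set` `]-oo, x]]) f y).
  rewrite Rintegral_mkcondr; apply: eq_Rintegral => y _.
  by rewrite patchE mem_setE in_itv/=; case: (_ <= _); rewrite ?mul1r ?mul0r.
congr (Rintegral _ _ _); apply/seteqP; split => y /=; rewrite !in_itv/=.
  by move=> [/andP[-> _] ->].
by move=> /andP[-> yx]; rewrite yx (le_trans yx).
Qed.

(** The two integrands differ only at [x], a Lebesgue null set. *)
Lemma leb_lt_le (c d x : R) f : lbm f ->
  itg leb c d (fun y => (y < x)%R%:R * f y) = itg leb c d (fun y => (y <= x)%R%:R * f y).
Proof.
move=> hf; apply/eqP; rewrite -subr_eq0.
have l1 : lbm (fun y => (y < x)%R%:R * f y) by exact: lbm_lt.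
have l2 := lbm_le x hf.
rewrite -(itgB leb_lf) //.
transitivity (\int[leb]_(y in [set` `[c, d]] `&` [set x]) (- f y) == 0).
  rewrite Rintegral_mkcondr; congr (_ == _); apply: eq_Rintegral => y _.
  rewrite patchE; have [->|yx] := eqVneq y x.
    by rewrite mem_set// lexx ltxx mul0r sub0r mul1r.
  rewrite memNset//=; last exact/eqP.
  by rewrite (lt_neqAle y x) yx /= subrr.
rewrite /Rintegral integral_mkcondl.
by rewrite integral_set1/= eqxx.
Qed.

Lemma prim_leb (c d x : R) f : lbm f -> x <= d -> prim leb c d f x = itg leb c x f.
Proof. by move=> hf xd; rewrite /prim leb_lt_le// itg_le_cut. Qed.

Lemma itg1 mu (c d : R) : itg mu c d (fun=> 1) = fine (mu [set` `[c, d]]).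
Proof. by rewrite /itg Rintegral_cst// mul1r. Qed.

Lemma itg_leb1 (c d : R) : c <= d -> itg leb c d (fun=> 1) = d - c.
Proof.
move=> cd; rewrite itg1.
have /= E := @lebesgue_measure_itv R `[c, d].
transitivity (fine (if (c%:E < d%:E)%E then (d%:E - c%:E)%E else 0%E)); first by rewrite -E.
by rewrite lte_fin; case: ltgtP cd => //= ->; rewrite subrr.
Qed.

Lemma lbm_prim mu (c d : R) f : locally_finite mu -> lbm f -> lbm (prim mu c d f).
Proof.
move=> lf hf.
apply: (lbm2_itg lf c d (h := fun p => (p.2 < p.1)%R%:R * f p.2)).
by apply: lbm2M; [exact: lbm2_lt|exact: lbm2_snd].
Qed.

Lemma eq_prim mu (c d x : R) f g : (forall y, c <= y <= d -> f y = g y) ->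
  prim mu c d f x = prim mu c d g x.
Proof. by move=> fg; apply: eq_itg => y /fg ->. Qed.

Lemma primD mu (c d x : R) f g : locally_finite mu -> lbm f -> lbm g ->
  prim mu c d (fun y => f y + g y) x = prim mu c d f x + prim mu c d g x.
Proof.
move=> lf hf hg; rewrite /prim -(itgD lf); [|exact: lbm_lt..].
by apply: eq_itg => y _; rewrite mulrDr.
Qed.

Lemma primZ mu (c d x k : R) f : locally_finite mu -> lbm f ->
  prim mu c d (fun y => k * f y) x = k * prim mu c d f x.
Proof.
move=> lf hf; rewrite /prim -(itgZ lf); last exact: lbm_lt.
by apply: eq_itg => y _; rewrite mulrCA.
Qed.

(** Fubini on the triangle [y < x]: an integration by parts that tolerates atoms of [mu], since [<]
    and [<=] are exchanged only in the Lebesgue variable. *)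
Lemma itg_prim_mul mu (c d : R) f g : locally_finite mu -> lbm f -> lbm g ->
  itg leb c d (fun x => prim mu c d f x * g x) =
  itg mu c d (fun y => f y * (itg leb c d g - prim leb c d g y)).
Proof.
move=> lf hf hg.
transitivity (itg leb c d (fun x => itg mu c d (fun y => (y < x)%R%:R * f y * g x))).
  apply: eq_itg => x _; rewrite mulrC /prim -(itgZ lf); last exact: lbm_lt.
  by apply: eq_itg => y _; rewrite mulrC.
rewrite (itg_fubini leb_lf lf c d c d (h := fun p => (p.2 < p.1)%R%:R * f p.2 * g p.1)); last first.
  by do 2 ?apply: lbm2M; [exact: lbm2_lt|exact: lbm2_snd|exact: lbm2_fst].
apply: eq_itg => y _ /=.
transitivity (itg leb c d (fun x => f y * (g x - (x <= y)%R%:R * g x))).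
  apply: eq_itg => x _; rewrite ltNge; case: (x <= y) => /=; ring.
have l0 := lbm_lt y hg.
have l2 := lbm_le y hg.
by rewrite (itgZ leb_lf) ?(itgB leb_lf)//; [rewrite -leb_lt_le|exact: lbmB].
Qed.

(** The product rule in integrated form, obtained from [itg_prim_mul] by cutting both functions off
    at [x]. *)
Lemma prim_mul (c d x : R) f g : lbm f -> lbm g ->
  prim leb c d (fun y => f y * prim leb c d g y + prim leb c d f y * g y) x =
  prim leb c d f x * prim leb c d g x.
Proof.
move=> hf hg.
have hf1 := lbm_lt x hf; have hg1 := lbm_lt x hg.
have := itg_prim_mul c d leb_lf hf1 hg1.
have -> : itg leb c d (fun y => (y < x)%R%:R * g y) = prim leb c d g x by [].
have lP k : lbm k -> lbm (prim leb c d k) by move=> hk; exact: lbm_prim leb_lf hk.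
(* To the left of [x], cutting the integrand off at [x] does not change its primitive. *)
have cutE k y : prim leb c d (fun z => (z < x)%R%:R * k z) y * (y < x)%R%:R =
    prim leb c d k y * (y < x)%R%:R.
  have [yx|_] := ltP y x; rewrite ?mulr0// !mulr1.
  apply: eq_itg => z _; case: (ltP z y) => zy; rewrite ?mul0r// !mul1r.
  by rewrite (lt_trans zy yx) mul1r.
move=> E; transitivity (itg leb c d (fun y => prim leb c d (fun z => (z < x)%R%:R * f z) y * ((y < x)%R%:R * g y)) +
   itg leb c d (fun y => ((y < x)%R%:R * f y) * prim leb c d (fun z => (z < x)%R%:R * g z) y)).
  rewrite -(itgD leb_lf); last 2 first.
  - by apply: lbmM => //; exact: lP.
  - by apply: lbmM => //; exact: lP.
  apply: eq_itg => y _.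
  rewrite (_ : prim leb c d (fun z => (z < x)%R%:R * f z) y * ((y < x)%R%:R * g y) =
    prim leb c d (fun z => (z < x)%R%:R * f z) y * (y < x)%R%:R * g y); last by ring.
  rewrite (_ : (y < x)%R%:R * f y * prim leb c d (fun z => (z < x)%R%:R * g z) y =
    prim leb c d (fun z => (z < x)%R%:R * g z) y * (y < x)%R%:R * f y); last by ring.
  rewrite !cutE; ring.
rewrite E -(itgD leb_lf); last 2 first.
- by apply: lbmM => //; apply: lbmB; [exact: lbm_cst|exact: lP].
- by apply: lbmM => //; exact: lP.
rewrite mulrC /prim -(itgZ leb_lf); last exact: lbm_lt.
by apply: eq_itg => y _; ring.
Qed.


(** Absolute continuity with a bounded derivative, put in integral form: [v'] matters only almost
    everywhere, so jumps of [v'] at atoms of [m] are allowed. *)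
Definition primitive_on (c d : R) (v v' : R -> R) : Prop :=
  lbm v' /\ forall x, c <= x <= d -> v x = v c + prim leb c d v' x.

Lemma primitive_onM (c d : R) v v' z z' : lbm v -> lbm z ->
  primitive_on c d v v' -> primitive_on c d z z' ->
  primitive_on c d (fun x => v x * z x) (fun x => v' x * z x + v x * z' x).
Proof.
move=> lv lz [lv' hv] [lz' hz]; split; first by apply: lbmD; exact: lbmM.
move=> x xcd; rewrite hv// hz//.
pose V := prim leb c d v'; pose Z := prim leb c d z'.
have lV : lbm V := lbm_prim c d leb_lf lv'; have lZ : lbm Z := lbm_prim c d leb_lf lz'.
rewrite (@eq_prim _ c d x (fun y => v' y * z y + v y * z' y) (fun y => (z c * v' y + v c * z' y) + (v' y * Z y + V y * z' y))).
  have lvz : lbm (fun y => v' y * Z y + V y * z' y) by apply: lbmD; exact: lbmM.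
  rewrite primD ?prim_mul ?primD ?primZ; do ?[done|exact: leb_lf|exact: lbmZ|apply: lbmD; exact: lbmZ].
  by rewrite -/V -/Z; ring.
by move=> y ycd; rewrite hv// hz// -/V -/Z; ring.
Qed.

Lemma primitive_on_itg (c d : R) v v' : c <= d -> primitive_on c d v v' ->
  itg leb c d v' = v d - v c.
Proof.
move=> cd [lv' hv]; rewrite (hv d) ?cd ?lexx// prim_leb// addrC addKr //.
Qed.

(** The hat with feet [c], [d] and peak [x], meant for [c <= z <= d]. Its affine pieces continue
    below 0 outside, where it is never integrated. *)
Definition hat (c x d z : R) : R :=
  if z < x then (z - c) / (x - c) else (d - z) / (d - x).

Definition hat' (c x d z : R) : R :=
  if z < x then (x - c)^-1 else - (d - x)^-1.

Lemma lbm_hat (c x d : R) : lbm (hat c x d).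
Proof.
apply: lbm_if; apply: lbmM; try exact: lbm_cst; apply: continuous_lbm => z;
  [apply: cvgB|apply: cvgB]; do ?[exact: cvg_id|exact: cvg_cst].
Qed.

Lemma lbm_hat' (c x d : R) : lbm (hat' c x d).
Proof. by apply: lbm_if; exact: lbm_cst. Qed.

Lemma hat01 (c x d z : R) : c < x -> x < d -> c <= z <= d -> 0 <= hat c x d z <= 1.
Proof.
move=> cx xd /andP[cz zd]; rewrite /hat; case: ltP => zx.
  rewrite divr_ge0 ?subr_ge0 ?(ltW cx)//= ler_pdivrMr ?subr_gt0// mul1r; lra.
rewrite divr_ge0 ?subr_ge0 ?(ltW xd)//= ler_pdivrMr ?subr_gt0// mul1r; lra.
Qed.

Lemma prim_lebcut (c d x y : R) : c <= x -> x <= d -> c <= y ->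
  prim leb c d (fun z => (z < x)%R%:R) y = Num.min x y - c.
Proof.
move=> cx xd cy.
transitivity (prim leb c d (fun=> 1) (Num.min x y)); last first.
  rewrite prim_leb ?itg_leb1 ?le_min ?cx//; last by rewrite ge_min xd.
  exact: lbm_cst.
apply: eq_itg => z _; rewrite mulr1 lt_min.
by case: (z < x); case: (z < y); rewrite ?mulr1 ?mulr0.
Qed.

Lemma lbm_cut (x : R) : lbm (fun z : R => (z < x)%R%:R : R).
Proof.
rewrite (_ : (fun _ => _) = fun z => (z < x)%R%:R * 1); first by apply: lbm_lt; exact: lbm_cst.
by apply/funext => z; rewrite mulr1.
Qed.

Lemma primitive_hat (c x d : R) : c < x -> x < d -> primitive_on c d (hat c x d) (hat' c x d).
Proof.
move=> cx xd; split; first exact: lbm_hat'.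
have p1 : x - c != 0 by rewrite subr_eq0 gt_eqF.
have p2 : d - x != 0 by rewrite subr_eq0 gt_eqF.
move=> y /andP[cy yd]; rewrite [hat c x d c]/hat cx subrr mul0r add0r.
rewrite (@eq_prim _ _ _ _ _ (fun z => ((x - c)^-1 + (d - x)^-1) * (z < x)%R%:R + (- (d - x)^-1) * 1)).
  rewrite primD ?primZ; do ?[exact: leb_lf|exact: lbm_cst|exact: lbm_cut|apply: lbmZ].
  rewrite prim_lebcut ?(ltW cx) ?(ltW xd)// prim_leb//; last exact: lbm_cst.
  rewrite itg_leb1// /hat; case: (ltP y x) => yx.
    by field; rewrite p1 p2.
  by field; rewrite p1 p2.
by move=> z _; rewrite /hat'; case: ltP => zx /=; ring.
Qed.

End Primitives.

(** * The flux of a solution and its energy identities *)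

Section FixedTime.
Context {R : realType} (m : {measure set (measurableTypeR R) -> \bar R}).
Hypothesis m_lf : locally_finite m.
Implicit Types (v w : R -> R).

(** The weak form of [v'' = 2 w m] tested with a hat: the second derivative of the hat consists of
    the point masses [1 / (x - c)] at [c], [1 / (d - x)] at [d] and minus their sum at [x], so that
    only values of [v] appear. *)
Definition hat_identity (v w : R -> R) (c x d : R) : Prop :=
  v c / (x - c) + v d / (d - x) - ((x - c)^-1 + (d - x)^-1) * v x =
  2 * itg m c d (fun z => hat c x d z * w z).

Definition flux (c d : R) (v w v' : R -> R) : Prop :=
  primitive_on c d v v' /\
  forall psi psi', lbm psi -> primitive_on c d psi psi' -> psi c = 0 -> psi d = 0 ->
    itg leb c d (fun x => v' x * psi' x) = - 2 * itg m c d (fun x => w x * psi x).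

(** The derivative is explicit: a constant [p] plus twice [W], the [m]-primitive of [w]. The hat
    identities say exactly that its integral reproduces [v], and [itg_prim_mul] turns it into the
    weak equation for every [psi] vanishing at both ends. *)
Lemma flux_exists (c d : R) v w : c < d -> lbm v -> lbm w ->
  (forall x, c < x < d -> hat_identity v w c x d) -> exists v', flux c d v w v'.
Proof.
move=> cd lv lw H.
pose K := itg m c d (fun z => (d - z) * w z).
(* The slope for which the primitive of [p + 2 * W] leads from [v c] to [v d]; the integral of [W]
   over [[c, d]] is [K]. *)
pose p := (v d - v c - 2 * K) / (d - c).
have dc : d - c != 0 by rewrite subr_eq0 gt_eqF.
pose W := prim m c d w.
have lW : lbm W := lbm_prim c d m_lf lw.
exists (fun x => p + 2 * W x); split; last first.
  move=> psi psi' lpsi hpsi p0 pd; have [lpsi' Epsi] := hpsi.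
  have I0 : itg leb c d psi' = 0.
    by rewrite (primitive_on_itg (ltW cd) hpsi) p0 pd subrr.
  transitivity (p * itg leb c d psi' + 2 * itg leb c d (fun x => W x * psi' x)).
    rewrite -!(itgZ leb_lf)//; last exact: lbmM.
    rewrite -(itgD leb_lf); do ?[exact: lbmZ|apply: lbmZ; exact: lbmM].
    by apply: eq_itg => x _; ring.
  rewrite itg_prim_mul// I0 mulr0 add0r mulNr -mulrN; congr (_ * _).
  rewrite -(itgN m_lf); last exact: lbmM.
  by apply: eq_itg => x xcd; rewrite Epsi// p0; ring.
split; first by apply: lbmD; [exact: lbm_cst|exact: lbmZ].
have lid : lbm (fun z : R => z) by apply: continuous_lbm => z; exact: cvg_id.
(* By Fubini the primitive of [W] integrates [w] against the positive part of [x - z], here written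
   with [Num.min]. *)
pose J x := itg m c d (fun z => (x - Num.min x z) * w z).
have lmin x : lbm (fun z : R => x - Num.min x z).
  apply: lbmB; first exact: lbm_cst.
  have -> : Num.min x = (fun z => if z < x then z else x).
    by apply/funext => z; rewrite minC.
  by apply: lbm_if => //; exact: lbm_cst.
have PW x : c <= x <= d -> prim leb c d W x = J x.
  move=> /andP[cx xd].
  transitivity (itg leb c d (fun z => W z * (z < x)%R%:R)).
    by apply: eq_itg => z _; rewrite mulrC.
  rewrite itg_prim_mul//; last exact: lbm_cut.
  apply: eq_itg => z /andP[cz zd]; rewrite prim_lebcut//.
  have -> : itg leb c d (fun z0 => (z0 < x)%R%:R) = x - c.
    rewrite -(itg_leb1 cx) -(prim_leb c (lbm_cst 1) xd); apply: eq_itg => t _.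
    by rewrite mulr1.
  ring.
move=> x xcd; rewrite primD; [|exact: leb_lf|exact: lbm_cst|exact: lbmZ].
rewrite (primZ c d x 2 leb_lf lW) PW//; have /andP[cx xd] := xcd.
have -> : prim leb c d (fun=> p) x = p * (x - c).
  have -> := prim_leb c (lbm_cst p) xd.
  have -> := itg_cst leb_lf c x p.
  by have -> := itg_leb1 cx.
have JK : J d = K.
  by apply: eq_itg => z /andP[_ zd]; rewrite min_r.
have J0 : J c = 0.
  rewrite /J (@eq_itg _ _ _ _ _ (fun=> 0)).
    by rewrite (itg_cst m_lf) mul0r.
  by move=> z /andP[cz _]; rewrite min_l// subrr mul0r.
have [->|xc] := eqVneq x c; first by rewrite J0; ring.
have [->|xd'] := eqVneq x d; first by rewrite JK /p; field.
have cx' : c < x by rewrite lt_neqAle eq_sym xc.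
have xdlt : x < d by rewrite lt_neqAle xd'.
have p1 : x - c != 0 by rewrite subr_eq0 gt_eqF.
have p2 : d - x != 0 by rewrite subr_eq0 gt_eqF.
have := H x; rewrite cx' xdlt => /(_ isT); rewrite /hat_identity.
(* On [[c, d]] the hat is a linear combination of [d - z] and of the positive part of [x - z]. *)
have -> : itg m c d (fun z => hat c x d z * w z) =
    (x - c) * ((x - c)^-1 * (d - x)^-1) * K - (d - c) * ((x - c)^-1 * (d - x)^-1) * J x.
  rewrite /K /J -!(itgZ m_lf); do ?[exact: lbmM].
  rewrite -(itgB m_lf); do ?[apply: lbmZ; exact: lbmM].
  - apply: eq_itg => z _; rewrite /hat; case: ltP => zx.
      by field; rewrite p1 p2.
    by field; rewrite p1 p2.
  - by apply: lbmZ; apply: lbmM => //; apply: lbmB => //; exact: lbm_cst.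
  - by apply: lbmM => //; apply: lbmB => //; exact: lbm_cst.
move=> E.
have E2 : (d - c) * v x = v c * (d - x) + v d * (x - c) - 2 * ((x - c) * K - (d - c) * J x).
  transitivity (v c * (d - x) + v d * (x - c) -
    (v c / (x - c) + v d / (d - x) - ((x - c)^-1 + (d - x)^-1) * v x) * ((x - c) * (d - x))).
    by field; rewrite p1 p2.
  by rewrite E; field; rewrite p1 p2.
apply: (mulfI dc); rewrite E2 /p; field => //.
Qed.

(** Test with [v] times the hat. The cross term is half the derivative of [v ^+ 2] times [hat'], and
    [hat'] is constant on either side of [x], so it integrates to values of [v ^+ 2] at [c], [x] and
    [d]. *)
Lemma flux_energy (c x d : R) v w v' : c < x -> x < d -> lbm v -> lbm w ->
  flux c d v w v' ->
  itg leb c d (fun z => v' z ^+ 2 * hat c x d z) =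
  2^-1 * (v c ^+ 2 / (x - c) + v d ^+ 2 / (d - x) - ((x - c)^-1 + (d - x)^-1) * v x ^+ 2)
  - 2 * itg m c d (fun z => hat c x d z * (w z * v z)).
Proof.
move=> cx xd lv lw [pv hv].
have cd : c < d := lt_trans cx xd.
have lh := lbm_hat c x d; have lh' := lbm_hat' c x d; have lv' := pv.1.
have ph := primitive_hat cx xd.
have := hv _ _ (lbmM lv lh) (primitive_onM lv lh pv ph).
rewrite [hat c x d c]/hat cx [hat c x d d]/hat ltNge (ltW xd) /= !subrr !mul0r !mulr0.
move=> /(_ erefl erefl).
have pvv := primitive_onM lv lv pv pv.
have l2 : lbm (fun z => v' z * v z + v z * v' z) by case: pvv.
have Ix : prim leb c d (fun z => v' z * v z + v z * v' z) x = v x * v x - v c * v c.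
  by have [_ ->] := pvv; rewrite ?(ltW cx) ?(ltW xd)// addrC addKr.
have Id := primitive_on_itg (ltW cd) pvv.
have -> : itg leb c d (fun z => v' z * (v' z * hat c x d z + v z * hat' c x d z)) =
   itg leb c d (fun z => v' z ^+ 2 * hat c x d z) +
   (2^-1 * ((x - c)^-1 + (d - x)^-1) * prim leb c d (fun z => v' z * v z + v z * v' z) x
    - 2^-1 * (d - x)^-1 * itg leb c d (fun z => v' z * v z + v z * v' z)).
  rewrite /prim -!(itgZ leb_lf)//; last exact: lbm_lt.
  rewrite -(itgB leb_lf); do ?[apply: lbmZ; exact: lbm_lt|exact: lbmZ].
  rewrite -(itgD leb_lf).
  - apply: eq_itg => z _; rewrite /hat'; case: (z < x) => /=; field.
    by rewrite !subr_eq0 !gt_eqF.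
    by rewrite !subr_eq0 !gt_eqF.
  - by apply: lbmM => //; exact: lbmX.
  - by apply: lbmB; apply: lbmZ => //; exact: lbm_lt.
rewrite Ix Id => E.
have -> : itg m c d (fun z => hat c x d z * (w z * v z)) = itg m c d (fun z => w z * (v z * hat c x d z)).
  by apply: eq_itg => z _; ring.
rewrite !expr2; lra.
Qed.

(** Used with [z] the time derivative of [y]: the equation for [y] is tested with [hat ^+ 2 * z].
    Thanks to the square, a factor [hat] remains for [y'] even when the other one is differentiated,
    so every Young term in [y'] is bounded by the energy weighted with the hat. *)
Lemma flux_gain (c x d k th : R) (y z w y' z' : R -> R) : c < x -> x < d -> 0 < th ->
  (x - c)^-1 <= k -> (d - x)^-1 <= k -> lbm y -> lbm z -> lbm w ->
  flux c d y z y' -> flux c d z w z' ->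
  2 * itg m c d (fun s => hat c x d s ^+ 2 * z s ^+ 2) <=
  2 * th^-1 * itg leb c d (fun s => y' s ^+ 2 * hat c x d s) +
  th * itg leb c d (fun s => z' s ^+ 2 * hat c x d s) +
  th * k ^+ 2 * itg leb c d (fun s => z s ^+ 2).
Proof.
move=> cx xd th0 ak bk ly lz lw [py hy] [pz hz].
have cd : c < d := lt_trans cx xd.
have lh := lbm_hat c x d; have lh' := lbm_hat' c x d; have ly' := py.1; have lz' := pz.1.
have ph := primitive_hat cx xd.
have := hy _ _ (lbmM lh (lbmM lh lz)) (primitive_onM lh (lbmM lh lz) ph (primitive_onM lh lz ph pz)).
rewrite [hat c x d c]/hat cx [hat c x d d]/hat ltNge (ltW xd) /= !subrr !mul0r.
move=> /(_ erefl erefl).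
have -> : itg m c d (fun s => z s * (hat c x d s * (hat c x d s * z s))) =
   itg m c d (fun s => hat c x d s ^+ 2 * z s ^+ 2).
  by apply: eq_itg => s _; ring.
move=> E.
have {E} -> : 2 * itg m c d (fun s => hat c x d s ^+ 2 * z s ^+ 2) =
   - itg leb c d (fun s => y' s * (hat' c x d s * (hat c x d s * z s) + hat c x d s * (hat' c x d s * z s + hat c x d s * z' s))).
  by rewrite E; ring.
have lI1 : lbm (fun s => y' s ^+ 2 * hat c x d s) by apply: lbmM => //; exact: lbmX.
have lI2 : lbm (fun s => z' s ^+ 2 * hat c x d s) by apply: lbmM => //; exact: lbmX.
have lI3 : lbm (fun s => z s ^+ 2) by exact: lbmX.
rewrite -(itgN leb_lf); last by do 6 ?[assumption|apply: lbmD|apply: lbmM].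
rewrite -!(itgZ leb_lf)// -!(itgD leb_lf); do ?[exact: lbmZ|apply: lbmD; exact: lbmZ].
apply: (itg_le leb_lf).
- by apply: lbmN; do 6 ?[assumption|apply: lbmD|apply: lbmM].
- by apply: lbmD; [apply: lbmD|]; exact: lbmZ.
move=> s scd; have /andP[h0 h1] := hat01 cx xd scd.
have hk : hat' c x d s ^+ 2 <= k ^+ 2.
  rewrite /hat'; case: ifP => _; rewrite ?sqrrN ler_sqr ?nnegrE ?invr_ge0 ?subr_ge0 ?(ltW cx) ?(ltW xd)//.
    by rewrite (le_trans _ ak) ?invr_ge0 ?subr_ge0 ?(ltW cx).
  by rewrite (le_trans _ bk) ?invr_ge0 ?subr_ge0 ?(ltW xd).
set H := hat c x d s in h0 h1 *; set Hp := hat' c x d s in hk *.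
set Y := y' s; set Z := z s; set Zp := z' s.
have thi : th * th^-1 = 1 by rewrite divff// gt_eqF.
set ti := th^-1 in thi *.
have ti0 : 0 < ti by rewrite invr_gt0.
have H2 : H ^+ 2 <= H by rewrite expr2 ler_piMr.
(* two instances of Young's inequality *)
have A1 : - (2 * Y * H * (Hp * Z)) <= ti * (Y * H) ^+ 2 + th * (Hp * Z) ^+ 2.
  have : 0 <= th * (ti * (Y * H) + Hp * Z) ^+ 2 by rewrite mulr_ge0 ?sqr_ge0 ?(ltW th0).
  have -> : th * (ti * (Y * H) + Hp * Z) ^+ 2 = (th * ti) * ti * (Y * H) ^+ 2 + 2 * (th * ti) * (Y * H) * (Hp * Z) + th * (Hp * Z) ^+ 2 by ring.
  rewrite thi; lra.
have A2 : - (Y * H * (H * Zp)) <= ti * (Y * H) ^+ 2 + th * (H * Zp) ^+ 2.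
  have : 0 <= th * (ti * (Y * H) + H * Zp) ^+ 2 by rewrite mulr_ge0 ?sqr_ge0 ?(ltW th0).
  have -> : th * (ti * (Y * H) + H * Zp) ^+ 2 = (th * ti) * ti * (Y * H) ^+ 2 + 2 * (th * ti) * (Y * H) * (H * Zp) + th * (H * Zp) ^+ 2 by ring.
  have : 0 <= ti * (Y * H) ^+ 2 + th * (H * Zp) ^+ 2 by rewrite addr_ge0// mulr_ge0 ?sqr_ge0 ?(ltW th0) ?(ltW ti0).
  rewrite thi; lra.
have B1 : ti * (Y * H) ^+ 2 <= ti * (Y ^+ 2 * H).
  by rewrite ler_pM2l// exprMn ler_wpM2l ?sqr_ge0.
have B2 : th * (H * Zp) ^+ 2 <= th * (Zp ^+ 2 * H).
  by rewrite ler_pM2l// exprMn mulrC ler_wpM2l ?sqr_ge0.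
have B3 : th * (Hp * Z) ^+ 2 <= th * k ^+ 2 * Z ^+ 2.
  by rewrite -mulrA ler_pM2l// exprMn ler_wpM2r ?sqr_ge0.
lra.
Qed.

End FixedTime.

(** * Energy estimates for smooth solutions *)

Section Calculus.
Context {R : realType}.
Implicit Types (f g : R -> R).

Lemma cont_id : continuous (fun t : R => t).
Proof. by move=> t; exact: cvg_id. Qed.

Lemma cont_cst (k : R) : continuous (fun _ : R => k).
Proof. by move=> t; exact: cvg_cst. Qed.

Lemma contM f g : continuous f -> continuous g -> continuous (fun t : R => f t * g t).
Proof. by move=> cf cg t; apply: cvgM; [exact: cf|exact: cg]. Qed.

Lemma contD f g : continuous f -> continuous g -> continuous (fun t : R => f t + g t).
Proof. by move=> cf cg t; apply: cvgD; [exact: cf|exact: cg]. Qed.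

Lemma contB f g : continuous f -> continuous g -> continuous (fun t : R => f t - g t).
Proof. by move=> cf cg t; apply: cvgB; [exact: cf|exact: cg]. Qed.

Lemma is_derive_continuous g (l t : R) : is_derive t (1 : R) g l -> {for t, continuous g}.
Proof.
by move=> dg; apply: differentiable_continuous; apply/derivable1_diffP; have [] := dg.
Qed.

Lemma itg_FTC (a b : R) f g : a <= b ->
  (forall t, a <= t <= b -> is_derive t (1 : R) g (f t)) ->
  continuous f -> itg leb a b f = g b - g a.
Proof.
move=> ab dg cf; have [->|ab'] := eqVneq a b.
  rewrite subrr /itg set_itv1 Rintegral_set1 //.
have {}ab : a < b by rewrite lt_neqAle ab'.
rewrite /itg /Rintegral (@continuous_FTC2 _ f g a b) //.
- exact: continuous_subspaceT.
- have oc t : t \in `]a, b[ -> a <= t <= b.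
    by rewrite in_itv/= => /andP[? ?]; rewrite !ltW.
  split.
  + by move=> t /oc tab; have [] := dg t tab.
  + by apply: cvg_at_right_filter; apply: is_derive_continuous (dg a _); rewrite lexx ltW.
  + by apply: cvg_at_left_filter; apply: is_derive_continuous (dg b _); rewrite lexx ltW.
- move=> t; rewrite in_itv/= => /andP[at_ tb].
  by rewrite derive1E; have [_ ->] := dg t (introT andP (conj (ltW at_) (ltW tb))).
Qed.

Lemma local_primitive (a : R) f t : continuous f -> a < t ->
  is_derive t (1 : R) (fun x => itg leb a x f) (f t).
Proof.
move=> cf at_.
have [] := @continuous_FTC1 R f (BLeft a) t (t + 1).
- by rewrite ltrDl.
- by apply: lbm_integrable; [exact: leb_lf|exact: continuous_lbm].
- by [].
- exact: cf.
by move=> df E; apply: DeriveDef; [exact: df|rewrite -derive1E; exact: E].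
Qed.

Lemma continuous_shift f (u : R) : continuous f -> continuous (fun t => f (t + u)).
Proof.
move=> cf t; apply: (@continuous_comp _ _ _ (fun t => t + u) f); last exact: cf.
by apply: cvgD; [exact: cvg_id|exact: cvg_cst].
Qed.

Lemma is_derive_shift g (u t l : R) : is_derive (t + u) (1 : R) g l ->
  is_derive t (1 : R) (fun t => g (t + u)) l.
Proof.
move=> dg; have d1 : is_derive t (1 : R) (fun t => t + u) 1.
  by apply: is_derive_eq; rewrite addr0.
by have := @is_derive1_comp R g (fun t => t + u) t l 1 dg d1; rewrite mulr1.
Qed.

Lemma itg_split (a b c : R) f : lbm f -> a <= b -> b <= c ->
  itg leb a c f = itg leb a b f + itg leb b c f.
Proof.
move=> lf ab bc.
rewrite -(itg_le_cut leb a f bc) -(leb_lt_le a c b lf).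
have <- : itg leb a c (fun y => (b <= y)%R%:R * f y) = itg leb b c f.
  rewrite /itg.
  transitivity (\int[leb]_(y in [set` `[a, c]] `&` [set` `[b, +oo[]) f y).
    rewrite Rintegral_mkcondr; apply: eq_Rintegral => y _.
    by rewrite patchE mem_setE in_itv/= andbT; case: (_ <= _); rewrite ?mul1r ?mul0r.
  congr (Rintegral _ _ _); apply/seteqP; split => y /=; rewrite !in_itv/=.
    by move=> [/andP[_ ->] /andP[-> _]].
  by move=> /andP[by_ ->]; rewrite by_ (le_trans ab by_).
have l1 := lbm_lt b lf.
have l2 : lbm (fun y => (b <= y)%R%:R * f y).
  rewrite (_ : (fun y => _) = fun y => f y - (y < b)%R%:R * f y); first exact: lbmB.
  by apply/funext => y; rewrite leNgt; case: (_ < _) => /=; ring.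
rewrite -(itgD leb_lf)//; apply: eq_itg => y _.
by rewrite leNgt; case: (_ < _) => /=; ring.
Qed.

Lemma itg_shift (a b u : R) f : a <= b -> continuous f ->
  itg leb a b (fun t => f (t + u)) = itg leb (a + u) (b + u) f.
Proof.
(* A base point strictly to the left of both intervals, so that one primitive [G] is differentiable
   on each of them. *)
move=> ab cf; pose a0 := Num.min a (a + u) - 1.
have a1 : a0 < a.
  have : Num.min a (a + u) <= a by rewrite ge_min lexx.
  by rewrite /a0; lra.
have a2 : a0 < a + u.
  have : Num.min a (a + u) <= a + u by rewrite ge_min lexx orbT.
  by rewrite /a0; lra.
pose G x := itg leb a0 x f.
have dG x : a0 < x -> is_derive x (1 : R) G (f x) by move=> ?; exact: local_primitive.
have -> : itg leb a b (fun t => f (t + u)) = G (b + u) - G (a + u).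
  apply: (@itg_FTC a b _ (fun t => G (t + u))) => //; last exact: continuous_shift.
  move=> t /andP[at_ _]; apply: is_derive_shift; apply: dG.
  by rewrite (lt_le_trans a2)// lerD2r.
apply/esym/itg_FTC => //; first by rewrite lerD2r.
by move=> t /andP[/(lt_le_trans a2) ? _]; exact: dG.
Qed.

(** The weight [(t - a) * (b - t)] vanishes at both ends, so integrating by parts leaves no boundary
    term. *)
Lemma itg_parts_square (a b : R) f g : a <= b -> (forall t, is_derive t (1 : R) g (f t)) ->
  continuous f ->
  itg leb a b (fun t => (t - a) * (b - t) * (2 * (f t * g t))) =
  - itg leb a b (fun t => (a + b - 2 * t) * g t ^+ 2).
Proof.
move=> ab dg cf.
have cg : continuous g.
  by move=> t; exact: is_derive_continuous (dg t).
have c1 : continuous (fun t : R => (t - a) * (b - t) * (2 * (f t * g t))).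
  apply: contM; last by apply: contM; [exact: cont_cst|exact: contM].
  by apply: contM; apply: contB; [exact: cont_id|exact: cont_cst|exact: cont_cst|exact: cont_id].
have c2 : continuous (fun t : R => (a + b - 2 * t) * (g t * g t)).
  apply: contM; last exact: contM.
  by apply: contB; [exact: cont_cst|apply: contM; [exact: cont_cst|exact: cont_id]].
have := @itg_FTC a b (fun t => (t - a) * (b - t) * (2 * (f t * g t)) + (a + b - 2 * t) * (g t * g t))
  (fun t => (t - a) * (b - t) * (g t * g t)) ab.
rewrite (itgD leb_lf); [|exact: continuous_lbm..].
rewrite !subrr !(mul0r, mulr0) subr0 => H.
apply/eqP; rewrite -addr_eq0; apply/eqP.
rewrite -[RHS]H; first by congr (_ + _); apply: eq_itg => t _; rewrite expr2.
- move=> t _; have dgt := dg t.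
  apply: is_derive_eq; rewrite /GRing.scale /=; ring.
- exact: contD.
Qed.


Lemma continuous_row (h : R * R -> R) (x : R) : continuous h -> continuous (fun t => h (x, t)).
Proof.
move=> ch t; apply: (@continuous_comp _ _ _ (fun t => (x, t)) h); last exact: ch.
move=> A [[B C] /= [Bx Ct] sub]; apply: filterS Ct => s Cs; apply: sub.
by split => //=; exact: nbhs_singleton Bx.
Qed.

Lemma continuous_col (h : R * R -> R) (t : R) : continuous h -> continuous (fun x => h (x, t)).
Proof.
move=> ch x; apply: (@continuous_comp _ _ _ (fun x => (x, t)) h); last exact: ch.
move=> A [[B C] /= [Bx Ct] sub]; apply: filterS Bx => s Cs; apply: sub.
by split => //=; exact: nbhs_singleton Ct.
Qed.

End Calculus.

Section SmoothSolutions.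
Context {R : realType} (m : {measure set (measurableTypeR R) -> \bar R}).
Hypothesis m_lf : locally_finite m.

(* [F n] is the n-th time derivative of a solution that is smooth in time;
   [2 m U_t = U_xx] is expressed at each time by testing with hat functions. *)
Definition smooth_solution (F : nat -> R -> R -> R) : Prop :=
  [/\ forall n, continuous (fun p : R * R => F n p.1 p.2),
      forall n x t, is_derive t (1 : R) (F n x) (F n.+1 x t) &
      forall n t c x d, 0 < t -> c < x -> x < d ->
        hat_identity m (F n ^~ t) (F n.+1 ^~ t) c x d].

Lemma smooth_solution_shift F : smooth_solution F -> smooth_solution (fun n => F n.+1).
Proof. by case=> cF dF hF; split => n; [exact: cF|exact: dF|exact: hF]. Qed.

Section Estimates.
Variable F : nat -> R -> R -> R.
Hypothesis solF : smooth_solution F.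

Lemma sol_cont_t n x : continuous (F n x).
Proof. by case: solF => cF _ _; have := @continuous_row R _ x (cF n). Qed.

Lemma sol_cont_x n t : continuous (F n ^~ t).
Proof. by case: solF => cF _ _; have := @continuous_col R _ t (cF n). Qed.

Lemma sol_lbm_t n x : lbm (F n x).
Proof. by apply: continuous_lbm; exact: sol_cont_t. Qed.

Lemma sol_lbm_x n t : lbm (F n ^~ t).
Proof. by apply: continuous_lbm; exact: sol_cont_x. Qed.

Lemma sol_lbm2 n : lbm2 (fun p => F n p.1 p.2).
Proof. by case: solF => cF _ _; exact: (continuous_lbm2 (cF n)). Qed.

Lemma sol_flux n t c d : 0 < t -> c < d ->
  exists v', flux m c d (F n ^~ t) (F n.+1 ^~ t) v'.
Proof.
move=> t0 cd; apply: flux_exists => //; [exact: sol_lbm_x..|].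
by move=> x /andP[cx xd]; case: solF => _ _; apply.
Qed.

(** By [flux_energy] this is the integral of [v_x ^+ 2] times the hat, whence [energy_ge0]. The
    formula in terms of values avoids choosing [v_x] at each time, which keeps measurability in [t]
    immediate. *)
Definition energy (G : nat -> R -> R -> R) (c x d t : R) : R :=
  2^-1 * (G 0%N c t ^+ 2 / (x - c) + G 0%N d t ^+ 2 / (d - x)
          - ((x - c)^-1 + (d - x)^-1) * G 0%N x t ^+ 2)
  - 2 * itg m c d (fun z => hat c x d z * (G 1%N z t * G 0%N z t)).

Lemma energy_ge0 c x d t : 0 < t -> c < x -> x < d -> 0 <= energy F c x d t.
Proof.
move=> t0 cx xd; have cd := lt_trans cx xd.
have [v' hv] := sol_flux 0 t0 cd.
rewrite /energy -(flux_energy cx xd _ _ hv); [|exact: sol_lbm_x..].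
apply: itg_ge0 => z zcd; rewrite mulr_ge0 ?sqr_ge0//.
by have /andP[] := hat01 cx xd zcd.
Qed.

Lemma lbm2_hat c x d n k : lbm2 (fun p : R * R => hat c x d p.1 * (F n p.1 p.2 * F k p.1 p.2)).
Proof.
apply: lbm2M; first by apply: lbm2_fst; exact: lbm_hat.
by apply: lbm2M; exact: sol_lbm2.
Qed.

Lemma lbm_energy c x d : lbm (energy F c x d).
Proof.
have l2 z : lbm (fun t => F 0%N z t ^+ 2) by apply: lbmX; exact: sol_lbm_t.
apply: lbmB.
  apply: lbmZ; apply: lbmB; last exact: lbmZ.
  by apply: lbmD; apply: lbmM => //; exact: lbm_cst.
apply: lbmZ.
exact: (lbm2_itg m_lf c d (lbm2_swap (lbm2_hat c x d 1 0))).
Qed.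

Definition weight (a b t : R) : R := (t - a) * (b - t).

Lemma lbm_weight a b : lbm (weight a b).
Proof.
apply: lbmM; apply: lbmB; try exact: lbm_cst; apply: continuous_lbm; exact: cont_id.
Qed.

Lemma weight_ge0 a b t : a <= t <= b -> 0 <= weight a b t.
Proof. by move=> /andP[at_ tb]; rewrite mulr_ge0 ?subr_ge0. Qed.

Lemma weight_le a b t : a <= t <= b -> weight a b t <= (b - a) ^+ 2.
Proof.
by move=> /andP[at_ tb]; rewrite expr2 ler_pM ?subr_ge0 ?lerB// lerD2r.
Qed.

(** The term [v_t v] in the energy is half the time derivative of [v ^+ 2]. Parts in time moves that
    derivative onto the weight, so only values of [v] remain on the right. *)
Lemma itg_weight_energy a b c x d : 0 < a -> a <= b -> c < x -> x < d ->
  itg leb a b (fun t => weight a b t * energy F c x d t) =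
  2^-1 * (itg leb a b (fun t => weight a b t * F 0%N c t ^+ 2) / (x - c)
    + itg leb a b (fun t => weight a b t * F 0%N d t ^+ 2) / (d - x)
    - ((x - c)^-1 + (d - x)^-1) * itg leb a b (fun t => weight a b t * F 0%N x t ^+ 2))
  + itg m c d (fun z => hat c x d z * itg leb a b (fun t => (a + b - 2 * t) * F 0%N z t ^+ 2)).
Proof.
move=> a0 ab cx xd.
have lw := lbm_weight a b.
have l2 z : lbm (fun t => weight a b t * F 0%N z t ^+ 2).
  by apply: lbmM => //; apply: lbmX; exact: sol_lbm_t.
pose h (p : R * R) := weight a b p.2 * (hat c x d p.1 * (F 1%N p.1 p.2 * F 0%N p.1 p.2)).
have lh : lbm2 h.
  by apply: lbm2M; [exact: lbm2_snd|exact: lbm2_hat].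
have lih : lbm (fun t => itg m c d (fun z => h (z, t))).
  exact: (lbm2_itg m_lf c d (lbm2_swap lh)).
transitivity (itg leb a b (fun t => 2^-1 * ((x - c)^-1 * (weight a b t * F 0%N c t ^+ 2)
   + (d - x)^-1 * (weight a b t * F 0%N d t ^+ 2)
   - ((x - c)^-1 + (d - x)^-1) * (weight a b t * F 0%N x t ^+ 2)) - 2 * itg m c d (fun z => h (z, t)))).
  apply: eq_itg => t _; rewrite /energy /h /=.
  have -> : itg m c d (fun z => weight a b t * (hat c x d z * (F 1%N z t * F 0%N z t))) =
    weight a b t * itg m c d (fun z => hat c x d z * (F 1%N z t * F 0%N z t)).
    rewrite (itgZ m_lf)//; apply: lbmM; first exact: lbm_hat.
    by apply: lbmM; exact: sol_lbm_x.
  ring.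
have lA : lbm (fun t => (x - c)^-1 * (weight a b t * F 0%N c t ^+ 2)
   + (d - x)^-1 * (weight a b t * F 0%N d t ^+ 2)).
  by apply: lbmD; exact: lbmZ.
have lB : lbm (fun t => ((x - c)^-1 + (d - x)^-1) * (weight a b t * F 0%N x t ^+ 2)) by exact: lbmZ.
rewrite (itgB leb_lf); [|by apply: lbmZ; exact: lbmB|exact: lbmZ].
rewrite (itgZ leb_lf); last exact: lbmB.
rewrite (itgB leb_lf)// (itgD leb_lf); [|exact: lbmZ|exact: lbmZ].
rewrite !(itgZ leb_lf)//; congr (_ * _ + _); first by congr (_ + _ - _); rewrite mulrC.
rewrite -(itg_fubini m_lf leb_lf c d a b lh) -mulNr -(itgZ m_lf); last first.
  exact: (lbm2_itg leb_lf a b lh).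
apply: eq_itg => z _; rewrite /h /=.
transitivity (- (hat c x d z * itg leb a b (fun t => (t - a) * (b - t) * (2 * (F 1%N z t * F 0%N z t))))).
  rewrite -mulNr -!(itgZ leb_lf); last 2 first.
  - apply: lbmM => //; apply: lbmZ; apply: lbmM; exact: sol_lbm_t.
  - by apply: lbmM => //; apply: lbmZ; apply: lbmM; exact: sol_lbm_t.
  by apply: eq_itg => t _; rewrite /weight; ring.
have dF : forall t : R, is_derive t (1 : R) (F 0%N z) (F 1%N z t).
  by case: solF => _ dF _ t; exact: dF.
have -> := itg_parts_square ab dF (@sol_cont_t 1 z).
by rewrite mulrN opprK.
Qed.

End Estimates.
End SmoothSolutions.

Arguments sol_cont_t {R m F} _ n x _.
Arguments sol_cont_x {R m F} _ n t _.
Arguments continuous_row {R h} x _ _.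
Arguments continuous_col {R h} t _ _.

#[global] Opaque leb itg.

(** * Interpolation between a solution and its time derivatives *)

Section Gain.
Context {R : realType} (m : {measure set (measurableTypeR R) -> \bar R}).
Hypothesis m_lf : locally_finite m.

Definition sqint (a b : R) (f : R -> R) : R := itg leb a b (fun t => f t ^+ 2).

Lemma sqint_ge0 a b f : 0 <= sqint a b f.
Proof. by apply: itg_ge0 => t _; exact: sqr_ge0. Qed.

Lemma sqint_subset a b c d f : lbm f -> a <= c -> d <= b -> sqint c d f <= sqint a b f.
Proof.
move=> lf ac db; apply: (itg_subset leb_lf) => //; first exact: lbmX.
by move=> t _; exact: sqr_ge0.
Qed.

Lemma weight_sqint_le a b f : lbm f -> a <= b ->
  itg leb a b (fun t => weight a b t * f t ^+ 2) <= (b - a) ^+ 2 * sqint a b f.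
Proof.
move=> lf ab; rewrite /sqint -(itgZ leb_lf); last exact: lbmX.
apply: (itg_le leb_lf).
- by apply: lbmM; [exact: lbm_weight|exact: lbmX].
- by apply: lbmZ; exact: lbmX.
- by move=> t tab; rewrite ler_wpM2r ?sqr_ge0 ?weight_le.
Qed.

Lemma weight_sqint_ge0 (a b : R) (f : R -> R) : 0 <= itg leb a b (fun t => weight a b t * f t ^+ 2).
Proof. by apply: itg_ge0 => t tab; rewrite mulr_ge0 ?sqr_ge0 ?weight_ge0. Qed.

Lemma weight_sqint_ge a b s T f : lbm f -> a <= s -> s <= T -> T <= b ->
  (s - a) * (b - T) * sqint s T f <= itg leb a b (fun t => weight a b t * f t ^+ 2).
Proof.
move=> lf as_ sT Tb; have lw : lbm (fun t => weight a b t * f t ^+ 2).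
  by apply: lbmM; [exact: lbm_weight|exact: lbmX].
apply: (@le_trans _ _ (itg leb s T (fun t => weight a b t * f t ^+ 2))); last first.
  by apply: (itg_subset leb_lf) => // t tab; rewrite mulr_ge0 ?sqr_ge0 ?weight_ge0.
rewrite /sqint -(itgZ leb_lf); last exact: lbmX.
apply: (itg_le leb_lf) => //; first by apply: lbmZ; exact: lbmX.
move=> t /andP[st tT]; rewrite ler_wpM2r ?sqr_ge0// /weight ler_pM ?subr_ge0//.
  by rewrite lerD2r.
by rewrite lerD2l lerN2.
Qed.

Lemma dweight_sqint_le a b f : lbm f -> a <= b ->
  itg leb a b (fun t => (a + b - 2 * t) * f t ^+ 2) <= (b - a) * sqint a b f.
Proof.
move=> lf ab; rewrite /sqint -(itgZ leb_lf); last exact: lbmX.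
apply: (itg_le leb_lf).
- apply: lbmM; last exact: lbmX.
  apply: lbmB; first exact: lbm_cst.
  by apply: lbmZ; apply: continuous_lbm; exact: cont_id.
- by apply: lbmZ; exact: lbmX.
- by move=> t /andP[at_ tb]; rewrite ler_wpM2r ?sqr_ge0//; lra.
Qed.

Variable F : nat -> R -> R -> R.
Hypothesis solF : smooth_solution m F.

Lemma lbm_sqint n a b : lbm (fun z => sqint a b (F n z)).
Proof.
have lh : lbm2 (fun p : R * R => F n p.1 p.2 ^+ 2).
  by under eq_fun do rewrite expr2; apply: lbm2M; exact: (sol_lbm2 solF).
exact: (lbm2_itg leb_lf a b lh).
Qed.

Lemma dweight_term_le a b c x d : 0 < a -> a <= b -> c < x -> x < d ->
  itg m c d (fun z => hat c x d z * itg leb a b (fun t => (a + b - 2 * t) * F 0%N z t ^+ 2))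
  <= (b - a) * itg m c d (fun z => sqint a b (F 0%N z)).
Proof.
move=> a0 ab cx xd.
have lh : lbm2 (fun p : R * R => (a + b - 2 * p.2) * (F 0%N p.1 p.2 ^+ 2)).
  apply: lbm2M; last first.
    by under eq_fun do rewrite expr2; apply: lbm2M; exact: (sol_lbm2 solF).
  apply: (@lbm2_snd R (fun t => a + b - 2 * t)).
  apply: lbmB; first exact: lbm_cst.
  by apply: lbmZ; apply: continuous_lbm; exact: cont_id.
have l0 := lbm_sqint 0 a b.
rewrite -(itgZ m_lf)//; apply: (itg_le m_lf).
- by apply: lbmM; [exact: lbm_hat|exact: (lbm2_itg leb_lf a b lh)].
- exact: lbmZ.
move=> z zcd; have /andP[h0 h1] := hat01 cx xd zcd.
have H := dweight_sqint_le (sol_lbm_t solF 0 z) ab.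
have P0 : 0 <= (b - a) * sqint a b (F 0%N z) by rewrite mulr_ge0 ?subr_ge0 ?sqint_ge0.
apply: le_trans (ler_wpM2l h0 H) _.
by rewrite -[leRHS]mul1r ler_wpM2r.
Qed.

(** A Caccioppoli estimate. The value at the peak [x] enters [itg_weight_energy] with a favourable
    sign and is dropped. *)
Lemma weight_energy_le a b c x d P : 0 < a -> a <= b -> c < x -> x < d ->
  (forall z, c <= z <= d -> sqint a b (F 0%N z) <= P) ->
  itg leb a b (fun t => weight a b t * energy m F c x d t) <=
  (2^-1 * ((x - c)^-1 + (d - x)^-1) * (b - a) ^+ 2 + (b - a) * itg m c d (fun=> 1)) * P.
Proof.
move=> a0 ab cx xd HP; rewrite (itg_weight_energy m_lf solF)//.
have cd := ltW (lt_trans cx xd).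
have ltF := sol_lbm_t solF 0.
have D := dweight_term_le a0 ab cx xd.
have D' : itg m c d (fun z => sqint a b (F 0%N z)) <= itg m c d (fun=> 1) * P.
  rewrite mulrC -(itg_cst m_lf); apply: (itg_le m_lf) => //; [exact: lbm_sqint|exact: lbm_cst].
have Nx := weight_sqint_ge0 a b (F 0%N x).
have wP z : c <= z <= d -> itg leb a b (fun t => weight a b t * F 0%N z t ^+ 2) <= (b - a) ^+ 2 * P.
  move=> zcd; apply: le_trans (weight_sqint_le (ltF z) ab) _.
  by rewrite ler_wpM2l ?sqr_ge0 ?HP.
have Nc := wP c; have Nd := wP d; rewrite !lexx cd in Nc Nd.
move: {Nc} (Nc isT) {Nd} (Nd isT) => Nc Nd.
set Ic := itg leb a b _ in Nc *; set Id := itg leb a b _ in Nd *; set Ix := itg leb a b _ in Nx *.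
have p1 : 0 < (x - c)^-1 by rewrite invr_gt0 subr_gt0.
have p2 : 0 < (d - x)^-1 by rewrite invr_gt0 subr_gt0.
set al := (x - c)^-1 in p1 *; set be := (d - x)^-1 in p2 *.
have ba : 0 <= b - a by rewrite subr_ge0.
have E1 : Ic * al <= (b - a) ^+ 2 * P * al by apply: ler_wpM2r => //; exact: ltW.
have E2 : Id * be <= (b - a) ^+ 2 * P * be by apply: ler_wpM2r => //; exact: ltW.
have E3 : 0 <= (al + be) * Ix by apply: mulr_ge0 => //; apply: ltW; exact: addr_gt0.
have E4 := ler_wpM2l ba D'.
set S := itg m c d (fun z => sqint _ _ _) in D E4.
lra.
Qed.

End Gain.

Section GainM.
Context {R : realType} (m : {measure set (measurableTypeR R) -> \bar R}).
Hypothesis m_lf : locally_finite m.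

Lemma flux_gain_sol F rho th t : smooth_solution m F -> 0 < rho -> 0 < th -> 0 < t ->
  2 * itg m (- rho) rho (fun z => hat (- rho) 0 rho z ^+ 2 * F 1%N z t ^+ 2) <=
  2 * th^-1 * energy m F (- rho) 0 rho t + th * energy m (fun n => F n.+1) (- rho) 0 rho t
  + th * rho^-1 ^+ 2 * itg leb (- rho) rho (fun z => F 1%N z t ^+ 2).
Proof.
move=> sF rho0 th0 t0.
have cx : - rho < 0 by rewrite oppr_lt0.
have cd : - rho < rho by lra.
have [y' hy] := sol_flux m_lf sF 0 t0 cd.
have [z' hz] := sol_flux m_lf sF 1 t0 cd.
have := @flux_gain R m (- rho) 0 rho rho^-1 th _ _ _ y' z' cx rho0 th0 _ _ _ _ _ hy hz.
rewrite (flux_energy cx rho0 _ _ hy) ?(flux_energy cx rho0 _ _ hz); try exact: (sol_lbm_x sF).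
by apply; rewrite ?sub0r ?opprK ?subr0//; exact: (sol_lbm_x sF).
Qed.

Lemma hat_center_ge (rho z : R) : 0 < rho -> - (rho / 2) <= z <= rho / 2 ->
  2^-1 <= hat (- rho) 0 rho z.
Proof.
move=> rho0 /andP[z0 z1]; rewrite /hat sub0r opprK subr0.
by case: ltP => _; rewrite ler_pdivlMr//; lra.
Qed.

Lemma gain_average (rho s0 s T s1 : R) : 0 < rho -> 0 < s0 -> s0 < s -> s <= T -> T < s1 ->
  exists2 C : R, 0 < C & forall F, smooth_solution m F -> forall P Q th : R, 0 < th ->
    (forall z, `|z| <= rho -> sqint s0 s1 (F 0%N z) <= P) ->
    (forall z, `|z| <= rho -> sqint s0 s1 (F 1%N z) <= Q) ->
    itg m (- (rho / 2)) (rho / 2) (fun z => sqint s T (F 1%N z)) <= C * (th^-1 * P + th * Q).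
Proof.
move=> rho0 s00 s0s sT Ts1.
have s01 : s0 <= s1 by lra.
(* A lower bound for the weight on [[s, T]]. The hat is at least 1/2 on the half interval, so
   [D / 4] bounds weight times squared hat from below there. *)
pose D := (s - s0) * (s1 - T).
have D0 : 0 < D by rewrite mulr_gt0 ?subr_gt0.
pose Ce := 2^-1 * ((0 - - rho)^-1 + (rho - 0)^-1) * (s1 - s0) ^+ 2 + (s1 - s0) * itg m (- rho) rho (fun=> 1).
(* The cost of the derivative falling on the hat: its squared slope, times the length [2 * rho],
   times an upper bound for the weight. *)
pose Cx := rho^-1 ^+ 2 * (2 * rho * (s1 - s0) ^+ 2).
have m1 : 0 <= itg m (- rho) rho (fun=> 1) by apply: itg_ge0.
have Ce0 : 0 <= Ce.
  rewrite /Ce sub0r opprK subr0 addr_ge0// mulr_ge0 ?subr_ge0 ?sqr_ge0//.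
  by rewrite mulr_ge0// addr_ge0// invr_ge0 ltW.
have Cx0 : 0 < Cx.
  rewrite /Cx mulr_gt0 ?exprn_gt0 ?invr_gt0//.
  by rewrite !mulr_gt0// ?exprn_gt0// subr_gt0; lra.
exists (2 * (2 * Ce + Cx) / D); first by rewrite divr_gt0// mulr_gt0//; lra.
move=> F sF P Q th th0 HP HQ.
have cx : - rho < 0 by rewrite oppr_lt0.
have sF1 := smooth_solution_shift sF.
have inrho z : - rho <= z <= rho -> `|z| <= rho by rewrite ler_norml.
have E1 := weight_energy_le m_lf sF s00 s01 cx rho0 (fun z hz => HP z (inrho z hz)).
have E2 := weight_energy_le m_lf sF1 s00 s01 cx rho0 (fun z hz => HQ z (inrho z hz)).
rewrite -/Ce in E1 E2.
have Q0 : 0 <= Q by apply: le_trans (HQ 0 _); rewrite ?sqint_ge0 ?normr0 ?ltW.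
have P0 : 0 <= P by apply: le_trans (HP 0 _); rewrite ?sqint_ge0 ?normr0 ?ltW.
have lw := @lbm_weight R s0 s1.
have l1 := lbm_energy m_lf sF (- rho) 0 rho.
have l2 := lbm_energy m_lf sF1 (- rho) 0 rho.
have lF2 : lbm2 (fun p : R * R => F 1%N p.1 p.2 ^+ 2).
  by under eq_fun do rewrite expr2; apply: lbm2M; exact: (sol_lbm2 sF).
have l3 : lbm (fun t => itg leb (- rho) rho (fun z => F 1%N z t ^+ 2)).
  exact: (lbm2_itg leb_lf (- rho) rho (lbm2_swap lF2)).
have lh2 : lbm (fun z => hat (- rho) 0 rho z ^+ 2) by apply: lbmX; exact: lbm_hat.
have lk : lbm2 (fun p : R * R => hat (- rho) 0 rho p.1 ^+ 2 * (weight s0 s1 p.2 * F 1%N p.1 p.2 ^+ 2)).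
  apply: lbm2M; first exact: (lbm2_fst lh2).
  by apply: lbm2M => //; exact: lbm2_snd.
have lhF : lbm2 (fun p : R * R => hat (- rho) 0 rho p.1 ^+ 2 * F 1%N p.1 p.2 ^+ 2).
  by apply: lbm2M => //; exact: (lbm2_fst lh2).
have l4 : lbm (fun t => itg m (- rho) rho (fun z => hat (- rho) 0 rho z ^+ 2 * F 1%N z t ^+ 2)).
  exact: (lbm2_itg m_lf (- rho) rho (lbm2_swap lhF)).
pose A t := itg m (- rho) rho (fun z => hat (- rho) 0 rho z ^+ 2 * F 1%N z t ^+ 2).
have E3 : itg leb s0 s1 (fun t => weight s0 s1 t * itg leb (- rho) rho (fun z => F 1%N z t ^+ 2))
    <= 2 * rho * (s1 - s0) ^+ 2 * Q.
  have -> : itg leb s0 s1 (fun t => weight s0 s1 t * itg leb (- rho) rho (fun z => F 1%N z t ^+ 2)) =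
      itg leb (- rho) rho (fun z => itg leb s0 s1 (fun t => weight s0 s1 t * F 1%N z t ^+ 2)).
    have lk' : lbm2 (fun p : R * R => weight s0 s1 p.2 * F 1%N p.1 p.2 ^+ 2).
      by apply: lbm2M => //; exact: lbm2_snd.
    rewrite (itg_fubini leb_lf leb_lf (- rho) rho s0 s1 lk'); apply: eq_itg => t _ /=.
    by rewrite (itgZ leb_lf)//; apply: lbmX; exact: (sol_lbm_x sF).
  have -> : 2 * rho * (s1 - s0) ^+ 2 * Q = ((s1 - s0) ^+ 2 * Q) * (rho - - rho) by ring.
  have cr : - rho <= rho by apply: le_trans (ltW cx) (ltW rho0).
  rewrite -(itg_leb1 cr) -(itg_cst leb_lf); apply: (itg_le leb_lf); last 2 first.
  - exact: lbm_cst.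
  - move=> z hz; apply: le_trans (weight_sqint_le (sol_lbm_t sF 1 z) s01) _.
    by rewrite ler_wpM2l ?sqr_ge0 ?HQ ?inrho.
  have lk' : lbm2 (fun p : R * R => weight s0 s1 p.2 * F 1%N p.1 p.2 ^+ 2).
    by apply: lbm2M => //; exact: lbm2_snd.
  exact: (lbm2_itg leb_lf s0 s1 lk').
have main : 2 * itg leb s0 s1 (fun t => weight s0 s1 t * A t) <=
   2 * th^-1 * itg leb s0 s1 (fun t => weight s0 s1 t * energy m F (- rho) 0 rho t) +
   th * itg leb s0 s1 (fun t => weight s0 s1 t * energy m (fun n => F n.+1) (- rho) 0 rho t) +
   th * rho^-1 ^+ 2 * itg leb s0 s1 (fun t => weight s0 s1 t * itg leb (- rho) rho (fun z => F 1%N z t ^+ 2)).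
  rewrite -!(itgZ leb_lf); try (by apply: lbmM).
  rewrite -!(itgD leb_lf); try (by do ?[apply: lbmD]; apply: lbmZ; apply: lbmM).
  apply: (itg_le leb_lf).
  - by apply: lbmZ; exact: lbmM.
  - by apply: lbmD; [apply: lbmD|]; apply: lbmZ; exact: lbmM.
  move=> t /andP[t0 t1]; have tp : 0 < t by rewrite (lt_le_trans s00).
  have H := flux_gain_sol sF rho0 th0 tp.
  have w0 : 0 <= weight s0 s1 t by rewrite weight_ge0 ?t0.
  have := ler_wpM2l w0 H; rewrite -/(A t).
  set w := weight _ _ _; set e1 := energy _ _ _ _ _ _; set e2 := energy _ _ _ _ _ _.
  set A0 := A t; set B0 := itg _ _ _ _; clear; lra.
have lower : D / 4 * itg m (- (rho / 2)) (rho / 2) (fun z => sqint s T (F 1%N z)) <=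
    itg leb s0 s1 (fun t => weight s0 s1 t * A t).
  have -> : itg leb s0 s1 (fun t => weight s0 s1 t * A t) =
    itg m (- rho) rho (fun z => hat (- rho) 0 rho z ^+ 2 * itg leb s0 s1 (fun t => weight s0 s1 t * F 1%N z t ^+ 2)).
    transitivity (itg m (- rho) rho (fun z => itg leb s0 s1 (fun t => hat (- rho) 0 rho z ^+ 2 * (weight s0 s1 t * F 1%N z t ^+ 2)))).
      rewrite (itg_fubini m_lf leb_lf (- rho) rho s0 s1 lk); apply: eq_itg => t _ /=.
      rewrite /A -(itgZ m_lf); last by apply: lbmM => //; apply: lbmX; exact: (sol_lbm_x sF).
      by apply: eq_itg => z _; ring.
    apply: eq_itg => z _; rewrite (itgZ leb_lf)//.
    by apply: lbmM => //; apply: lbmX; exact: (sol_lbm_t sF).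
  have lq := lbm_sqint sF 1 s T.
  have lI : lbm (fun z => itg leb s0 s1 (fun t => weight s0 s1 t * F 1%N z t ^+ 2)).
    have lk' : lbm2 (fun p : R * R => weight s0 s1 p.2 * F 1%N p.1 p.2 ^+ 2).
      by apply: lbm2M => //; exact: lbm2_snd.
    exact: (lbm2_itg leb_lf s0 s1 lk').
  rewrite -(itgZ m_lf)//.
  apply: (@le_trans _ _ (itg m (- (rho / 2)) (rho / 2) (fun z => hat (- rho) 0 rho z ^+ 2 * itg leb s0 s1 (fun t => weight s0 s1 t * F 1%N z t ^+ 2)))).
    apply: (itg_le m_lf); [exact: lbmZ|exact: lbmM|].
    move=> z /andP[z0 z1].
    have h12 : 2^-1 <= hat (- rho) 0 rho z by apply: hat_center_ge => //; rewrite z0.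
    have h14 : 4^-1 <= hat (- rho) 0 rho z ^+ 2.
      have -> : 4^-1 = 2^-1 ^+ 2 :> R by rewrite expr2 -invfM; congr (_^-1); ring.
      by rewrite ler_sqr ?nnegrE ?invr_ge0//; apply: le_trans h12; rewrite invr_ge0.
    have I1 := weight_sqint_ge (sol_lbm_t sF 1 z) (ltW s0s) sT (ltW Ts1).
    rewrite -/D in I1.
    have -> : D / 4 * sqint s T (F 1%N z) = 4^-1 * (D * sqint s T (F 1%N z)) by ring.
    by apply: ler_pM => //; rewrite ?invr_ge0// mulr_ge0 ?sqint_ge0 ?ltW.
  have rho2 : rho / 2 <= rho by rewrite ler_pdivrMr// ler_peMr ?ltW// ltr1n.
  apply: (itg_subset m_lf) => //; [exact: lbmM|by rewrite lerN2|].
  by move=> z _; rewrite mulr_ge0 ?sqr_ge0 ?weight_sqint_ge0.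
have ti0 : 0 < th^-1 by rewrite invr_gt0.
set I := itg m (- (rho / 2)) _ _ in lower *.
rewrite mulrAC ler_pdivlMr//.
have W1 : 2 * th^-1 * itg leb s0 s1 (fun t => weight s0 s1 t * energy m F (- rho) 0 rho t) <= 2 * th^-1 * (Ce * P).
  by rewrite ler_wpM2l// mulr_ge0// ltW.
have W2 : th * itg leb s0 s1 (fun t => weight s0 s1 t * energy m (fun n => F n.+1) (- rho) 0 rho t) <= th * (Ce * Q).
  by rewrite ler_wpM2l// ltW.
have W3 : th * rho^-1 ^+ 2 * itg leb s0 s1 (fun t => weight s0 s1 t * itg leb (- rho) rho (fun z => F 1%N z t ^+ 2)) <= th * (Cx * Q).
  have -> : th * (Cx * Q) = th * rho^-1 ^+ 2 * (2 * rho * (s1 - s0) ^+ 2 * Q) by rewrite /Cx; ring.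
  by rewrite ler_wpM2l// mulr_ge0 ?sqr_ge0 ?ltW.
have X1 : 0 <= Ce * (th * Q) by apply: mulr_ge0 => //; apply: mulr_ge0 => //; exact: ltW.
have X2 : 0 <= Cx * (th^-1 * P).
  by apply: mulr_ge0; [exact: ltW|apply: mulr_ge0 => //; exact: ltW].
clear -main lower W1 W2 W3 X1 X2.
lra.
Qed.

End GainM.

(** * From means with respect to [m] to pointwise bounds *)

Section Gain.
Context {R : realType} (m : {measure set (measurableTypeR R) -> \bar R}).
Hypothesis m_lf : locally_finite m.

Lemma le_average (a b X A B : R) (f : R -> R) : lbm f -> 0 <= A ->
  0 < itg m a b (fun=> 1) -> (forall z, a <= z <= b -> X <= A * f z + B) ->
  X <= A / itg m a b (fun=> 1) * itg m a b f + B.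
Proof.
move=> lf A0 mu0 H.
have : itg m a b (fun=> X) <= itg m a b (fun z => A * f z + B).
  apply: (itg_le m_lf) => //; first exact: lbm_cst.
  by apply: lbmD; [exact: lbmZ|exact: lbm_cst].
rewrite (itg_cst m_lf) (itgD m_lf); [|exact: lbmZ|exact: lbm_cst].
rewrite (itgZ m_lf)// (itg_cst m_lf a b B).
set mu := itg m a b (fun=> 1) in mu0 *; set I := itg m a b f => E.
rewrite -(ler_pM2r mu0) mulrDl; apply: le_trans E _.
by rewrite mulrAC divfK ?gt_eqF.
Qed.

(** Positivity of the energy, read the other way round: the peak term dropped in [weight_energy_le]
    is now the one being estimated. The feet of the hat bound the peak, as for a convex function, up
    to a mean over [[c, d]]. *)
Lemma pointwise_weight F (a b c x d : R) : smooth_solution m F -> 0 < a -> a <= b ->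
  c < x -> x < d ->
  ((x - c)^-1 + (d - x)^-1) * itg leb a b (fun t => weight a b t * F 0%N x t ^+ 2) <=
  (b - a) ^+ 2 * (sqint a b (F 0%N c) / (x - c) + sqint a b (F 0%N d) / (d - x)) +
  2 * (b - a) * itg m c d (fun z => sqint a b (F 0%N z)).
Proof.
move=> sF a0 ab cx xd.
have E0 : 0 <= itg leb a b (fun t => weight a b t * energy m F c x d t).
  apply: itg_ge0 => t tab; apply: mulr_ge0; first exact: weight_ge0.
  by apply: energy_ge0 => //; case/andP: tab => /(lt_le_trans a0).
rewrite (itg_weight_energy m_lf sF)// in E0.
have D := dweight_term_le m_lf sF a0 ab cx xd.
have Nc := weight_sqint_le (sol_lbm_t sF 0 c) ab.
have Nd := weight_sqint_le (sol_lbm_t sF 0 d) ab.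
have p1 : 0 <= (x - c)^-1 by rewrite invr_ge0 subr_ge0 ltW.
have p2 : 0 <= (d - x)^-1 by rewrite invr_ge0 subr_ge0 ltW.
have Nc' := ler_wpM2r p1 Nc; have Nd' := ler_wpM2r p2 Nd.
move: E0 D Nc' Nd'; clear.
set A1 := itg leb _ _ _; set A2 := itg leb _ _ _; set A3 := itg leb _ _ _.
set A4 := itg m c d _; set A5 := itg m c d _.
set S1 := sqint _ _ _; set S2 := sqint _ _ _.
lra.
Qed.

(** The feet of the hat in [pointwise_weight] are free, so the bound is averaged with respect to
    [m], over the left foot and then over the right one. This reaches every [x], including points in
    gaps of [m]. *)
Lemma pointwise_average (r r1 a s T b : R) : 0 < r -> r + 1 < r1 ->
  0 < itg m (r + 1) r1 (fun=> 1) -> 0 < itg m (- r1) (- (r + 1)) (fun=> 1) ->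
  0 < a -> a < s -> s <= T -> T < b ->
  exists2 C : R, 0 < C & forall F, smooth_solution m F -> forall x, `|x| <= r ->
    sqint s T (F 0%N x) <= C * itg m (- r1) r1 (fun z => sqint a b (F 0%N z)).
Proof.
move=> r0 rr1 mR mL a0 as_ sT Tb.
have ab : a <= b by apply: ltW; apply: lt_le_trans as_ _; apply: le_trans sT (ltW Tb).
have D0 : 0 < (s - a) * (b - T) by rewrite mulr_gt0 ?subr_gt0.
set D := (s - a) * (b - T) in D0.
set mr := itg m (r + 1) r1 _ in mR; set ml := itg m _ (- (r + 1)) _ in mL.
have r10 : 0 < r1 by apply: lt_trans rr1; apply: addr_gt0.
pose K := (b - a) ^+ 2 * r1.
have K0 : 0 <= K by apply: mulr_ge0; [exact: sqr_ge0|exact: ltW].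
have ba0 : 0 <= b - a by rewrite subr_ge0.
have C0 : 0 < (K / ml + K / mr + 2 * (b - a) * r1 + 1) / D.
  apply: divr_gt0 => //; apply: ltr_wpDl => //; apply: addr_ge0.
    by apply: addr_ge0; apply: mulr_ge0 => //; rewrite invr_ge0 ltW.
  by apply: mulr_ge0; [apply: mulr_ge0|exact: ltW].
exists ((K / ml + K / mr + 2 * (b - a) * r1 + 1) / D) => // F sF x xr.
set Q := itg m (- r1) r1 _.
have lS := lbm_sqint sF 0 a b.
have Q0 : 0 <= Q by apply: itg_ge0 => z _; exact: sqint_ge0.
move: (xr); rewrite ler_norml => /andP[xl xu].
set X := itg leb a b (fun t => weight a b t * F 0%N x t ^+ 2).
have X0 : 0 <= X by exact: weight_sqint_ge0.
(* both hat end points range over sets of positive measure *)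
have H c d : - r1 <= c <= - (r + 1) -> r + 1 <= d <= r1 ->
    X <= K * sqint a b (F 0%N c) + (K * sqint a b (F 0%N d) + 2 * (b - a) * r1 * Q).
  move=> /andP[c1 c2] /andP[d1 d2].
  have xc1 : 1 <= x - c by move: c2 xl; clear; lra.
  have xd1 : 1 <= d - x by move: d1 xu; clear; lra.
  have xc2 : x - c <= 2 * r1 by move: c1 xu rr1; clear; lra.
  have xd2 : d - x <= 2 * r1 by move: d2 xl rr1; clear; lra.
  have cx : c < x by rewrite -subr_gt0 (lt_le_trans _ xc1).
  have xd : x < d by rewrite -subr_gt0 (lt_le_trans _ xd1).
  have P := pointwise_weight sF a0 ab cx xd; rewrite -/X in P.
  have i1 : (x - c)^-1 <= 1 by rewrite invf_le1 ?(lt_le_trans _ xc1).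
  have i2 : (d - x)^-1 <= 1 by rewrite invf_le1 ?(lt_le_trans _ xd1).
  have j1 : (2 * r1)^-1 <= (x - c)^-1 by rewrite lef_pV2 ?posrE ?subr_gt0// mulr_gt0.
  have j2 : (2 * r1)^-1 <= (d - x)^-1 by rewrite lef_pV2 ?posrE ?subr_gt0// mulr_gt0.
  have QS : itg m c d (fun z => sqint a b (F 0%N z)) <= Q.
    by apply: (itg_subset m_lf) => // z _; exact: sqint_ge0.
  have S1 := sqint_ge0 a b (F 0%N c); have S2 := sqint_ge0 a b (F 0%N d).
  (* Each slope is at least [1 / (2 * r1)], so their sum is at least [1 / r1]; multiplying by [r1]
     later produces the factor [r1] in [K]. *)
  have h0 : r1^-1 * X <= ((x - c)^-1 + (d - x)^-1) * X.
    apply: ler_wpM2r => //; apply: le_trans (lerD j1 j2).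
    rewrite le_eqVlt; apply/orP; left; apply/eqP.
    by move: (gt_eqF r10); clear => n0; field; rewrite n0.
  have h1 : sqint a b (F 0%N c) / (x - c) <= sqint a b (F 0%N c) by apply: ler_piMr.
  have h2 : sqint a b (F 0%N d) / (d - x) <= sqint a b (F 0%N d) by apply: ler_piMr.
  have h3 : r1^-1 * X <= (b - a) ^+ 2 * (sqint a b (F 0%N c) + sqint a b (F 0%N d)) + 2 * (b - a) * Q.
    apply: le_trans h0 (le_trans P _); apply: lerD.
      by apply: ler_wpM2l; [exact: sqr_ge0|exact: lerD].
    by apply: ler_wpM2l => //; apply: mulr_ge0.
  have := ler_wpM2l (ltW r10) h3; rewrite mulrA divff ?gt_eqF// mul1r.
  rewrite /K; set u1 := sqint _ _ _; set u2 := sqint _ _ _; clear; lra.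
have H1 d : r + 1 <= d <= r1 -> X <= K * sqint a b (F 0%N d) + (K / ml * Q + 2 * (b - a) * r1 * Q).
  move=> hd; have := le_average lS K0 mL (fun z hz => H z d hz hd).
  rewrite -/ml; set I := itg m (- r1) (- (r + 1)) _ => E; apply: le_trans E _.
  have : K / ml * I <= K / ml * Q.
    apply: ler_wpM2l; first by apply: mulr_ge0 => //; rewrite invr_ge0 ltW.
    apply: (itg_subset m_lf) => //; last by move=> z _; exact: sqint_ge0.
    by rewrite lerNl; move: r0 rr1; clear; lra.
  set u := sqint _ _ _; set v := K / ml * I; set w := K / ml * Q; clear; lra.
have H2 : X <= K / mr * Q + (K / ml * Q + 2 * (b - a) * r1 * Q).
  have := le_average lS K0 mR H1.
  rewrite -/mr; set I := itg m (r + 1) r1 _ => E; apply: le_trans E _.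
  rewrite lerD2r; apply: ler_wpM2l; first by apply: mulr_ge0 => //; rewrite invr_ge0 ltW.
  apply: (itg_subset m_lf) => //; last by move=> z _; exact: sqint_ge0.
  by rewrite lerNl; move: r0 rr1; clear; lra.
have L := weight_sqint_ge (sol_lbm_t sF 0 x) (ltW as_) sT (ltW Tb).
rewrite -/D -/X in L.
rewrite mulrAC ler_pdivlMr// mulrC; apply: le_trans L (le_trans H2 _).
move: Q0; clear; set u := K / mr; set v := K / ml; lra.
Qed.

(** The gap of length 1 between [[-r, r]] and the two charged regions keeps the slopes of the hats
    at most 1. *)
Definition two_sided : Prop := forall r : R, 0 < r -> exists r1, [/\ r + 1 < r1,
  0 < itg m (r + 1) r1 (fun=> 1) & 0 < itg m (- r1) (- (r + 1)) (fun=> 1)].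

Hypothesis m2 : two_sided.

(** [gain_average] controls the time derivative in the mean with respect to [m]; since that
    derivative is itself a solution, [pointwise_average] makes the bound pointwise in [x]. *)
Lemma gain (r s T : R) : 0 < r -> 0 < s -> s <= T ->
  exists r' s' T' C, [/\ r <= r', 0 < s', s' <= s, T <= T' & 0 < C] /\
    forall F, smooth_solution m F -> forall P Q th : R, 0 < th ->
    (forall z, `|z| <= r' -> sqint s' T' (F 0%N z) <= P) ->
    (forall z, `|z| <= r' -> sqint s' T' (F 1%N z) <= Q) ->
    forall x, `|x| <= r -> sqint s T (F 1%N x) <= C * (th^-1 * P + th * Q).
Proof.
move=> r0 s0 sT; have [r1 [rr1 mR mL]] := m2 r0.
have r10 : 0 < r1 by apply: lt_trans rr1; apply: addr_gt0.
have s2 : 0 < s / 2 by apply: divr_gt0.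
have s2s : s / 2 < s by rewrite ltr_pdivrMr// ltr_pMr// ltr1n.
have s4 : 0 < s / 2 / 2 by apply: divr_gt0.
have s42 : s / 2 / 2 < s / 2 by rewrite ltr_pdivrMr// ltr_pMr// ltr1n.
have T1 : T < T + 1 by rewrite ltrDl.
have T2 : T + 1 < T + 2 by rewrite ltrD2l ltr1n.
have [C1 C10 H1] := pointwise_average r0 rr1 mR mL s2 s2s sT T1.
(* [gain_average] halves the interval, so starting from [2 * r1] ends at the [r1] of
   [pointwise_average]. *)
have rho0 : 0 < 2 * r1 by apply: mulr_gt0.
have sT1 : s / 2 <= T + 1 by apply: le_trans (ltW s2s) (le_trans sT (ltW T1)).
have [C2 C20 H2] := gain_average m_lf rho0 s4 s42 sT1 T2.
exists (2 * r1), (s / 2 / 2), (T + 2), (C1 * C2); split.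
  split => //.
  - by move: rr1 r0; clear; lra.
  - exact: le_trans (ltW s42) (ltW s2s).
  - exact: le_trans (ltW T1) (ltW T2).
  - exact: mulr_gt0.
move=> F sF P Q th th0 HP HQ x xr.
apply: le_trans (H1 _ (smooth_solution_shift sF) x xr) _.
rewrite -mulrA; apply: ler_wpM2l; first exact: ltW.
have := H2 F sF P Q th th0 HP HQ.
by rewrite (_ : 2 * r1 / 2 = r1)// mulrAC divff ?mul1r// pnatr_eq0.
Qed.

End Gain.

(** * Time differences and averages of solutions *)

Section ParametricIntegrals.
Context {R : realType}.

Lemma continuous_shift2 (U : R * R -> R) (h : R) : continuous U ->
  continuous (fun p : R * R => U (p.1, p.2 + h)).
Proof.
move=> cU p; apply: (@continuous_comp _ _ _ (fun p : R * R => (p.1, p.2 + h)) U); last exact: cU.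
move=> A [[B C] /= [Bp Cp] sub].
have Cp' : nbhs p.2 [set t | C (t + h)].
  by apply: (@continuous_shift R id h cont_id p.2).
exists (B, [set t | C (t + h)]) => // q [/= q1 q2]; exact: sub.
Qed.

(** Compactness of [[a, b]], in near-covering form, makes the continuity of [U] uniform in [u]; the
    rest is a bound by mass times supremum. *)
Lemma continuous_itg_param (U : R * R -> R) (k : R -> R) (a b : R) :
  continuous U -> lbm k ->
  continuous (fun p : R * R => itg leb a b (fun u => U (p.1, p.2 + u) * k u)).
Proof.
move=> cU lk p; apply/cvgrPdist_le => e e0.
have [M M0 hM] := lbm_bounded a b lk.
pose L := itg leb a b (fun=> 1) + 1 : R.
have L0 : 0 < L by apply: ltr_wpDl => //; apply: itg_ge0.
pose e' := e / (M * L).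
have e'0 : 0 < e' by apply: divr_gt0 => //; exact: mulr_gt0.
have cK : compact (`[a, b] : set R) by exact: segment_compact.
move/compact_near_coveringP : cK.
move=> /(_ _ (nbhs p) (fun (q : R * R) u => `|U (p.1, p.2 + u) - U (q.1, q.2 + u)| <= e') _) H.
have lU (q : R * R) : lbm (fun u => U (q.1, q.2 + u)).
  apply: continuous_lbm.
  have := @continuous_shift R (fun t => U (q.1, t)) q.2 (continuous_row q.1 cU).
  by under eq_fun do rewrite addrC.
near=> q.
rewrite -(itgB leb_lf); [|by apply: lbmM..].
apply: le_trans (itg_bound leb_lf (M := e' * M) _ _) _.
- by apply: lbmB; apply: lbmM.
- move=> u uab; rewrite -mulrBl normrM; apply: ler_pM => //; last exact: hM.
  have : `[a, b] `<=` (fun u => `|U (p.1, p.2 + u) - U (q.1, q.2 + u)| <= e').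
    near: q; apply: H.
    move=> u0 _ /=.
    have e2 : 0 < e' / 2 by exact: divr_gt0.
    have /cvgrPdist_lt/(_ _ e2)/nbhs_ballP[d /= d0 Hd] := cU (p.1, p.2 + u0).
    have d2 : 0 < d / 2 by exact: divr_gt0.
    exists (ball u0 (d / 2), ball p (d / 2)) => /=.
      by split; exact: nbhsx_ballx.
    move=> [u' q'] /= [bu [bq1 bq2]].
    have h1 : `|U (p.1, p.2 + u0) - U (p.1, p.2 + u')| < e' / 2.
      apply: (Hd (p.1, p.2 + u')); split => /=; first exact: ballxx.
      move: bu; rewrite /ball/= => bu.
      rewrite (_ : p.2 + u0 - (p.2 + u') = u0 - u'); last by ring.
      by apply: lt_trans bu _; rewrite ltr_pdivrMr// ltr_pMr// ltr1n.
    have h2 : `|U (p.1, p.2 + u0) - U (q'.1, q'.2 + u')| < e' / 2.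
      apply: (Hd (q'.1, q'.2 + u')); split => /=.
        by apply: le_ball bq1; rewrite ler_pdivrMr// ler_pMr// ler1n.
      move: bu bq2; rewrite /ball/= => bu bq2.
      rewrite (_ : p.2 + u0 - (q'.2 + u') = (p.2 - q'.2) + (u0 - u')); last by ring.
      apply: le_lt_trans (ler_normD _ _) _.
      by rewrite [ltRHS](splitr d) ltrD.
    rewrite (_ : _ - _ = - (U (p.1, p.2 + u0) - U (p.1, p.2 + u')) +
      (U (p.1, p.2 + u0) - U (q'.1, q'.2 + u'))); last by ring.
    apply: le_trans (ler_normD _ _) _; rewrite normrN [leRHS](splitr e').
    by apply: lerD; exact: ltW.
  by apply; rewrite /= in_itv.
rewrite /e'; set I := itg leb a b _.
have IL : I <= L by rewrite /L lerDl.
have -> : e / (M * L) * M * I = e * (I / L).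
  by move: (gt_eqF M0) (gt_eqF L0); clear => m0 l0; field; rewrite m0 l0.
by rewrite ler_piMr ?(ltW e0)// ler_pdivrMr// mul1r.
Unshelve. all: end_near. Qed.

End ParametricIntegrals.

Arguments continuous_itg_param {R U k} a b _ _ _.
Arguments continuous_shift2 {R U} h _ _.

Section Differences.
Context {R : realType} (m : {measure set (measurableTypeR R) -> \bar R}).
Hypothesis m_lf : locally_finite m.

Lemma hat_identityB v w v' w' (c x d : R) : lbm w -> lbm w' ->
  hat_identity m v w c x d -> hat_identity m v' w' c x d ->
  hat_identity m (fun z => v z - v' z) (fun z => w z - w' z) c x d.
Proof.
move=> lw lw' h h'; rewrite /hat_identity in h h' *.
have lh := lbm_hat c x d.
have -> : itg m c d (fun z => hat c x d z * (w z - w' z)) =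
   itg m c d (fun z => hat c x d z * w z) - itg m c d (fun z => hat c x d z * w' z).
  rewrite -(itgB m_lf); [|exact: lbmM..].
  by apply: eq_itg => z _; rewrite mulrBr.
rewrite [RHS]mulrBr -h -h'; ring.
Qed.

Definition delta (h : R) (F : nat -> R -> R -> R) n x t := F n x (t + h) - F n x t.

(** The integral over [[t, t + h]], not divided by [h]. Its time derivative is the difference of
    [F 0], so from order 1 on the family is [delta h F] with the order lowered by one. *)
Definition average (h : R) (F : nat -> R -> R -> R) n x t : R :=
  if n is n'.+1 then delta h F n' x t else itg leb 0 h (fun u => F 0%N x (t + u)).

Section Closure.
Variables (F : nat -> R -> R -> R) (h : R).
Hypotheses (sF : smooth_solution m F) (h0 : 0 < h).

Lemma smooth_solution_delta : smooth_solution m (delta h F).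
Proof.
have [cF dF hF] := sF; split.
- move=> n; have c2 := continuous_shift2 h (cF n).
  by move=> p; apply: cvgB; [exact: c2|exact: cF].
- move=> n x t.
  have d1 := is_derive_shift (dF n x (t + h)); have d2 := dF n x t.
  by rewrite /delta; exact: is_deriveB.
- move=> n t c x d t0 cx xd.
  apply: hat_identityB; try exact: (sol_lbm_x sF); apply: hF => //.
  exact: addr_gt0.
Qed.

Lemma average_derive x t : is_derive t (1 : R) (average h F 0 x) (average h F 1 x t).
Proof.
have cF := sol_cont_t sF 0 x; have lF := sol_lbm_t sF 0 x.
pose G y := itg leb (t - 1) y (F 0%N x).
have dG y : t - 1 < y -> is_derive y (1 : R) G (F 0%N x y).
  by move=> ty; exact: local_primitive.
have t1 : t - 1 < t by rewrite ltrBlDr ltrDl.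
have th : t - 1 < t + h by apply: lt_trans t1 _; rewrite ltrDl.
have d1 := is_derive_shift (dG _ th); have d2 := dG _ t1.
have : is_derive t (1 : R) (fun y => G (y + h) - G y) (average h F 1 x t).
  by rewrite /average /delta; exact: is_deriveB.
apply: near_eq_is_derive; near=> y.
have ty : t - 1 <= y by apply: ltW; near: y; exact: lt_nbhsr.
rewrite /average.
have -> : itg leb 0 h (fun u => F 0%N x (y + u)) = itg leb y (y + h) (F 0%N x).
  have := @itg_shift R 0 h y (F 0%N x) (ltW h0) cF; rewrite add0r addrC => <-.
  by apply: eq_itg => u _; rewrite addrC.
rewrite /G (itg_split lF ty (_ : y <= y + h)) ?lerDl ?ltW//.
by rewrite addrC addKr.
Unshelve. all: end_near. Qed.

Lemma lbm_shift_t n x t : lbm (fun u => F n x (t + u)).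
Proof.
apply: continuous_lbm; have := @continuous_shift R _ t (sol_cont_t sF n x).
by under eq_fun do rewrite addrC.
Qed.

Lemma average_hat t c x d : 0 < t -> c < x -> x < d ->
  hat_identity m (average h F 0 ^~ t) (average h F 1 ^~ t) c x d.
Proof.
move=> t0 cx xd; have [cF dF hF] := sF; rewrite /hat_identity /average.
have l z := lbm_shift_t 0 z t.
have lh2 : lbm2 (fun p : R * R => hat c x d p.1 * F 1%N p.1 (t + p.2)).
  apply: lbm2M; first by apply: lbm2_fst; exact: lbm_hat.
  apply: continuous_lbm2.
  have := continuous_shift2 t (cF 1%N).
  by under eq_fun do rewrite addrC.
transitivity (itg leb 0 h (fun u => 2 * itg m c d (fun z => hat c x d z * F 1%N z (t + u)))).
  transitivity (itg leb 0 h (fun u => (x - c)^-1 * F 0%N c (t + u) + (d - x)^-1 * F 0%N d (t + u)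
      - ((x - c)^-1 + (d - x)^-1) * F 0%N x (t + u))).
    rewrite (itgB leb_lf); [|by apply: lbmD; exact: lbmZ|exact: lbmZ].
    rewrite (itgD leb_lf); [|exact: lbmZ|exact: lbmZ].
    by rewrite !(itgZ leb_lf)//; congr (_ + _ - _); rewrite mulrC.
  apply: eq_itg => u /andP[u0 _].
  have := hF 0%N (t + u) c x d (ltr_wpDr u0 t0) cx xd; rewrite /hat_identity => <-.
  by congr (_ + _ - _); rewrite mulrC.
rewrite (itgZ leb_lf); last exact: (lbm2_itg m_lf c d (lbm2_swap lh2)).
congr (_ * _); rewrite -(itg_fubini m_lf leb_lf c d 0 h lh2); apply: eq_itg => z _ /=.
rewrite (itgZ leb_lf); last exact: lbm_shift_t.
congr (_ * _); rewrite /delta.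
have -> : itg leb 0 h (fun u => F 1%N z (t + u)) = itg leb 0 h (fun u => F 1%N z (u + t)).
  by apply: eq_itg => u _; rewrite addrC.
rewrite (@itg_shift R 0 h t _ (ltW h0) (sol_cont_t sF 1 z)) add0r addrC.
have th : t <= t + h by rewrite lerDl ltW.
exact: (@itg_FTC R t (t + h) (F 1%N z) (F 0%N z) th (fun s _ => dF 0%N z s) (sol_cont_t sF 1 z)).
Qed.

Lemma smooth_solution_average : smooth_solution m (average h F).
Proof.
have [cF dF hF] := sF; have [cD dD hD] := smooth_solution_delta; split.
- move=> [|n]; last exact: cD.
  have := continuous_itg_param 0 h (cF 0%N) (lbm_cst 1).
  by rewrite /average; under eq_fun do under eq_fun do rewrite mulr1.
- by move=> [|n] x t; [exact: average_derive|exact: dD].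
- by move=> [|n] t c x d t0 cx xd; [exact: average_hat|exact: hD].
Qed.

Lemma sqint_shift (a b u : R) (f : R -> R) : a <= b -> continuous f ->
  sqint a b (fun t => f (t + u)) = sqint (a + u) (b + u) f.
Proof.
move=> ab cf; have cf2 : continuous (fun t => f t ^+ 2).
  by under eq_fun do rewrite expr2; exact: contM.
exact: (itg_shift u ab cf2).
Qed.

Lemma sqint_delta_le x s T : s <= T ->
  sqint s T (delta h F 0 x) <= 4 * sqint s (T + h) (F 0%N x).
Proof.
move=> sT; have cF := sol_cont_t sF 0 x; have lF := sol_lbm_t sF 0 x.
have lFh : lbm (fun t => F 0%N x (t + h)) by apply: continuous_lbm; exact: continuous_shift.
apply: (@le_trans _ _ (2 * sqint s T (fun t => F 0%N x (t + h)) + 2 * sqint s T (F 0%N x))).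
  rewrite /sqint -!(itgZ leb_lf); [|exact: lbmX..].
  rewrite -(itgD leb_lf); [|by apply: lbmZ; exact: lbmX..].
  apply: (itg_le leb_lf); first by apply: lbmX; exact: lbmB.
    by apply: lbmD; apply: lbmZ; exact: lbmX.
  move=> t _; rewrite /delta; set p := F _ _ _; set q := F _ _ _.
  by rewrite -subr_ge0 (_ : _ - _ = (p + q) ^+ 2) ?sqr_ge0//; ring.
rewrite sqint_shift//.
have i1 : sqint (s + h) (T + h) (F 0%N x) <= sqint s (T + h) (F 0%N x).
  by apply: sqint_subset => //; rewrite lerDl ltW.
have i2 : sqint s T (F 0%N x) <= sqint s (T + h) (F 0%N x).
  by apply: sqint_subset => //; rewrite lerDl ltW.
by move: i1 i2; clear; lra.
Qed.

(** Cauchy-Schwarz, read off from the nonnegative integral of [(h * f u - I) ^+ 2]. *)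
Lemma itg_square_le (f : R -> R) : lbm f ->
  itg leb 0 h f ^+ 2 <= h * itg leb 0 h (fun u => f u ^+ 2).
Proof.
move=> lf; set I := itg leb 0 h f; set J := itg leb 0 h _.
have : 0 <= itg leb 0 h (fun u => (h * f u - I) ^+ 2) by apply: itg_ge0 => u _; exact: sqr_ge0.
have -> : itg leb 0 h (fun u => (h * f u - I) ^+ 2) = h ^+ 2 * J - 2 * h * I * I + I ^+ 2 * h.
  transitivity (itg leb 0 h (fun u => h ^+ 2 * f u ^+ 2 - 2 * h * I * f u + I ^+ 2)).
    by apply: eq_itg => u _; ring.
  have lf2 : lbm (fun u => f u ^+ 2) by exact: lbmX.
  rewrite (itgD leb_lf); [|by apply: lbmB; exact: lbmZ|exact: lbm_cst].
  rewrite (itgB leb_lf); [|exact: lbmZ..].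
  by rewrite (itg_cst leb_lf 0 h (I ^+ 2)) (itg_leb1 (ltW h0)) subr0 !(itgZ leb_lf).
have -> : h ^+ 2 * J - 2 * h * I * I + I ^+ 2 * h = h * (h * J - I ^+ 2) by ring.
by rewrite pmulr_rge0// subr_ge0.
Qed.

Lemma sqint_average_le x s T : s <= T ->
  sqint s T (average h F 0 x) <= h ^+ 2 * sqint s (T + h) (F 0%N x).
Proof.
move=> sT; have cF := sol_cont_t sF 0 x; have lF := sol_lbm_t sF 0 x.
have l2 : lbm2 (fun p : R * R => F 0%N x (p.1 + p.2) ^+ 2).
  apply: continuous_lbm2; move=> p.
  have cs : {for p, continuous (fun q : R * R => q.1 + q.2)}.
    by apply: cvgD; [exact: cvg_fst|exact: cvg_snd].
  have cc : {for p, continuous (fun q : R * R => F 0%N x (q.1 + q.2))}.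
    by apply: (@continuous_comp _ _ _ (fun q : R * R => q.1 + q.2) (F 0%N x)) => //; exact: cF.
  by under eq_fun do rewrite expr2; apply: cvgM; exact: cc.
have lA := sol_lbm_t smooth_solution_average 0 x.
apply: (@le_trans _ _ (itg leb s T (fun t => h * itg leb 0 h (fun u => F 0%N x (t + u) ^+ 2)))).
  apply: (itg_le leb_lf); first exact: lbmX.
    by apply: lbmZ; exact: (lbm2_itg leb_lf 0 h l2).
  move=> t _; rewrite /average; apply: itg_square_le; exact: lbm_shift_t.
rewrite (itgZ leb_lf); last exact: (lbm2_itg leb_lf 0 h l2).
rewrite expr2 -mulrA ler_pM2l//.
rewrite (itg_fubini leb_lf leb_lf s T 0 h l2) /=.
have -> : h * sqint s (T + h) (F 0%N x) = itg leb 0 h (fun=> sqint s (T + h) (F 0%N x)).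
  by rewrite (itg_cst leb_lf) (itg_leb1 (ltW h0)) subr0 mulrC.
apply: (itg_le leb_lf); [exact: (lbm2_itg leb_lf s T (lbm2_swap l2))|exact: lbm_cst|].
move=> u /andP[u0 uh].
have -> : itg leb s T (fun t => F 0%N x (t + u) ^+ 2) = sqint (s + u) (T + u) (F 0%N x).
  exact: sqint_shift.
by apply: sqint_subset => //; [rewrite lerDl|rewrite lerD2l].
Qed.

End Closure.

Hypothesis m2 : two_sided m.

(** [gain] is applied to the average, whose square integral is at most [h ^+ 2 * M], while that of
    its derivative is at most [4 * M]. With [th = h] both terms are of order [h * M]: one power of
    [h] in the square, half a power in the norm. *)
Lemma half_gain (r s T : R) : 0 < r -> 0 < s -> s <= T ->
  exists r' s' T' C, [/\ r <= r', 0 < s', s' <= s, T <= T' & 0 < C] /\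
    forall F, smooth_solution m F -> forall M,
    (forall z, `|z| <= r' -> sqint s' T' (F 0%N z) <= M) ->
    forall h, 0 < h -> h <= 1 ->
    forall x, `|x| <= r -> sqint s T (delta h F 0 x) <= C * h * M.
Proof.
move=> r0 s0 sT; have [r' [s' [T' [C [[rr s'0 s's TT C0] H]]]]] := gain m_lf m2 r0 s0 sT.
exists r', s', (T' + 1), (5 * C); split.
  split => //; last by rewrite mulr_gt0.
  by apply: le_trans TT _; rewrite lerDl.
move=> F sF M HM h h0 h1 x xr.
have sT' : s' <= T' by apply: le_trans s's (le_trans sT TT).
have sub z : sqint s' (T' + h) (F 0%N z) <= sqint s' (T' + 1) (F 0%N z).
  by apply: sqint_subset => //; [exact: (sol_lbm_t sF)|rewrite lerD2l].
have := H _ (smooth_solution_average sF h0) (h ^+ 2 * M) (4 * M) h h0 _ _ x xr.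
have -> : C * (h^-1 * (h ^+ 2 * M) + h * (4 * M)) = 5 * C * h * M.
  by move: (gt_eqF h0); clear => n0; field; rewrite n0.
apply.
- move=> z zr; apply: le_trans (sqint_average_le sF h0 z sT') _.
  apply: ler_wpM2l; first exact: sqr_ge0.
  exact: le_trans (sub z) (HM z zr).
- move=> z zr; apply: le_trans (sqint_delta_le sF h0 z sT') _.
  by apply: ler_wpM2l => //; exact: le_trans (sub z) (HM z zr).
Qed.

End Differences.

(** * Bounds on the time derivatives *)

Section SquareIntegrals.
Context {R : realType}.
Implicit Types f g : R -> R.

(** Minkowski's inequality without square roots: Young's inequality with the weights [q / p] and
    [p / q], for which the two bounds add up to exactly [(p + q) ^+ 2]. *)
Lemma sqint_add (s T p q : R) f g : lbm f -> lbm g -> 0 < p -> 0 < q ->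
  sqint s T f <= p ^+ 2 -> sqint s T g <= q ^+ 2 ->
  sqint s T (fun t => f t + g t) <= (p + q) ^+ 2.
Proof.
move=> lf lg p0 q0 hf hg.
have lf2 : lbm (fun t => f t ^+ 2) by exact: lbmX.
have lg2 : lbm (fun t => g t ^+ 2) by exact: lbmX.
apply: (@le_trans _ _ ((1 + q / p) * sqint s T f + (1 + p / q) * sqint s T g)).
  rewrite /sqint -!(itgZ leb_lf)// -(itgD leb_lf); [|exact: lbmZ..].
  apply: (itg_le leb_lf); first by apply: lbmX; exact: lbmD.
    by apply: lbmD; exact: lbmZ.
  move=> t _; set a := f t; set b := g t.
  rewrite -subr_ge0 (_ : _ - _ = (q * a - p * b) ^+ 2 / (p * q)).
    by apply: divr_ge0; [exact: sqr_ge0|apply: mulr_ge0; exact: ltW].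
  by move: (gt_eqF p0) (gt_eqF q0); clear => n1 n2; field; rewrite n1 n2.
have -> : (p + q) ^+ 2 = (1 + q / p) * p ^+ 2 + (1 + p / q) * q ^+ 2.
  by move: (gt_eqF p0) (gt_eqF q0); clear => n1 n2; field; rewrite n1 n2.
apply: lerD; apply: ler_wpM2l => //; apply: addr_ge0 => //; apply: divr_ge0; exact: ltW.
Qed.

Lemma sqint_scale (s T k : R) f : lbm f ->
  sqint s T (fun t => k * f t) = k ^+ 2 * sqint s T f.
Proof.
move=> lf; rewrite /sqint -(itgZ leb_lf); last exact: lbmX.
by apply: eq_itg => t _; rewrite exprMn.
Qed.

Lemma sqint_scale_le (s T k p : R) f : lbm f -> sqint s T f <= p ^+ 2 ->
  sqint s T (fun t => k * f t) <= (k * p) ^+ 2.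
Proof.
by move=> lf H; rewrite sqint_scale// exprMn; apply: ler_wpM2l => //; exact: sqr_ge0.
Qed.

Lemma eq_sqint (s T : R) f g : f =1 g -> sqint s T f = sqint s T g.
Proof. by move=> fg; apply: eq_itg => t _; rewrite fg. Qed.

Lemma sqint_bound (s T N : R) f : lbm f -> s <= T -> 0 <= N ->
  (forall t, s <= t <= T -> `|f t| <= N) -> sqint s T f <= N ^+ 2 * (T - s).
Proof.
move=> lf sT N0 H; rewrite -(itg_leb1 sT) -(itg_cst leb_lf).
apply: (itg_le leb_lf); [exact: lbmX|exact: lbm_cst|].
move=> t tsT; rewrite -real_normK ?num_real//.
by rewrite ler_sqr ?nnegrE// H.
Qed.

End SquareIntegrals.

(** * Marchaud's inequality along dyadic steps *)

Section Marchaud.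
Context {R : realType}.

Lemma dyadic_half (k : nat) : 2^-1 ^+ k = 2 * 2^-1 ^+ k.+1 :> R.
Proof. by rewrite exprS mulrA divff ?mul1r// pnatr_eq0. Qed.

(** Halving [h] divides [h ^+ 3] by 8; [2 / 5] is a rational bound for the corresponding rate
    [2^(-3/2)] of the norm. *)
Lemma rate_le : 8^-1 <= (2 / 5) ^+ 2 :> R.
Proof. by rewrite expr2; lra. Qed.

(* Marchaud's inequality along dyadic steps: [||D_h^2||] is recovered from
   [||D_h^3|| = O(h^(3/2))] through [D_(2h)^2 = 4 D_h^2 + 4 D_h^3 + D_h^4], and
   then [||D_h|| / h] from [||D_h^2||] through [D_(2h) = 2 D_h + D_h^2];
   [2^(-3/2) < 2/5] and [1/4 < 2/5 < 1/2] make both recursions contract. *)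
Lemma difference_quotient_bound (f : R -> R) (s T c mu : R) : continuous f -> s <= T ->
  0 < c -> 0 < mu ->
  sqint s (T + 2) f <= mu ^+ 2 ->
  (forall k, sqint s (T + 1) (fun t => let h := 2^-1 ^+ k in
     f (t + 3 * h) - 3 * f (t + 2 * h) + 3 * f (t + h) - f t) <= (c * (2 / 5) ^+ k * mu) ^+ 2) ->
  forall k, sqint s T (fun t => 2 ^+ k * (f (t + 2^-1 ^+ k) - f t)) <= ((10 + 8 * c) * mu) ^+ 2.
Proof.
move=> cf sT c0 mu0 hf h3.
have cs u : continuous (fun t => f (t + u)) by exact: continuous_shift.
have ls u : lbm (fun t => f (t + u)) by exact: continuous_lbm.
have lf : lbm f by exact: continuous_lbm.
have base u : 0 <= u -> u <= 2 -> sqint s T (fun t => f (t + u)) <= mu ^+ 2.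
  move=> u0 u2; apply: le_trans hf.
  rewrite sqint_shift//; apply: sqint_subset => //; first by rewrite lerDl.
  by rewrite lerD2l.
(* The start of the recursion needs [K >= 4], and its step needs [K / 4 + 2 / 5 * c <= 2 / 5 * K],
   that is [K >= 8 / 3 * c]. *)
pose K := 4 * c + 4.
have K0 : 0 < K by apply: addr_gt0 => //; exact: mulr_gt0.
have q0 k : 0 < (2 / 5 : R) ^+ k by apply: exprn_gt0; apply: divr_gt0.
pose h k : R := 2^-1 ^+ k.
have h0 k : 0 < h k by apply: exprn_gt0; rewrite invr_gt0.
have h1 k : h k <= 1 by apply: exprn_ile1; rewrite ?invr_ge0// invf_le1// ler1n.
pose d k t := f (t + h k) - f t.
pose dd k t := f (t + 2 * h k) - 2 * f (t + h k) + f t.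
pose d3 k t := f (t + 3 * h k) - 3 * f (t + 2 * h k) + 3 * f (t + h k) - f t.
have cd k : continuous (d k) by apply: contB => //.
have cdd k : continuous (dd k).
  by apply: contD => //; apply: contB => //; apply: contM => //; exact: cont_cst.
have cd3 k : continuous (d3 k).
  by apply: contB => //; apply: contD; [apply: contB => //|]; apply: contM => //; exact: cont_cst.
have Kmu k : 0 < K * (2 / 5) ^+ k * mu by apply: mulr_gt0 => //; exact: mulr_gt0.
have Cmu k : 0 < c * (2 / 5) ^+ k * mu by apply: mulr_gt0 => //; exact: mulr_gt0.
have hk k : h k = 2 * h k.+1 by exact: dyadic_half.
have second k : sqint s T (dd k) <= (K * (2 / 5) ^+ k * mu) ^+ 2.
  elim: k => [|k ih].
    rewrite expr0 mulr1.
    (* At step size 1 the triangle inequality suffices, with the coefficients 1, 2, 1 of the second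
       difference. *)
    apply: (@le_trans _ _ ((mu + 2 * mu + mu) ^+ 2)); last first.
      rewrite ler_sqr ?nnegrE; last 2 first.
      - by do ?[apply: addr_ge0|apply: mulr_ge0|exact: ltW].
      - by apply: mulr_ge0; exact: ltW.
      have -> : mu + 2 * mu + mu = 4 * mu by ring.
      by apply: ler_wpM2r; [exact: ltW|rewrite lerDr mulr_ge0// ltW].
    have mu2 : 0 < 2 * mu by exact: mulr_gt0.
    apply: sqint_add => //; [|exact: addr_gt0| |].
    - by apply: lbmB => //; exact: lbmZ.
    - rewrite (@eq_sqint _ _ _ _ (fun t => f (t + 2 * h 0%N) + (-2) * f (t + h 0%N))); last first.
        by move=> t; rewrite mulNr.
      apply: sqint_add => //; first exact: lbmZ.
        by apply: base; rewrite /h expr0 mulr1.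
      rewrite sqint_scale// sqrrN exprMn; apply: ler_wpM2l; first exact: sqr_ge0.
      by apply: base; rewrite /h expr0// ler1n.
    - have := base 0 (lexx 0) (ler0n _ 2); by rewrite (@eq_sqint _ _ _ _ f)// => t; rewrite addr0.
  (* The relation for [D_(2h)^2], solved for [D_h^2], with [D_h^4] written as a shifted third
     difference minus an unshifted one. The shift is why third differences are controlled up to
     [T + 1]. *)
  rewrite (@eq_sqint _ _ _ _ (fun t => (4^-1 * dd k t + (- (3 / 4)) * d3 k.+1 t) + (- 4^-1) * d3 k.+1 (t + h k.+1))); last first.
    move=> t; rewrite /dd /d3 (hk k); set u := h k.+1.
    rewrite (_ : t + 2 * (2 * u) = t + 4 * u); last by ring.
    rewrite (_ : t + u + 3 * u = t + 4 * u); last by ring.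
    rewrite (_ : t + u + 2 * u = t + 3 * u); last by ring.
    rewrite (_ : t + u + u = t + 2 * u); last by ring.
    by field.
  have ld3 : lbm (d3 k.+1) by exact: continuous_lbm.
  have ld3s : lbm (fun t => d3 k.+1 (t + h k.+1)) by apply: continuous_lbm; exact: continuous_shift.
  have ldd : lbm (dd k) by exact: continuous_lbm.
  have T1 : T <= T + 1 by rewrite lerDl.
  have e3 : sqint s T (d3 k.+1) <= (c * (2 / 5) ^+ k.+1 * mu) ^+ 2.
    by apply: le_trans (h3 k.+1); exact: sqint_subset.
  have e4 : sqint s T (fun t => d3 k.+1 (t + h k.+1)) <= (c * (2 / 5) ^+ k.+1 * mu) ^+ 2.
    apply: le_trans (h3 k.+1); rewrite sqint_shift//; apply: sqint_subset => //.
      by rewrite lerDl ltW.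
    by rewrite lerD2l.
  apply: (@le_trans _ _ ((4^-1 * (K * (2 / 5) ^+ k * mu) + 3 / 4 * (c * (2 / 5) ^+ k.+1 * mu)
     + 4^-1 * (c * (2 / 5) ^+ k.+1 * mu)) ^+ 2)).
    have i4 : 0 < 4^-1 :> R by rewrite invr_gt0.
    have i34 : 0 < 3 / 4 :> R by apply: divr_gt0.
    have x1 := mulr_gt0 i4 (Kmu k); have x2 := mulr_gt0 i34 (Cmu k.+1).
    apply: sqint_add => //; try exact: lbmZ.
    - by apply: lbmD; exact: lbmZ.
    - exact: addr_gt0.
    - exact: mulr_gt0.
    - apply: sqint_add => //; try exact: lbmZ; first exact: sqint_scale_le.
      by rewrite sqint_scale// sqrrN -sqint_scale//; exact: sqint_scale_le.
    - by rewrite sqint_scale// sqrrN -sqint_scale//; exact: sqint_scale_le.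
  have qm : 0 < (2 / 5) ^+ k * mu by exact: mulr_gt0.
  rewrite ler_sqr ?nnegrE; last 2 first.
  - have := Kmu k; have := Cmu k.+1; set u := _ * mu; set v := _ * mu; clear; lra.
  - exact: ltW.
  rewrite !exprS -!mulrA; move: qm; set u := _ ^+ k * mu; rewrite /K => qm.
  have cu : 0 < c * u by exact: mulr_gt0.
  have -> : (4 * c + 4) * u = 4 * (c * u) + 4 * u by ring.
  have -> : (4 * c + 4) * (2 * (5^-1 * u)) = 8 / 5 * (c * u) + 8 / 5 * u by ring.
  have -> : c * (2 * (5^-1 * u)) = 2 / 5 * (c * u) by ring.
  move: qm cu; set v := c * u; clear; lra.
have r0 k : 0 < (4 / 5 : R) ^+ k by apply: exprn_gt0; apply: divr_gt0.
have r1 k : (4 / 5 : R) ^+ k <= 1.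
  by apply: exprn_ile1; rewrite ?divr_ge0// ler_pdivrMr// mul1r ler_nat.
have pos k : 0 < (2 + 2 * K - 2 * K * (4 / 5) ^+ k) * mu.
  apply: mulr_gt0 => //.
  have : 2 * K * (4 / 5) ^+ k <= 2 * K * 1 by apply: ler_wpM2l => //; apply: mulr_ge0 => //; exact: ltW.
  rewrite mulr1; set u := _ * _ ^+ k; clear; lra.
(* The factor is a geometric partial sum: passing from [k] to [k.+1] adds
   [2 / 5 * K * (4 / 5) ^+ k]. It stays below [2 + 2 * K], which is [10 + 8 * c]. *)
have first k : sqint s T (fun t => 2 ^+ k * d k t) <= ((2 + 2 * K - 2 * K * (4 / 5) ^+ k) * mu) ^+ 2.
  elim: k => [|k ih].
    rewrite !expr0 mulr1 addrK.
    rewrite (@eq_sqint _ _ _ _ (fun t => f (t + h 0%N) + (-1) * f t)); last first.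
      by move=> t; rewrite mul1r mulN1r.
    rewrite mulr_natl mulr2n; apply: sqint_add => //; first exact: lbmZ.
      by apply: base; rewrite /h expr0// ler1n.
    rewrite sqint_scale// sqrrN expr1n mul1r.
    have := base 0 (lexx 0) (ler0n _ 2); by rewrite (@eq_sqint _ _ _ _ f)// => t; rewrite addr0.
  rewrite (@eq_sqint _ _ _ _ (fun t => 2 ^+ k * d k t + (- 2 ^+ k) * dd k.+1 t)); last first.
    by move=> t; rewrite exprS /d /dd (hk k); ring.
  apply: (@le_trans _ _ (((2 + 2 * K - 2 * K * (4 / 5) ^+ k) * mu + 2 ^+ k * (K * (2 / 5) ^+ k.+1 * mu)) ^+ 2)).
    have p2 : 0 < 2 ^+ k :> R by exact: exprn_gt0.
    have ld : lbm (d k) by exact: continuous_lbm.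
    have ldd : lbm (dd k.+1) by exact: continuous_lbm.
    apply: sqint_add => //; try exact: lbmZ; first exact: mulr_gt0.
    by rewrite sqint_scale// sqrrN -sqint_scale//; exact: sqint_scale_le.
  have E : 2 ^+ k * (K * (2 / 5) ^+ k.+1 * mu) = 2 / 5 * K * (4 / 5) ^+ k * mu.
    have -> : (4 / 5 : R) = 2 * (2 / 5) by rewrite mulrA -natrM.
    by move: (2 / 5 : R) => q; rewrite exprS exprMn; ring.
  rewrite E ler_sqr ?nnegrE; last 2 first.
  - apply: addr_ge0; first exact: ltW.
    by do ?[apply: mulr_ge0|exact: ltW|exact: divr_ge0].
  - exact: ltW.
  rewrite -mulrDl; apply: ler_wpM2r; first exact: ltW.
  rewrite exprS; set u := (4 / 5) ^+ k; clear; lra.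
move=> k; apply: le_trans (first k) _.
rewrite ler_sqr ?nnegrE; last 2 first.
- exact: ltW.
- by apply: mulr_ge0; [apply: addr_ge0 => //; apply: mulr_ge0 => //; exact: ltW|exact: ltW].
apply: ler_wpM2r; first exact: ltW.
have : 0 <= 2 * K * (4 / 5) ^+ k by do ?[apply: mulr_ge0|exact: ltW|by []].
rewrite {1}/K; set u := _ * _ ^+ k; rewrite /K; clear; lra.
Qed.

End Marchaud.

Arguments rate_le : clear implicits.

(** * Bounds on full time derivatives *)

Section FullGain.
Context {R : realType} (m : {measure set (measurableTypeR R) -> \bar R}).
Hypotheses (m_lf : locally_finite m) (m2 : two_sided m).

(** Time differences of solutions are solutions, so [half_gain] can be used three times on nested
    boxes, each time with one factor [h] in the square. *)
Lemma third_difference_gain (r s T : R) : 0 < r -> 0 < s -> s <= T ->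
  exists r' s' T' C, [/\ r <= r', 0 < s', s' <= s, T <= T' & 0 < C] /\
    forall F, smooth_solution m F -> forall M,
    (forall z, `|z| <= r' -> sqint s' T' (F 0%N z) <= M) ->
    forall h, 0 < h -> h <= 1 ->
    forall x, `|x| <= r -> sqint s T (delta h (delta h (delta h F)) 0 x) <= C * h ^+ 3 * M.
Proof.
move=> r0 s0 sT.
have [r1 [s1 [T1 [C1 [[rr1 s10 ss1 TT1 C10] H1]]]]] := half_gain m_lf m2 r0 s0 sT.
have r10 : 0 < r1 by exact: lt_le_trans rr1.
have sT1 : s1 <= T1 by apply: le_trans ss1 (le_trans sT TT1).
have [r2 [s2 [T2 [C2 [[rr2 s20 ss2 TT2 C20] H2]]]]] := half_gain m_lf m2 r10 s10 sT1.
have r20 : 0 < r2 by exact: lt_le_trans rr2.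
have sT2 : s2 <= T2 by apply: le_trans ss2 (le_trans sT1 TT2).
have [r3 [s3 [T3 [C3 [[rr3 s30 ss3 TT3 C30] H3]]]]] := half_gain m_lf m2 r20 s20 sT2.
exists r3, s3, T3, (C1 * C2 * C3); split.
  split => //.
  - exact: le_trans rr1 (le_trans rr2 rr3).
  - exact: le_trans ss3 (le_trans ss2 ss1).
  - exact: le_trans TT1 (le_trans TT2 TT3).
  - by apply: mulr_gt0 => //; exact: mulr_gt0.
move=> F sF M HM h h0 h1 x xr.
have sD := smooth_solution_delta m_lf sF h0.
have sD2 := smooth_solution_delta m_lf sD h0.
have E3 := H3 F sF M HM h h0 h1.
have E2 := H2 _ sD _ E3 h h0 h1.
have := H1 _ sD2 _ E2 h h0 h1 x xr.
by rewrite (_ : C1 * h * (C2 * h * (C3 * h * M)) = C1 * C2 * C3 * h ^+ 3 * M)//; ring.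
Qed.

Lemma sol_increment_le F n x (a b N : R) : smooth_solution m F -> a <= b ->
  (forall t, a <= t <= b -> `|F n.+1 x t| <= N) -> `|F n x b - F n x a| <= N * (b - a).
Proof.
move=> sF ab H; have [_ dF _] := sF.
rewrite -(itg_FTC ab (fun t _ => dF n x t) (sol_cont_t sF n.+1 x)).
rewrite -(itg_leb1 ab); apply: (itg_bound leb_lf) => //; exact: (sol_lbm_t sF).
Qed.

(** Marchaud's inequality bounds the dyadic difference quotients uniformly in the step; a step fine
    enough for the given solution then replaces the quotient by the derivative. *)
Lemma full_gain (r s T : R) : 0 < r -> 0 < s -> s <= T ->
  exists r' s' T' C, [/\ r <= r', 0 < s', s' <= s, T <= T' & 0 < C] /\
    forall F, smooth_solution m F -> forall mu, 0 < mu ->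
    (forall z, `|z| <= r' -> sqint s' T' (F 0%N z) <= mu ^+ 2) ->
    forall x, `|x| <= r -> sqint s T (F 1%N x) <= (C * mu) ^+ 2.
Proof.
move=> r0 s0 sT; have sT1 : s <= T + 1 by apply: le_trans sT _; rewrite lerDl.
have [r' [s' [T' [C [[rr' s'0 ss' TT' C0] H]]]]] := third_difference_gain r0 s0 sT1.
exists r', s', (T' + 2), (11 + 8 * (C + 1)); split.
  split => //; last by apply: addr_gt0 => //; apply: mulr_gt0 => //; exact: addr_gt0.
  by apply: (@le_trans _ _ (T + 1)); [rewrite lerDl|apply: le_trans TT' _; rewrite lerDl].
move=> F sF mu mu0 HM x xr; have [cF dF hF] := sF.
have lF := sol_lbm_t sF 0; have cFt := sol_cont_t sF 0 x.
have HM' z : `|z| <= r' -> sqint s' T' (F 0%N z) <= mu ^+ 2.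
  by move=> zr; apply: le_trans (HM z zr); apply: sqint_subset => //; rewrite lerDl.
have C10 : 0 < C + 1 by exact: addr_gt0.
have base : sqint s (T + 2) (F 0%N x) <= mu ^+ 2.
  apply: le_trans (HM x (le_trans xr rr')); apply: sqint_subset => //.
  by move: TT'; clear; lra.
(* The constant [C + 1] works because [C <= (C + 1) ^+ 2], so no root of [C] is taken. *)
have h3 k : sqint s (T + 1) (fun t => let h := 2^-1 ^+ k in
   F 0%N x (t + 3 * h) - 3 * F 0%N x (t + 2 * h) + 3 * F 0%N x (t + h) - F 0%N x t)
   <= ((C + 1) * (2 / 5) ^+ k * mu) ^+ 2.
  have h0 : 0 < 2^-1 ^+ k :> R by apply: exprn_gt0; rewrite invr_gt0.
  have h1 : 2^-1 ^+ k <= 1 :> R by apply: exprn_ile1; rewrite ?invr_ge0// invf_le1// ler1n.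
  have := H F sF _ HM' _ h0 h1 x xr.
  rewrite (@eq_sqint _ _ _ _ (fun t => let h := 2^-1 ^+ k in
     F 0%N x (t + 3 * h) - 3 * F 0%N x (t + 2 * h) + 3 * F 0%N x (t + h) - F 0%N x t)); last first.
    move=> t /=; rewrite /delta; set h := 2^-1 ^+ k.
    rewrite (_ : t + h + h + h = t + 3 * h); last by ring.
    rewrite (_ : t + h + h = t + 2 * h); last by ring.
    by ring.
  have := rate_le R; move: (2 / 5 : R) => q q2.
  move/le_trans; apply; rewrite !exprMn; apply: ler_wpM2r; first exact: sqr_ge0.
  have -> : (2^-1 ^+ k) ^+ 3 = (8^-1) ^+ k :> R.
    by rewrite -exprM mulnC exprM; congr (_ ^+ k); rewrite !exprS expr0 mulr1 -!invfM; congr (_^-1); rewrite -!natrM.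
  rewrite -exprM mulnC exprM.
  apply: ler_pM; [exact: ltW|by apply: exprn_ge0; rewrite invr_ge0| |].
    rewrite -subr_ge0 (_ : _ - _ = C ^+ 2 + C + 1); last by ring.
    by do ?[apply: addr_ge0|exact: sqr_ge0|exact: ltW|by []].
  by apply: lerXn2r; rewrite ?nnegrE ?invr_ge0 ?sqr_ge0.
have B := difference_quotient_bound cFt sT C10 mu0 base h3.
have [N N0 HN] : exists2 N : R, 0 < N & forall t, s <= t <= T + 1 -> `|F 2%N x t| <= N.
  by apply: lbm_bounded; exact: (sol_lbm_t sF).
pose N' := N * (T - s + 1).
have Ts : 0 <= T - s by rewrite subr_ge0.
have N'0 : 0 < N' by apply: mulr_gt0 => //; apply: ltr_wpDl.
(* [N] bounds the second time derivative and depends on [F], but it only decides how fine the step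
   is. For this [k] the quotient differs from the derivative by at most [mu] in norm, which turns 10
   into 11 in the constant. *)
pose k := (Num.truncn (N' / mu)).+1.
have kN : 2^-1 ^+ k * N' <= mu.
  rewrite exprVn mulrC ler_pdivrMr ?exprn_gt0// mulrC -ler_pdivrMr//.
  apply: ltW; apply: lt_le_trans (truncnS_gt _) _.
  by rewrite -natrX ler_nat; apply: ltnW; exact: ltn_expl.
have h0 : 0 < 2^-1 ^+ k :> R by apply: exprn_gt0; rewrite invr_gt0.
have h1 : 2^-1 ^+ k <= 1 :> R by apply: exprn_ile1; rewrite ?invr_ge0// invf_le1// ler1n.
have hk : 2 ^+ k = (2^-1 ^+ k)^-1 :> R by rewrite exprVn invrK.
move: (B k); rewrite hk; set h := 2^-1 ^+ k in h0 h1 kN *; move=> Bk.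
pose e t := F 1%N x t - h^-1 * (F 0%N x (t + h) - F 0%N x t).
have le : lbm e.
  apply: lbmB; first exact: (sol_lbm_t sF).
  by apply: lbmZ; apply: lbmB => //; apply: continuous_lbm; exact: continuous_shift.
have eN t : s <= t <= T -> `|e t| <= N * h.
  move=> /andP[st tT]; have th : t <= t + h by rewrite lerDl ltW.
  have I1 : F 0%N x (t + h) - F 0%N x t = itg leb t (t + h) (F 1%N x).
    by rewrite (itg_FTC th (fun u _ => dF 0%N x u) (sol_cont_t sF 1 x)).
  have lF1 := sol_lbm_t sF 1 x.
  have E : e t = h^-1 * itg leb t (t + h) (fun u => F 1%N x t - F 1%N x u).
    rewrite (itgB leb_lf) ?(itg_cst leb_lf _ _ (F 1%N x t)) ?itg_leb1//; last exact: lbm_cst.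
    rewrite /e I1; move: (gt_eqF h0); clear => n0.
    by set A := itg _ _ _ _; field; rewrite n0.
  rewrite E normrM gtr0_norm ?invr_gt0// mulrC ler_pdivrMr//.
  have -> : N * h * h = (N * h) * itg leb t (t + h) (fun=> 1).
    by rewrite itg_leb1// addrC addKr.
  apply: (itg_bound leb_lf); first by apply: lbmB => //; exact: lbm_cst.
  move=> u /andP[tu uh]; rewrite distrC; apply: le_trans (sol_increment_le (N := N) sF tu _) _.
    move=> v /andP[tv vu]; apply: HN; rewrite (le_trans st tv) /=.
    by apply: le_trans vu (le_trans uh _); exact: lerD.
  by apply: ler_wpM2l; [exact: ltW|rewrite lerBlDl].
have eB : sqint s T e <= mu ^+ 2.
  apply: le_trans (sqint_bound le sT _ eN) _; first by apply: mulr_ge0; exact: ltW.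
  apply: (@le_trans _ _ ((h * N') ^+ 2)); last first.
    by rewrite ler_sqr ?nnegrE//; [apply: mulr_ge0; exact: ltW|exact: ltW].
  have -> : h * N' = N * h * (T - s + 1) by rewrite /N'; ring.
  rewrite [leRHS]exprMn; apply: ler_wpM2l; first exact: sqr_ge0.
  have : 0 <= (T - s) ^+ 2 by exact: sqr_ge0.
  move: Ts; set u := T - s; clear; rewrite !expr2; set v := u * u => ? ?.
  have -> : (u + 1) * (u + 1) = v + 2 * u + 1 by rewrite /v; ring.
  lra.
rewrite (@eq_sqint _ _ _ _ (fun t => h^-1 * (F 0%N x (t + h) - F 0%N x t) + e t)); last first.
  by move=> t; rewrite /e addrC subrK.
have -> : (11 + 8 * (C + 1)) * mu = (10 + 8 * (C + 1)) * mu + mu by ring.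
apply: sqint_add => //.
- by apply: lbmZ; apply: lbmB => //; apply: continuous_lbm; exact: continuous_shift.
- by apply: mulr_gt0 => //; apply: addr_gt0 => //; exact: mulr_gt0.
Qed.

Lemma iterated_gain (n : nat) (r s T : R) : 0 < r -> 0 < s -> s <= T ->
  exists r' s' T' C, [/\ r <= r', 0 < s', s' <= s, T <= T' & 0 < C] /\
    forall F, smooth_solution m F -> forall mu, 0 < mu ->
    (forall z, `|z| <= r' -> sqint s' T' (F 0%N z) <= mu ^+ 2) ->
    forall x, `|x| <= r -> sqint s T (F n x) <= (C * mu) ^+ 2.
Proof.
elim: n r s T => [|n ih] r s T r0 s0 sT.
  by exists r, s, T, 1; split => // F _ mu _ H x xr; rewrite mul1r; exact: H.
have [r1 [s1 [T1 [C1 [[rr1 s10 ss1 TT1 C10] H1]]]]] := ih r s T r0 s0 sT.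
have r10 : 0 < r1 by exact: lt_le_trans rr1.
have sT1 : s1 <= T1 by apply: le_trans ss1 (le_trans sT TT1).
have [r2 [s2 [T2 [C2 [[rr2 s20 ss2 TT2 C20] H2]]]]] := full_gain r10 s10 sT1.
exists r2, s2, T2, (C1 * C2); split.
  split => //.
  - exact: le_trans rr1 rr2.
  - exact: le_trans ss2 ss1.
  - exact: le_trans TT1 TT2.
  - exact: mulr_gt0.
move=> F sF mu mu0 HM x xr; rewrite -mulrA.
apply: (H1 _ (smooth_solution_shift sF)) => //; first exact: mulr_gt0.
exact: H2.
Qed.

(** A Sobolev embedding in time: the derivative of the square is [2 * (F n * F n.+1)], so the square
    oscillates by at most [J] on [[s, T]] and is compared with its mean. *)
Lemma sup_le_sqint F n x (s T : R) : smooth_solution m F -> s < T ->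
  forall t, s <= t <= T -> F n x t ^+ 2 <=
    (1 + (T - s)^-1) * sqint s T (F n x) + sqint s T (F n.+1 x).
Proof.
move=> sF sT t /andP[st tT]; have [_ dF _] := sF.
have cF := sol_cont_t sF; have lF k := sol_lbm_t sF k x.
have Ts : 0 < T - s by rewrite subr_gt0.
pose J := sqint s T (F n x) + sqint s T (F n.+1 x).
have l2 k : lbm (fun t => F k x t ^+ 2) by exact: lbmX.
have inc a b : s <= a -> a <= b -> b <= T -> `|F n x b ^+ 2 - F n x a ^+ 2| <= J.
  move=> sa ab bT.
  have I : F n x b ^+ 2 - F n x a ^+ 2 = itg leb a b (fun u => 2 * (F n x u * F n.+1 x u)).
    rewrite !expr2; apply/esym.
    have := @itg_FTC R a b (fun u => 2 * (F n x u * F n.+1 x u)) (fun u => F n x u * F n x u) ab; apply.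
      move=> u _; have du := dF n x u.
      by apply: is_derive_eq; rewrite /GRing.scale /=; ring.
    by apply: contM; [exact: cont_cst|apply: contM; exact: cF].
  have lP : lbm (fun u => 2 * (F n x u * F n.+1 x u)) by apply: lbmZ; exact: lbmM.
  rewrite I; apply: le_trans (itg_norm leb_lf _ _ lP) _.
  apply: (@le_trans _ _ (itg leb a b (fun u => F n x u ^+ 2 + F n.+1 x u ^+ 2))).
    apply: (itg_le leb_lf); [exact: lbm_norm|exact: lbmD|].
    move=> u _; set p := F n x u; set q := F n.+1 x u.
    have A1 : 0 <= (p + q) ^+ 2 by exact: sqr_ge0.
    have A2 : 0 <= (p - q) ^+ 2 by exact: sqr_ge0.
    rewrite ler_norml; apply/andP; split.
      by rewrite -subr_ge0 (_ : _ - _ = (p + q) ^+ 2)//; ring.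
    by rewrite -subr_ge0 (_ : _ - _ = (p - q) ^+ 2)//; ring.
  rewrite /J /sqint -(itgD leb_lf)//; apply: (itg_subset leb_lf) => //; first exact: lbmD.
  by move=> u _; apply: addr_ge0; exact: sqr_ge0.
have key u : s <= u <= T -> F n x t ^+ 2 - J <= F n x u ^+ 2.
  move=> /andP[su uT]; rewrite lerBlDl -lerBlDr.
  have [tu|ut] := leP t u.
    by apply: le_trans (inc t u st tu uT); rewrite distrC ler_norm.
  by apply: le_trans (inc u t su (ltW ut) tT); exact: ler_norm.
have : (F n x t ^+ 2 - J) * (T - s) <= sqint s T (F n x).
  rewrite -(itg_leb1 (ltW sT)) -(itg_cst leb_lf); apply: (itg_le leb_lf) => //; exact: lbm_cst.
rewrite -ler_pdivlMr// lerBlDr /J; set a := sqint _ _ _; set b := sqint _ _ _.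
by rewrite mulrDl mul1r mulrC; set c := _ * a; clear; lra.
Qed.

(** The form needed for limits: [iterated_gain] for the orders [n] and [n.+1], fed into
    [sup_le_sqint]. The box and the constant do not depend on the solution. *)
Lemma sup_gain (n : nat) (r s T : R) : 0 < r -> 0 < s -> s < T ->
  exists r' s' T' C, [/\ r <= r', 0 < s', s' <= s, T <= T' & 0 < C] /\
    forall F, smooth_solution m F -> forall mu, 0 < mu ->
    (forall z t, `|z| <= r' -> s' <= t <= T' -> `|F 0%N z t| <= mu) ->
    forall x t, `|x| <= r -> s <= t <= T -> `|F n x t| <= C * mu.
Proof.
move=> r0 s0 sT.
have [r1 [s1 [T1 [C1 [[rr1 s10 ss1 TT1 C10] H1]]]]] := iterated_gain n r0 s0 (ltW sT).
have [r2 [s2 [T2 [C2 [[rr2 s20 ss2 TT2 C20] H2]]]]] := iterated_gain n.+1 r0 s0 (ltW sT).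
pose r' := Num.max r1 r2; pose s' := Num.min s1 s2; pose T' := Num.max T1 T2.
have Ts : 0 < T - s by rewrite subr_gt0.
pose W := (1 + (T - s)^-1) * C1 ^+ 2 + C2 ^+ 2.
have W0 : 0 < W.
  apply: addr_gt0; last exact: exprn_gt0.
  by apply: mulr_gt0; [apply: addr_gt0 => //; rewrite invr_gt0|exact: exprn_gt0].
(* The added 1 gives [T' - s' <= L ^+ 2]; in the same way [W + 1] is used through
   [W <= (W + 1) ^+ 2]. *)
pose L := T' - s' + 1.
have s'1 : s' <= s1 by rewrite ge_min lexx.
have s'2 : s' <= s2 by rewrite ge_min lexx orbT.
have T'1 : T1 <= T' by rewrite le_max lexx.
have T'2 : T2 <= T' by rewrite le_max lexx orbT.
have s'0 : 0 < s' by rewrite lt_min s10.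
have sT' : s' <= T' by apply: le_trans s'1 (le_trans ss1 (le_trans (ltW sT) (le_trans TT1 T'1))).
have L0 : 0 < L by apply: ltr_wpDl => //; rewrite subr_ge0.
exists r', s', T', ((W + 1) * L); split.
  split => //.
  - by rewrite le_max rr1.
  - exact: le_trans s'1 ss1.
  - exact: le_trans TT1 T'1.
  - by apply: mulr_gt0 => //; exact: addr_gt0.
move=> F sF mu mu0 HM x t xr tsT.
have B z : `|z| <= r' -> sqint s' T' (F 0%N z) <= (mu * L) ^+ 2.
  move=> zr; have l := sol_lbm_t sF 0 z.
  apply: le_trans (sqint_bound l sT' (ltW mu0) (fun t => HM z t zr)) _.
  rewrite exprMn; apply: ler_wpM2l; first exact: sqr_ge0.
  have u0 : 0 <= T' - s' by rewrite subr_ge0.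
  have : 0 <= (T' - s') ^+ 2 by exact: sqr_ge0.
  move: u0; rewrite /L; set u := T' - s'; clear; rewrite !expr2; set v := u * u => ? ?.
  have -> : (u + 1) * (u + 1) = v + 2 * u + 1 by rewrite /v; ring.
  lra.
have muL : 0 < mu * L by exact: mulr_gt0.
have E1 : sqint s T (F n x) <= (C1 * (mu * L)) ^+ 2.
  apply: (H1 F sF _ muL) => // z zr.
  apply: le_trans (B z _); last by rewrite le_max zr.
  by apply: sqint_subset => //; exact: (sol_lbm_t sF).
have E2 : sqint s T (F n.+1 x) <= (C2 * (mu * L)) ^+ 2.
  apply: (H2 F sF _ muL) => // z zr.
  apply: le_trans (B z _); last by rewrite le_max zr orbT.
  by apply: sqint_subset => //; exact: (sol_lbm_t sF).
have E3 := sup_le_sqint n x sF sT tsT.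
have E4 : F n x t ^+ 2 <= W * (mu * L) ^+ 2.
  apply: le_trans E3 _.
  have -> : W * (mu * L) ^+ 2 = (1 + (T - s)^-1) * (C1 * (mu * L)) ^+ 2 + (C2 * (mu * L)) ^+ 2.
    by rewrite /W; ring.
  apply: lerD => //.
  by apply: ler_wpM2l => //; apply: addr_ge0 => //; rewrite invr_ge0 ltW.
have -> : (W + 1) * L * mu = (W + 1) * (mu * L) by ring.
rewrite -ler_sqr ?nnegrE//; last by apply: mulr_ge0; [apply: addr_ge0 => //; exact: ltW|exact: ltW].
rewrite real_normK ?num_real//; apply: le_trans E4 _.
rewrite [leRHS]exprMn; apply: ler_wpM2r; first exact: sqr_ge0.
have : 0 <= W ^+ 2 by exact: sqr_ge0.
move: W0; clear; rewrite !expr2; set v := W * W => ? ?.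
have -> : (W + 1) * (W + 1) = v + 2 * W + 1 by rewrite /v; ring.
  lra.
Qed.

End FullGain.

(** * Smooth functions on the line *)

Section SmoothFunctions.
Context {R : realType}.
Implicit Types (f g : R -> R).

Fixpoint Cn (k : nat) f : Prop :=
  if k is k'.+1 then (forall x, derivable f x 1) /\ Cn k' ((derive1 f)) else True.

Definition smooth1 f := forall k, Cn k f.

Lemma derive1_eq f f' : (forall x : R, is_derive x (1 : R) f (f' x)) -> (derive1 f) = f'.
Proof. by move=> df; apply/funext => x; rewrite derive1E; have [_ ->] := df x. Qed.

Lemma CnS k f f' : (forall x : R, is_derive x (1 : R) f (f' x)) -> Cn k f' -> Cn k.+1 f.
Proof. by move=> df cf; split => [x|]; [have [] := df x|rewrite (derive1_eq df)]. Qed.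

Lemma Cn_deriv k f : Cn k.+1 f -> forall x : R, is_derive x (1 : R) f ((derive1 f) x).
Proof. by case=> df _ x; apply: DeriveDef => //; rewrite derive1E. Qed.

Lemma CnW k f : Cn k.+1 f -> Cn k f.
Proof. by elim: k f => // k ih f [df cf]; split => //; exact: ih. Qed.

Lemma is_deriveD1 f g (x lf lg : R) : is_derive x (1 : R) f lf -> is_derive x (1 : R) g lg ->
  is_derive x (1 : R) (fun y => f y + g y) (lf + lg).
Proof. by move=> df dg; exact: is_deriveD. Qed.

Lemma is_deriveM1 f g (x lf lg : R) : is_derive x (1 : R) f lf -> is_derive x (1 : R) g lg ->
  is_derive x (1 : R) (fun y => f y * g y) (lf * g x + f x * lg).
Proof. by move=> df dg; apply: is_derive_eq; rewrite /GRing.scale /=; ring. Qed.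

Lemma Cn_cst k (c : R) : Cn k (fun=> c).
Proof.
elim: k c => // k ih c.
exact: (CnS (f' := fun=> 0) (fun x => is_derive_cst c x (1 : R)) (ih 0)).
Qed.

Lemma CnD k f g : Cn k f -> Cn k g -> Cn k (fun x => f x + g x).
Proof.
elim: k f g => // k ih f g cf cg.
exact: (CnS (fun x => is_deriveD1 (Cn_deriv cf x) (Cn_deriv cg x)) (ih _ _ cf.2 cg.2)).
Qed.

Lemma CnM k f g : Cn k f -> Cn k g -> Cn k (fun x => f x * g x).
Proof.
elim: k f g => // k ih f g cf cg.
apply: (CnS (fun x => is_deriveM1 (Cn_deriv cf x) (Cn_deriv cg x))).
by apply: CnD; apply: ih; [exact: cf.2|exact: CnW|exact: CnW|exact: cg.2].
Qed.

Lemma CnZ k (c : R) f : Cn k f -> Cn k (fun x => c * f x).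
Proof. by move=> cf; apply: CnM => //; exact: Cn_cst. Qed.

Lemma is_derive_affine f (a b l x : R) : is_derive (a + b * x) (1 : R) f l ->
  is_derive x (1 : R) (fun y => f (a + b * y)) (b * l).
Proof.
move=> df; have d1 : is_derive x (1 : R) (fun y => a + b * y) b.
  by apply: is_derive_eq; rewrite /GRing.scale /=; ring.
by have := @is_derive1_comp R f (fun y => a + b * y) x l b df d1; rewrite mulrC.
Qed.

Lemma Cn_affine k (a b : R) f : Cn k f -> Cn k (fun x => f (a + b * x)).
Proof.
elim: k f => // k ih f cf.
exact: (CnS (fun x => is_derive_affine (Cn_deriv cf (a + b * x))) (CnZ b (ih _ cf.2))).
Qed.

Lemma smooth1_derivn f n : smooth1 f -> smooth1 (derive1n n f).
Proof.
by move=> sf; elim: n => // n ih k; have [_] := ih k.+1.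
Qed.

Lemma smooth1_is_derive f n (x : R) : smooth1 f ->
  is_derive x (1 : R) (derive1n n f) (derive1n n.+1 f x).
Proof. by move=> sf; exact: (@Cn_deriv 0 _ (smooth1_derivn n sf 1%N)). Qed.

Lemma smooth1_continuous f : smooth1 f -> continuous f.
Proof. by move=> sf x; exact: is_derive_continuous (Cn_deriv (sf 1%N) x). Qed.

(** A quadratic remainder is the criterion behind three derivatives: of [flat] at 0, of mollified
    functions, and of limits of sequences. Quadratic remainders pass to limits and under
    integrals. *)
Lemma is_derive_quadratic f (t l C d : R) : 0 < d ->
  (forall h, `|h| < d -> `|f (t + h) - f t - h * l| <= C * h ^+ 2) ->
  is_derive t (1 : R) f l.
Proof.
move=> d0 H.
have C0 : 0 <= `|C| by [].
have lim : h^-1 *: ((f \o shift t) (h *: (1 : R)) - f t) @[h --> (0 : R)^'] --> l.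
  apply/cvgrPdist_le => e e0.
  near=> h.
  have h0 : h != 0 by near: h; exact: nbhs_dnbhs_neq.
  have hd : `|h| < d.
    by near: h; apply: dnbhs0_lt.
  have he : `|h| <= e / (`|C| + 1).
    by near: h; apply: dnbhs0_le; apply: divr_gt0 => //; exact: ltr_wpDl.
  rewrite /= /GRing.scale /= mulr1 addrC.
  have -> : - (h^-1 * (f (h + t) - f t)) + l = - (h^-1 * (f (t + h) - f t - h * l)).
    by rewrite (addrC h t); field.
  rewrite normrN normrM normfV ler_pdivrMl ?normr_gt0//.
  apply: le_trans (H h hd) _; rewrite -real_normK ?num_real// expr2 mulrCA.
  apply: ler_wpM2l => //.
  apply: (@le_trans _ _ ((`|C| + 1) * `|h|)).
    by apply: ler_wpM2r => //; apply: le_trans (ler_norm C) _; rewrite lerDl.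
  by rewrite mulrC -ler_pdivlMr//; exact: ltr_wpDl.
apply: DeriveDef; first by apply/cvg_ex; exists l.
exact: cvg_lim.
Unshelve. all: end_near. Qed.

(** The classical smooth function flat at 0, with negative powers attached: the derivative of
    [flat n] combines [flat n.+1] and [flat n.+2], so the family is closed under differentiation. *)
Definition flat (n : nat) (x : R) : R :=
  if 0 < x then x^-1 ^+ n * expR (- x^-1) else 0.

Lemma flat_ge0 n x : 0 <= flat n x.
Proof.
rewrite /flat; case: ifP => // x0; apply: mulr_ge0; last exact: expR_ge0.
by apply: exprn_ge0; rewrite invr_ge0 ltW.
Qed.

(** With [y = x^-1] and [N = n.+2], [expR y] is at least [(y / N) ^+ N]. The two powers in excess of
    [n] leave the factor [x ^+ 2], whence a zero derivative at 0. *)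
Lemma flat_le n x : flat n x <= n.+2%:R ^+ n.+2 * x ^+ 2.
Proof.
rewrite /flat; case: ifPn => [x0|_]; last first.
  by apply: mulr_ge0; [exact: exprn_ge0|exact: sqr_ge0].
set y := x^-1; have y0 : 0 < y by rewrite invr_gt0.
set N := n.+2.
have N0 : 0 < N%:R :> R by rewrite ltr0n.
have E : (y / N%:R) ^+ N <= expR y.
  have -> : expR y = expR (y / N%:R) ^+ N.
    by rewrite -expRM_natl; congr expR; rewrite mulrC divfK// gt_eqF.
  apply: lerXn2r; rewrite ?nnegrE ?expR_ge0 ?divr_ge0 ?(ltW y0)//.
  by apply: le_trans (expR_ge1Dx _); rewrite lerDr.
rewrite expRN ler_pdivrMr ?expR_gt0//.
have -> : y ^+ n = N%:R ^+ N * x ^+ 2 * (y / N%:R) ^+ N.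
  have -> : (y / N%:R) ^+ N = y * (y * y ^+ n) / N%:R ^+ N by rewrite expr_div_n !(exprS y).
  have M0 : N%:R ^+ N != 0 :> R by rewrite expf_neq0// gt_eqF.
  set a := y ^+ n; move: M0; set M := _ ^+ N => M0.
  by rewrite /y expr2; move: (gt_eqF x0) => x1; field; rewrite x1 M0.
apply: ler_wpM2l => //; apply: mulr_ge0; [exact: exprn_ge0|exact: sqr_ge0].
Qed.


Lemma flat_derive n (x : R) : is_derive x (1 : R) (flat n) (- n%:R * flat n.+1 x + flat n.+2 x).
Proof.
have [x0|x0|->] := ltgtP x 0.
- have -> : - n%:R * flat n.+1 x + flat n.+2 x = 0.
    by rewrite /flat ltNge (ltW x0) /= mulr0 addr0.
  have := is_derive_cst (0 : R) x (1 : R); apply: near_eq_is_derive.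
  near=> y; rewrite /flat ifF//; apply/negbTE; rewrite -leNgt ltW//.
  by near: y; exact: lt_nbhsl.
- have dV : is_derive x (1 : R) (fun y => y^-1) (- x ^- 2).
    have x1 : x != 0 by rewrite gt_eqF.
    have H := @is_deriveV R (fun y => y) x 1 1 x1 (is_derive_id x (1 : R)).
    by move: H; rewrite /GRing.scale /= mulr1.
  have dE : is_derive x (1 : R) (fun y => expR (- y^-1)) (expR (- x^-1) * (x ^- 2)).
    have dN : is_derive x (1 : R) (fun y => - y^-1) (x ^- 2) by apply: is_derive_eq; rewrite opprK.
    exact: (@is_derive1_comp R expR (fun y => - y^-1) x _ _ (is_derive_expR _) dN).
  have : is_derive x (1 : R) (fun y => y^-1 ^+ n * expR (- y^-1)) (- n%:R * flat n.+1 x + flat n.+2 x).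
    have dX : is_derive x (1 : R) (fun y => y^-1 ^+ n) (- n%:R * x^-1 ^+ n.+1).
      elim: n => [|k ih].
        have -> : (fun y : R => y^-1 ^+ 0) = fun=> 1 by apply/funext => y; rewrite expr0.
        by rewrite oppr0 mul0r; exact: is_derive_cst.
      have -> : (fun y : R => y^-1 ^+ k.+1) = fun y => y^-1 * y^-1 ^+ k.
        by apply/funext => y; rewrite exprS.
      move: (is_deriveM1 dV ih) => dVih; apply: is_derive_eq.
      by rewrite -exprVn !exprS expr0 -natr1; ring.
    rewrite /flat x0; move: (is_deriveM1 dX dE) => dXE; apply: is_derive_eq.
    by rewrite -exprVn !exprS expr0; ring.
  apply: near_eq_is_derive.
  near=> y; rewrite /flat ifT//; near: y; exact: lt_nbhsr.
have -> : - n%:R * flat n.+1 0 + flat n.+2 0 = 0 by rewrite /flat ltxx mulr0 addr0.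
apply: (@is_derive_quadratic _ 0 0 (n.+2%:R ^+ n.+2) 1) => // h _.
rewrite add0r mulr0 subr0 [flat n 0]/flat ltxx subr0 ger0_norm ?flat_ge0//.
exact: flat_le.
Unshelve. all: end_near. Qed.

Lemma smooth1_flat n : smooth1 (flat n).
Proof.
move=> k; elim: k n => // k ih n.
by apply: (CnS (flat_derive n)); apply: CnD => //; exact: CnZ.
Qed.

(** The support is one-sided: averaging at time [t] against such a bump uses only times in
    [[t, t + e]]. *)
Definition bump_on (e : R) b : Prop := [/\ smooth1 b,
  forall x, 0 <= b x, forall x, x <= 0 -> b x = 0, forall x, e <= x -> b x = 0 &
  itg leb 0 e b = 1].

(** The product of [flat 0] at [x] and at [e - x], divided by its integral; the latter is positive
    because the product is positive near [e / 2]. *)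
Lemma bump_exists (e : R) : 0 < e -> exists b, bump_on e b.
Proof.
move=> e0; pose b x := flat 0 x * flat 0 (e + (-1) * x).
have sb : smooth1 b by move=> k; apply: CnM; [exact: smooth1_flat|apply: Cn_affine; exact: smooth1_flat].
have b0 x : 0 <= b x by apply: mulr_ge0; exact: flat_ge0.
have bl x : x <= 0 -> b x = 0 by move=> x0; rewrite /b {1}/flat ltNge x0 mul0r.
have br x : e <= x -> b x = 0.
  by move=> ex; rewrite /b [flat 0 (_ + _)]/flat mulN1r subr_gt0 ltNge ex mulr0.
have cb := smooth1_continuous sb; have lb := continuous_lbm cb.
have Z0 : 0 < itg leb 0 e b.
  pose x := e / 2; have x0 : 0 < x by exact: divr_gt0.
  have ex : 0 < e + (-1) * x by rewrite mulN1r subr_gt0 /x ltr_pdivrMr// ltr_pMr// ltr1n.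
  have bx : 0 < b x by rewrite /b /flat x0 ex !expr0 !mul1r mulr_gt0 ?expR_gt0.
  have /cvgrPdist_lt/(_ _ (divr_gt0 bx (ltr0n _ 2)))/nbhs_ballP[d /= d0 Hd] := cb x.
  pose d' := Num.min (d / 2) (e / 2).
  have d'0 : 0 < d' by rewrite lt_min !divr_gt0.
  have d'd : d' < d by rewrite /d' gt_min ltr_pdivrMr// ltr_pMr// ltr1n.
  have d'e : d' <= e / 2 by rewrite ge_min lexx orbT.
  have xd : x <= x + d' by rewrite lerDl ltW.
  apply: (@lt_le_trans _ _ (itg leb x (x + d') (fun=> b x / 2))).
    by rewrite (itg_cst leb_lf) (itg_leb1 xd) addrC addKr mulr_gt0// divr_gt0.
  apply: (@le_trans _ _ (itg leb x (x + d') b)).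
    apply: (itg_le leb_lf) => //; first exact: lbm_cst.
    move=> y /andP[xy yd].
    have : `|b x - b y| < b x / 2.
      apply: Hd; rewrite /ball/= distrC ger0_norm ?subr_ge0//.
      by apply: le_lt_trans d'd; rewrite lerBlDl.
    by move/ltr_normlP => [_]; lra.
  apply: (itg_subset leb_lf) => //; first exact: ltW.
  by rewrite [leRHS](splitr e) lerD2l.
exists (fun x => (itg leb 0 e b)^-1 * b x); split.
- by move=> k; exact: CnZ.
- by move=> x; apply: mulr_ge0 => //; rewrite invr_ge0 ltW.
- by move=> x /bl ->; rewrite mulr0.
- by move=> x /br ->; rewrite mulr0.
- by rewrite (itgZ leb_lf)// mulVf// gt_eqF.
Qed.

Lemma mean_value f f' : (forall x : R, is_derive x (1 : R) f (f' x)) ->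
  forall a b, exists2 c, `|c - a| <= `|b - a| & f b - f a = f' c * (b - a).
Proof.
move=> df a b.
have cf : continuous f by move=> x; exact: is_derive_continuous (df x).
have [ab|ba|->] := ltgtP a b; last first.
- by exists b; rewrite ?subrr ?mulr0.
- have [c /[!in_itv]/= /andP[bc ca] E] := @MVT _ f f' _ _ ba (fun x _ => df x) (continuous_subspaceT cf).
  exists c; last by rewrite -opprB E -mulrN opprB.
  rewrite !ler0_norm ?subr_le0 ?(ltW ca) ?(ltW ba)//; lra.
- have [c /[!in_itv]/= /andP[ac cb] E] := @MVT _ f f' _ _ ab (fun x _ => df x) (continuous_subspaceT cf).
  exists c => //.
  rewrite !ger0_norm ?subr_ge0 ?(ltW ac) ?(ltW ab)//; lra.
Qed.

Lemma taylor2 f f1 f2 (M y h : R) : (forall x : R, is_derive x (1 : R) f (f1 x)) ->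
  (forall x : R, is_derive x (1 : R) f1 (f2 x)) ->
  (forall x, `|x - y| <= `|h| -> `|f2 x| <= M) ->
  `|f (y + h) - f y - h * f1 y| <= M * h ^+ 2.
Proof.
move=> d1 d2 HM.
have M0 : 0 <= M by apply: le_trans (HM y _); rewrite ?subrr ?normr0.
have [c hc E] := mean_value d1 y (y + h).
have [c' hc' E'] := mean_value d2 y c.
have yh : y + h - y = h by ring.
rewrite yh in hc; rewrite E yh (_ : _ - _ = (f1 c - f1 y) * h); last by ring.
rewrite E' !normrM -[h ^+ 2]real_normK ?num_real// expr2 mulrA.
apply: ler_wpM2r => //; apply: ler_pM => //.
by apply: HM; exact: le_trans hc.
Qed.

End SmoothFunctions.

(** * Mollification in time *)

Section TensorProducts.
Context {R : realType}.
Implicit Types (xi tau : R -> R).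

(** A directional derivative sees [f] only along a line, where it is a function [g] of one
    variable. *)
Lemma is_derive_line (f : R * R -> R) (p v : R * R) (g : R -> R) (t l : R) :
  (forall h : R, f (h *: v + p) = g (h + t)) -> is_derive t (1 : R) g l ->
  is_derive p v f l.
Proof.
move=> fg [dg Eg].
have f0 : f p = g t by have := fg 0; rewrite scale0r !add0r.
have E : (fun h : R => h^-1 *: ((f \o shift p) (h *: v) - f p)) =
         (fun h : R => h^-1 *: ((g \o shift t) (h *: (1 : R)) - g t)).
  by apply/funext => h; rewrite /= fg f0 /GRing.scale /= mulr1.
have D : derivable f p v by rewrite /derivable E; exact: dg.
by apply: DeriveDef => //; rewrite /derive E; exact: Eg.
Qed.

Definition tensor xi tau (p : R * R) : R := xi p.1 * tau p.2.

Lemma tensor_dx xi tau p : smooth1 xi ->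
  is_derive p ((1, 0) : R * R) (tensor xi tau) (tensor (derive1 xi) tau p).
Proof.
move=> sx; apply: (@is_derive_line _ _ _ (fun s => xi s * tau p.2) p.1).
  by move=> h; rewrite /tensor /= /GRing.scale /= mulr1 mulr0 add0r.
have := is_deriveM1 (Cn_deriv (sx 1%N) p.1) (is_derive_cst (tau p.2) p.1 (1 : R)).
by rewrite mulr0 addr0.
Qed.

Lemma tensor_dt xi tau p : smooth1 tau ->
  is_derive p ((0, 1) : R * R) (tensor xi tau) (tensor xi (derive1 tau) p).
Proof.
move=> st; apply: (@is_derive_line _ _ _ (fun s => xi p.1 * tau s) p.2).
  by move=> h; rewrite /tensor /= /GRing.scale /= mulr1 mulr0 add0r.
have := is_deriveM1 (is_derive_cst (xi p.1) p.2 (1 : R)) (Cn_deriv (st 1%N) p.2).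
by rewrite mul0r add0r.
Qed.

Lemma dx_tensor xi tau : smooth1 xi -> dx (tensor xi tau) = tensor (derive1 xi) tau.
Proof. by move=> sx; apply/funext => p; have [_] := tensor_dx tau p sx. Qed.

Lemma dt_tensor xi tau : smooth1 tau -> dt (tensor xi tau) = tensor xi (derive1 tau).
Proof. by move=> st; apply/funext => p; have [_] := tensor_dt xi p st. Qed.

Lemma continuous_tensor xi tau : continuous xi -> continuous tau -> continuous (tensor xi tau).
Proof.
move=> cx ct p; apply: cvgM.
  by apply: (@continuous_comp _ _ _ fst xi); [exact: cvg_fst|exact: cx].
by apply: (@continuous_comp _ _ _ snd tau); [exact: cvg_snd|exact: ct].
Qed.

Lemma Ck_tensor k xi tau : smooth1 xi -> smooth1 tau -> Ck k (tensor xi tau).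
Proof.
elim: k xi tau => [|k ih] xi tau sx st; (split; first by apply: continuous_tensor; exact: smooth1_continuous) => //.
split.
- by move=> p; have [] := tensor_dx tau p sx.
- by move=> p; have [] := tensor_dt xi p st.
- by rewrite dx_tensor//; apply: ih => //; exact: (smooth1_derivn 1 sx).
- by rewrite dt_tensor//; apply: ih => //; exact: (smooth1_derivn 1 st).
Qed.

Lemma test_function_tensor xi tau (A B a b : R) : smooth1 xi -> smooth1 tau -> 0 < a ->
  (forall x, ~~ (A <= x <= B) -> xi x = 0) -> (forall t, ~~ (a <= t <= b) -> tau t = 0) ->
  test_function (tensor xi tau).
Proof.
move=> sx st a0 hx ht.
have sub : closure [set p | tensor xi tau p != 0] `<=` [set` `[A, B]] `*` [set` `[a, b]].
  apply: (@subset_trans _ (closure ([set` `[A, B]] `*` [set` `[a, b]] : set (R * R)))).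
    apply: closure_subset => p /= p0; split; rewrite /= in_itv /=; apply: contraNT p0.
      by move=> /hx E; rewrite /tensor E mul0r.
    by move=> /ht E; rewrite /tensor E mulr0.
  have /closure_id <- // : closed ([set` `[A, B]] `*` [set` `[a, b]] : set (R * R)).
  have -> : [set` `[A, B]] `*` [set` `[a, b]] =
      (fst @^-1` [set` `[A, B]]) `&` (snd @^-1` [set` `[a, b]]) :> set (R * R) by [].
  have c1 : continuous (@fst R R) by move=> p; exact: cvg_fst.
  have c2 : continuous (@snd R R) by move=> p; exact: cvg_snd.
  by apply: closedI; apply: closed_comp => [p _|]; [exact: c1|exact: interval_closed|exact: c2|exact: interval_closed].
split => [k| |p /sub [_]]; first exact: Ck_tensor.
- apply: (subclosed_compact _ _ sub); first exact: closed_closure.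
  by apply: compact_setX; exact: segment_compact.
- by rewrite /= in_itv/= => /andP[ap _]; apply: lt_le_trans ap.
Qed.

(** The complement of a closed interval is open, so [xi] vanishes in a neighbourhood of the
    point. *)
Lemma derive1_support xi (a b : R) : (forall x, ~~ (a <= x <= b) -> xi x = 0) ->
  forall x, ~~ (a <= x <= b) -> derive1 xi x = 0.
Proof.
move=> h x xab.
have d0 := is_derive_cst (0 : R) x (1 : R).
suff : is_derive x (1 : R) xi 0 by move=> [_]; rewrite -derive1E.
move: d0; apply: near_eq_is_derive.
move: xab; rewrite negb_and -!ltNge => /orP[xa|bx]; near=> y; apply/esym/h; rewrite negb_and -!ltNge.
  by apply/orP; left; near: y; exact: lt_nbhsl.
by apply/orP; right; near: y; exact: lt_nbhsr.
Unshelve. all: end_near. Qed.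

Lemma derive1n_support xi (a b : R) n : (forall x, ~~ (a <= x <= b) -> xi x = 0) ->
  forall x, ~~ (a <= x <= b) -> derive1n n xi x = 0.
Proof. by move=> h; elim: n => // n ih; exact: derive1_support ih. Qed.

Lemma bounded_support (k : R -> R) (a b : R) : continuous k ->
  (forall x, ~~ (a <= x <= b) -> k x = 0) -> exists2 M, 0 < M & forall x, `|k x| <= M.
Proof.
move=> ck hk; have [M M0 HM] := lbm_bounded a b (continuous_lbm ck).
exists M => // x; have [/HM//|/hk ->] := boolP (a <= x <= b).
by rewrite normr0 ltW.
Qed.

End TensorProducts.

(** * Product test functions and mollification in time *)

Section WeakForm.
Context {R : realType} (m : {measure set (measurableTypeR R) -> \bar R}).
Hypothesis m_lf : locally_finite m.
Variable U : R * R -> R.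
Hypothesis U_continuous : {within [set p : R * R | 0 <= p.2], continuous U}.
Hypothesis U_equation : distributional_solution m U.

(** Negative times are given the value at time 0. This makes the function continuous on the whole
    plane and changes nothing where the equation is tested. *)
Definition extended (p : R * R) : R := U (p.1, Num.max p.2 0).

Lemma extendedE x t : 0 <= t -> extended (x, t) = U (x, t).
Proof. by move=> t0; rewrite /extended /= max_l. Qed.

Lemma continuous_extended : continuous extended.
Proof.
move=> p; pose c (q : R * R) : R * R := (q.1, Num.max q.2 0).
have c0 q : 0 <= (c q).2 by rewrite /c /= le_max lexx orbT.
have cc : {for p, continuous c}.
  move=> A [[B C] /= [Bp Cp] sub].
  have cmax : {for p.2, continuous (fun t : R => Num.max t 0)}.
    by apply: continuous_max; [exact: cvg_id|exact: cvg_cst].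
  exists (B, [set t | C (Num.max t 0)]).
    by split => //=; exact: cmax.
  by move=> q [/= q1 q2]; exact: sub.
have /subspace_continuousP/(_ (c p) (c0 p)) H := U_continuous.
move=> A /H /= HA.
have {}HA : nbhs p [set q | [set p0 : R * R | 0 <= p0.2] (c q) -> A (U (c q))] by exact: cc HA.
by apply: (@filterS _ (nbhs p)) HA => q; apply; exact: c0.
Qed.

Lemma weak_tensor (xi tau : R -> R) (A B a b : R) : smooth1 xi -> smooth1 tau -> 0 < a ->
  (forall x, ~~ (A <= x <= B) -> xi x = 0) -> (forall t, ~~ (a <= t <= b) -> tau t = 0) ->
  - 2 * itg m A B (fun x => xi x * itg leb a b (fun t => extended (x, t) * derive1 tau t)) =
  itg leb A B (fun x => derive1 (derive1 xi) x * itg leb a b (fun t => extended (x, t) * tau t)).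
Proof.
move=> sx st a0 hx ht.
have := U_equation (test_function_tensor sx st a0 hx ht).
rewrite dt_tensor// dx_tensor// dx_tensor; last exact: (smooth1_derivn 1 sx).
have hx2 := derive1_support (derive1_support hx).
have ht1 := derive1_support ht.
have subT (c d : R) : [set` `[c, d]] `<=` setT by [].
have suba : [set` `[a, b]] `<=` [set` `]0, +oo[].
  by move=> t /=; rewrite !in_itv/= andbT => /andP[at_ _]; exact: lt_le_trans at_.
have cE := continuous_extended.
have lE : lbm2 extended := continuous_lbm2 cE.
(* Both sides of the equation have this shape: [m] with [xi] and the derivative of [tau], and
   Lebesgue measure with the second derivative of [xi] and [tau]. *)
have lem mu (mu_lf : locally_finite mu) (f g : R -> R) : continuous f -> continuous g ->
    (forall x, ~~ (A <= x <= B) -> f x = 0) -> (forall t, ~~ (a <= t <= b) -> g t = 0) ->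
    \int[leb]_(t in [set` `]0, +oo[]) \int[mu]_x (U (x, t) * tensor f g (x, t)) =
    itg mu A B (fun x => f x * itg leb a b (fun t => extended (x, t) * g t)).
  move=> cf cg hf hg.
  have lf := continuous_lbm cf; have lg := continuous_lbm cg.
  rewrite (@Rintegral_support R leb _ a b)//; last first.
    move=> t /hg g0; rewrite (_ : (fun x => _) = fun=> 0).
      by rewrite Rintegral_cst// mul0r.
    by apply/funext => x; rewrite /tensor /= g0 !mulr0.
  have l2 : lbm2 (fun p => extended p * tensor f g p).
    by apply: lbm2M => //; apply: continuous_lbm2; exact: continuous_tensor.
  transitivity (itg leb a b (fun t => itg mu A B (fun x => extended (x, t) * tensor f g (x, t)))).
    apply: eq_itg => t /andP[at_ _].
    rewrite (@Rintegral_support R mu _ A B)//; last first.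
      by move=> x /hf f0; rewrite /tensor /= f0 mul0r mulr0.
    by apply: eq_itg => x _; rewrite extendedE// ltW// (lt_le_trans a0).
  rewrite -(itg_fubini mu_lf leb_lf A B a b l2); apply: eq_itg => x _.
  rewrite -(itgZ leb_lf); first by apply: eq_itg => t _; rewrite /tensor /=; ring.
  by apply: lbmM => //; exact: (lbm2_row x lE).
have c1 := smooth1_continuous sx; have c2 := smooth1_continuous st.
have c3 : continuous (derive1 tau) := smooth1_continuous (smooth1_derivn 1 st).
have c4 : continuous (derive1 (derive1 xi)) := smooth1_continuous (smooth1_derivn 2 sx).
have <- := lem m m_lf xi (derive1 tau) c1 c3 hx ht1.
by have <- := lem leb leb_lf (derive1 (derive1 xi)) tau c4 c2 hx2 ht.
Qed.

Section Mollify.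
Variables (e : R) (k : R -> R).
Hypotheses (e0 : 0 < e) (sk : smooth1 k) (hk : forall u, ~~ (0 <= u <= e) -> k u = 0).

(** Each time derivative of the mollified function passes to the kernel by parts, with a change of
    sign. *)
Definition kernel_n (n : nat) (u : R) : R := (-1) ^+ n * derive1n n k u.

Definition mollified (n : nat) (x t : R) : R :=
  itg leb 0 e (fun u => extended (x, t + u) * kernel_n n u).

Lemma kernel_smooth n : smooth1 (kernel_n n).
Proof. by move=> j; apply: CnZ; exact: smooth1_derivn. Qed.

Lemma kernel_derive n u : is_derive u (1 : R) (kernel_n n) (- kernel_n n.+1 u).
Proof.
have := is_deriveM1 (is_derive_cst ((-1) ^+ n : R) u (1 : R)) (smooth1_is_derive n u sk).
by rewrite mul0r add0r /kernel_n exprS mulN1r mulNr opprK.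
Qed.

Lemma kernel_support n u : ~~ (0 <= u <= e) -> kernel_n n u = 0.
Proof. by move=> uu; rewrite /kernel_n (derive1n_support n hk) ?mulr0. Qed.

Lemma kernel_lbm n : lbm (kernel_n n).
Proof. by apply: continuous_lbm; apply: smooth1_continuous; exact: kernel_smooth. Qed.

Lemma mollified_continuous n : continuous (fun p : R * R => mollified n p.1 p.2).
Proof. exact: (continuous_itg_param 0 e continuous_extended (kernel_lbm n)). Qed.

(** With the substitution [s = t + u] and a fixed larger interval, [t] occurs only in the smooth
    kernel. *)
Lemma mollifiedE n (x t a b : R) : a <= t -> t + e <= b ->
  mollified n x t = itg leb a b (fun s : R => extended (x, s) * kernel_n n (- t + 1 * s)).
Proof.
move=> at_ tb.
have cE : continuous (fun s => extended (x, s)) := continuous_row x continuous_extended.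
have ck : continuous (fun s : R => kernel_n n (- t + 1 * s)).
  by apply: smooth1_continuous => j; apply: Cn_affine; exact: kernel_smooth.
have cc := contM cE ck.
transitivity (itg leb t (t + e) (fun s : R => extended (x, s) * kernel_n n (- t + 1 * s))).
  have := itg_shift t (ltW e0) cc; rewrite add0r (addrC e) => <-.
  apply: eq_itg => u _; congr (extended (x, _) * kernel_n n _); first by rewrite addrC.
  by ring.
apply/esym; have := @Rintegral_support R leb [set` `[a, b]] t (t + e).
move=> /(_ (fun s => extended (x, s) * kernel_n n (- t + 1 * s))); apply.
  move=> s hs; rewrite kernel_support ?mulr0//; apply: contra hs => /andP[s0 s1].
  by apply/andP; split; lra.
by move=> s /=; rewrite !in_itv/= => /andP[ts st]; rewrite (le_trans at_ ts) (le_trans st).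
Qed.

(** Differentiation under the integral: Taylor's formula for the kernel has a remainder quadratic in
    [h], uniformly in [s], and [U] is merely bounded on the interval, which is wide enough for all
    [|h| < 1]. *)
Lemma mollified_derive n x t : is_derive t (1 : R) (mollified n x) (mollified n.+1 x t).
Proof.
have sK j := @kernel_smooth j.
have [M M0 HM] := bounded_support (smooth1_continuous (sK n.+2)) (@kernel_support n.+2).
pose a := t - 1; pose b := t + 1 + e.
have cE : continuous (fun s => extended (x, s)) := continuous_row x continuous_extended.
have lE := continuous_lbm cE.
have [N N0 HN] := lbm_bounded a b lE.
pose L := itg leb a b (fun=> 1).
have lk j y : lbm (fun s => kernel_n j (y + 1 * s)).
  by apply: continuous_lbm; apply: smooth1_continuous => i; apply: Cn_affine; exact: sK.
apply: (@is_derive_quadratic _ _ _ _ (N * M * L) 1) => // h h1.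
have [h2 h3] : -1 < h /\ h < 1 by move: h1; rewrite ltr_norml => /andP[].
rewrite (@mollifiedE n x (t + h) a b); [|by rewrite /a; lra|by rewrite /b; lra].
rewrite (@mollifiedE n x t a b); [|by rewrite /a; lra|by rewrite /b; lra].
rewrite (@mollifiedE n.+1 x t a b); [|by rewrite /a; lra|by rewrite /b; lra].
have lP j y : lbm (fun s => extended (x, s) * kernel_n j (y + 1 * s)) by exact: lbmM.
have l3 : lbm (fun s => h * (extended (x, s) * kernel_n n.+1 (- t + 1 * s))) by exact: lbmZ.
have l4 := lbmB (lP n (- (t + h))) (lP n (- t)).
have l5 := lP n (- (t + h)); have l6 := lP n (- t); have l7 := lP n.+1 (- t).
rewrite -(itgB leb_lf _ _ l5 l6) -(itgZ leb_lf _ _ _ l7) -(itgB leb_lf _ _ l4 l3).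

have -> : N * M * L * h ^+ 2 = N * (M * h ^+ 2) * L by ring.
apply: (itg_bound leb_lf); first exact: lbmB.
move=> s sab.
have dd u : is_derive u (1 : R) (fun u => - kernel_n n.+1 u) (kernel_n n.+2 u).
  have := is_deriveM1 (is_derive_cst (-1 : R) u (1 : R)) (kernel_derive n.+1 u).
  rewrite mul0r add0r mulN1r opprK; set f1 := (fun y => _ * _).
  by have -> : f1 = (fun u => - kernel_n n.+1 u) by apply/funext => y; rewrite /f1 mulN1r.
have T := @taylor2 _ _ _ _ M (- t + 1 * s) (- h) (kernel_derive n) dd (fun z _ => HM z).
rewrite sqrrN in T.
have -> : extended (x, s) * kernel_n n (- (t + h) + 1 * s) - extended (x, s) * kernel_n n (- t + 1 * s) -
   h * (extended (x, s) * kernel_n n.+1 (- t + 1 * s)) =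
   extended (x, s) * (kernel_n n (- t + 1 * s + - h) - kernel_n n (- t + 1 * s) - - h * - kernel_n n.+1 (- t + 1 * s)).
  have -> : - (t + h) + 1 * s = - t + 1 * s + - h by ring.
  ring.
by rewrite normrM; apply: ler_pM => //; exact: HN.
Qed.

(** The kernel translated to [[t, t + e]] is an admissible test function of time for each [t > 0],
    and its derivative is minus the next kernel: integration in time turns the distributional
    equation into one at time [t]. *)
Lemma mollified_weak (xi : R -> R) (A B t : R) n : smooth1 xi -> 0 < t ->
  (forall x, ~~ (A <= x <= B) -> xi x = 0) ->
  2 * itg m A B (fun x => xi x * mollified n.+1 x t) =
  itg leb A B (fun x => derive1 (derive1 xi) x * mollified n x t).
Proof.
move=> sx t0 hx.
pose tau s := kernel_n n (- t + 1 * s).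
have stau : smooth1 tau by move=> j; apply: Cn_affine; exact: kernel_smooth.
have dtau s : is_derive s (1 : R) tau (- kernel_n n.+1 (- t + 1 * s)).
  by have := is_derive_affine (kernel_derive n (- t + 1 * s)); rewrite mul1r.
have htau s : ~~ (t <= s <= t + e) -> tau s = 0.
  move=> hs; apply: kernel_support; apply: contra hs => /andP[s0 s1].
  by apply/andP; split; lra.
have := weak_tensor sx stau t0 hx htau; rewrite (derive1_eq dtau).
have lE x : lbm (fun s => extended (x, s)).
  exact: continuous_lbm (continuous_row x continuous_extended).
have lk : lbm (fun s => kernel_n n.+1 (- t + 1 * s)).
  by apply: continuous_lbm; apply: smooth1_continuous => i; apply: Cn_affine; exact: kernel_smooth.
have cm : continuous (fun x => mollified n.+1 x t) := continuous_col t (@mollified_continuous n.+1).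
have -> : itg m A B (fun x => xi x * itg leb t (t + e) (fun s => extended (x, s) * - kernel_n n.+1 (- t + 1 * s))) =
    - itg m A B (fun x => xi x * mollified n.+1 x t).
  rewrite -(itgN m_lf); last first.
    by apply: lbmM; apply: continuous_lbm => //; exact: smooth1_continuous.
  apply: eq_itg => x _; rewrite (mollifiedE n.+1 x (lexx t) (lexx (t + e))).
  rewrite -mulrN -(itgN leb_lf); last exact: lbmM.
  by congr (_ * _); apply: eq_itg => s _; rewrite mulrN.
rewrite mulrNN => ->; apply: eq_itg => x _.
by rewrite (mollifiedE n x (lexx t) (lexx (t + e))).
Qed.

End Mollify.
End WeakForm.

(** * Smooth steps and ramps *)

Section Ramps.
Context {R : realType}.
Implicit Types (f v b : R -> R).

(** Meant for [f] vanishing on negative numbers. A base point strictly below 0 lets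
    [local_primitive] give the derivative at 0 as well; below -1 the integral is empty and 0. *)
Definition primitive f (x : R) : R := itg leb (-1) x f.

Lemma itg0 (mu : {measure set (measurableTypeR R) -> \bar R}) (c d : R) f :
  locally_finite mu -> (forall x, c <= x <= d -> f x = 0) -> itg mu c d f = 0.
Proof.
move=> lf h; transitivity (itg mu c d (fun=> 0)); first exact: eq_itg.
by rewrite itg_cst// mul0r.
Qed.

Section Primitive.
Variable f : R -> R.
Hypotheses (sf : smooth1 f) (f0 : forall x, x <= 0 -> f x = 0).

Lemma primitive_nonpos (x : R) : x <= 0 -> primitive f x = 0.
Proof. by move=> x0; apply: (itg0 leb_lf) => y /andP[_ yx]; apply: f0; exact: le_trans x0. Qed.

Lemma primitive_derive (x : R) : is_derive x (1 : R) (primitive f) (f x).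
Proof.
have cf := smooth1_continuous sf.
have [x0|x0] := ltP x 0; last by apply: local_primitive => //; lra.
rewrite f0 ?ltW//; have := is_derive_cst (0 : R) x (1 : R).
apply: near_eq_is_derive; near=> y; rewrite primitive_nonpos// ltW//.
by near: y; exact: lt_nbhsl.
Unshelve. all: end_near. Qed.

Lemma smooth1_primitive : smooth1 (primitive f).
Proof. by case=> // k; exact: (CnS primitive_derive (sf k)). Qed.

Lemma primitive_nonneg (x : R) : 0 <= x -> primitive f x = itg leb 0 x f.
Proof.
move=> x0; have lf := continuous_lbm (smooth1_continuous sf).
rewrite /primitive (@itg_split _ _ 0 _ _ lf)//.
by rewrite (itg0 leb_lf) ?add0r// => y /andP[_]; exact: f0.
Qed.

End Primitive.

Lemma bump_average e b f c eps : bump_on e b -> lbm f ->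
  (forall u, 0 <= u <= e -> `|f u - c| <= eps) ->
  `|itg leb 0 e (fun u => f u * b u) - c| <= eps.
Proof.
move=> [sb b0 _ _ b1] lf hf; have lb := continuous_lbm (smooth1_continuous sb).
have lcst := @lbm_cst R.
have -> : itg leb 0 e (fun u => f u * b u) - c = itg leb 0 e (fun u => (f u - c) * b u).
  transitivity (itg leb 0 e (fun u => f u * b u) - c * itg leb 0 e b); first by rewrite b1 mulr1.
  rewrite -(itgZ leb_lf _ _ _ lb) -(itgB leb_lf _ _ (lbmM lf lb) (lbmZ _ lb)).
  by apply: eq_itg => u _; rewrite mulrBl.
have l1 : lbm (fun u => (f u - c) * b u) by apply: lbmM => //; apply: lbmB.
apply: le_trans (itg_norm leb_lf _ _ l1) _.
have -> : eps = itg leb 0 e (fun u => eps * b u) by rewrite (itgZ leb_lf _ _ _ lb) b1 mulr1.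
apply: (itg_le leb_lf); [exact: lbm_norm|exact: lbmZ|].
by move=> u ue; rewrite normrM (ger0_norm (b0 u)); apply: ler_wpM2r => //; exact: hf.
Qed.

Lemma shifted_bump_average e b v a A B eps : 0 < e -> bump_on e b -> continuous v ->
  A <= a -> a + e <= B -> (forall y, a <= y <= a + e -> `|v y - v a| <= eps) ->
  `|itg leb A B (fun y => b (- a + 1 * y) * v y) - v a| <= eps.
Proof.
move=> e0 hb cv Aa aB hv; have [sb _ bn bp _] := hb.
have cb : continuous (fun y : R => b (- a + 1 * y)).
  by apply: smooth1_continuous => k; apply: Cn_affine.
have -> : itg leb A B (fun y => b (- a + 1 * y) * v y) =
          itg leb a (a + e) (fun y => b (- a + 1 * y) * v y).
  have := @Rintegral_support R leb [set` `[A, B]] a (a + e).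
  move=> /(_ (fun s => b (- a + 1 * s) * v s)); apply.
    move=> s; rewrite negb_and -!ltNge => /orP[sa|sa]; first by rewrite bn ?mul0r//; lra.
    by rewrite bp ?mul0r//; lra.
  by move=> s /=; rewrite !in_itv/= => /andP[ts st]; rewrite (le_trans Aa ts) (le_trans st).
have := itg_shift a (ltW e0) (contM cb cv); rewrite add0r (addrC e) => <-.
have -> : itg leb 0 e (fun t => b (- a + 1 * (t + a)) * v (t + a)) =
          itg leb 0 e (fun t => v (t + a) * b t).
  by apply: eq_itg => t _; rewrite mulrC; congr (_ * b _); ring.
apply: (bump_average hb); first by apply: continuous_lbm; exact: continuous_shift.
by move=> u /andP[u0 ue]; apply: hv; apply/andP; split; lra.
Qed.

(** A smooth version of the positive part: its first derivative is a smooth step and its second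
    derivative is the bump [b]. *)
Definition ramp b : R -> R := primitive (primitive b).


Section Ramp.
Variables (e : R) (b : R -> R).
Hypotheses (e0 : 0 < e) (hb : bump_on e b).

Lemma step_01 y : 0 <= primitive b y <= 1.
Proof.
have [sb b0 bn bp b1] := hb; have lb := continuous_lbm (smooth1_continuous sb).
have ge0 A B : 0 <= itg leb A B b by exact: itg_ge0.
rewrite {1}/primitive ge0 /=; have [y0|y0] := leP y 0.
  by rewrite primitive_nonpos.
rewrite primitive_nonneg ?(ltW y0)//.
have [ye|ye] := leP y e.
  by rewrite -b1 (itg_split lb (ltW y0) ye) lerDl.
rewrite (itg_split lb (ltW e0) (ltW ye)) b1 (itg0 leb_lf) ?addr0// => x /andP[ex _].
exact: bp.
Qed.

Lemma step_eq1 y : e <= y -> primitive b y = 1.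
Proof.
have [sb b0 bn bp b1] := hb; have lb := continuous_lbm (smooth1_continuous sb).
move=> ye; rewrite primitive_nonneg//; last exact: le_trans (ltW e0) ye.
rewrite (itg_split lb (ltW e0) ye) b1 (itg0 leb_lf) ?addr0// => x /andP[ex _].
exact: bp.
Qed.

Lemma smooth1_step : smooth1 (primitive b).
Proof. by have [sb _ bn _ _] := hb; exact: smooth1_primitive. Qed.

Lemma ramp_nonpos y : y <= 0 -> ramp b y = 0.
Proof.
by have [sb _ bn _ _] := hb; apply: primitive_nonpos => x; exact: primitive_nonpos.
Qed.

Lemma smooth1_ramp : smooth1 (ramp b).
Proof.
by have [sb _ bn _ _] := hb; apply: smooth1_primitive; [exact: smooth1_step|exact: primitive_nonpos].
Qed.

Lemma ramp_derive y : is_derive y (1 : R) (ramp b) (primitive b y).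
Proof.
by have [sb _ bn _ _] := hb; apply: primitive_derive; [exact: smooth1_step|exact: primitive_nonpos].
Qed.

Lemma step_derive y : is_derive y (1 : R) (primitive b) (b y).
Proof. by have [sb _ bn _ _] := hb; exact: primitive_derive. Qed.

Lemma ramp_affine y : e <= y -> ramp b y = y - e + ramp b e.
Proof.
move=> ey; have l1 := continuous_lbm (smooth1_continuous smooth1_step).
have [sb _ bn _ _] := hb.
have pE x : 0 <= x -> ramp b x = itg leb 0 x (primitive b).
  by move=> x0; apply: primitive_nonneg => //; [exact: smooth1_step|exact: primitive_nonpos].
rewrite !pE ?(ltW e0)//; last exact: le_trans (ltW e0) ey.
rewrite (itg_split l1 (ltW e0) ey) addrC; congr (_ + _).
rewrite -(itg_leb1 ey); apply: eq_itg => x /andP[ex _]; exact: step_eq1.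
Qed.

Lemma ramp_close y : `|ramp b y - Num.max y 0| <= e.
Proof.
have [y0|y0] := leP y 0; first by rewrite ramp_nonpos// subrr normr0 ltW.
have l1 := continuous_lbm (smooth1_continuous smooth1_step).
have [sb _ bn _ _] := hb.
have small x : 0 <= x -> x <= e -> `|ramp b x - x| <= e.
  move=> x0 xe.
  have -> : ramp b x = itg leb 0 x (primitive b).
    by apply: primitive_nonneg => //; [exact: smooth1_step|exact: primitive_nonpos].
  rewrite ler_norml; apply/andP; split.
    have : 0 <= itg leb 0 x (primitive b).
      by apply: itg_ge0 => // z _; case/andP: (step_01 z).
    lra.
  have : itg leb 0 x (primitive b) <= itg leb 0 x (fun=> 1).
    by apply: (itg_le leb_lf) => //; [exact: lbm_cst|move=> z _; case/andP: (step_01 z)].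
  rewrite itg_leb1//; lra.
have [ye|/ltW ye] := leP y e; first exact: small (ltW y0) ye.
rewrite ramp_affine// (_ : y - e + ramp b e - y = ramp b e - e); last by ring.
exact: small (ltW e0) (lexx e).
Qed.

End Ramp.
End Ramps.

(** * From smooth test functions to hats *)

Section WeakHat.
Context {R : realType} (m : {measure set (measurableTypeR R) -> \bar R}).
Hypothesis m_lf : locally_finite m.

Lemma eq_of_small_error (a b C : R) :
  (forall eps, 0 < eps -> `|a - b| <= C * eps) -> a = b.
Proof.
move=> h; have C0 : 0 < `|C| + 1 by apply: ltr_wpDl.
apply/eqP; rewrite -subr_eq0 -normr_le0; apply/ler_addgt0Pr => eps eps0.
rewrite add0r; have e1 : 0 < eps / (`|C| + 1) by exact: divr_gt0.
apply: le_trans (h _ e1) _; rewrite mulrA ler_pdivrMr// mulrC ler_pM2l//.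
by apply: le_trans (ler_norm C) _; rewrite lerDl.
Qed.

Lemma continuous_modulus (v : R -> R) a eps : continuous v -> 0 < eps ->
  exists2 d, 0 < d & forall y, `|y - a| <= d -> `|v y - v a| <= eps.
Proof.
move=> cv eps0; have /cvgrPdist_le/(_ eps eps0) := cv a.
move=> /nbhs_ballP[d /= d0 hd]; exists (d / 2); first exact: divr_gt0.
move=> y ya; rewrite distrC; apply: hd; rewrite /ball /= distrC.
by apply: le_lt_trans ya _; rewrite ltr_pdivrMr// ltr_pMr// ltr1n.
Qed.

(** The hat is the combination of positive parts whose coefficients are the point masses of its
    second derivative. *)
Lemma hat_ramp (c x d y : R) : c < x -> x < d -> c <= y ->
  (x - c)^-1 * Num.max (- c + 1 * y) 0 - ((x - c)^-1 + (d - x)^-1) * Num.max (- x + 1 * y) 0 +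
    (d - x)^-1 * Num.max (- d + 1 * y) 0 = if y <= d then hat c x d y else 0.
Proof.
move=> cx xd cy; rewrite !mul1r.
have p1 : x - c != 0 by rewrite subr_eq0 gt_eqF.
have p2 : d - x != 0 by rewrite subr_eq0 gt_eqF.
rewrite (@max_l _ _ (- c + y)); last by lra.
rewrite /hat; have [xy|xy] := ltP y x.
  rewrite max_r; last by lra.
  rewrite max_r; last by lra.
  by rewrite (le_trans (ltW xy) (ltW xd)) !mulr0 subr0 addr0 mulrC [- c + y]addrC.
rewrite max_l; last by lra.
case: leP => yd; first (rewrite max_r; [by field; rewrite ?p1 ?p2|lra]).
by rewrite max_l; [field; rewrite ?p1 ?p2|lra].
Qed.

(** The positive parts in [hat_ramp] are replaced by smooth ramps. The second derivative becomes
    three bumps that average [v] near [c], [x] and [d], while the test function stays uniformly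
    close to the hat; uniform closeness suffices whatever atoms [m] has. *)
Lemma weak_hat_identity (v w : R -> R) (c x d : R) : continuous v -> lbm w ->
  c < x -> x < d ->
  (forall xi, smooth1 xi -> (forall y, ~~ (c <= y <= d + 1) -> xi y = 0) ->
    2 * itg m c (d + 1) (fun y => xi y * w y) =
    itg leb c (d + 1) (fun y => derive1 (derive1 xi) y * v y)) ->
  hat_identity m v w c x d.
Proof.
move=> cv lw cx xd weak.
set al := (x - c)^-1; set be := (d - x)^-1.
have al0 : 0 < al by rewrite invr_gt0 subr_gt0.
have be0 : 0 < be by rewrite invr_gt0 subr_gt0.
have [W W0 HW] := lbm_bounded c (d + 1) lw.
pose M1 := itg m c (d + 1) (fun=> 1).
have M10 : 0 <= M1 by apply: itg_ge0.
apply: (@eq_of_small_error _ _ (2 * (al + be) * (1 + 2 * W * M1))) => eps eps0.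
have [d1 d10 H1] := continuous_modulus c cv eps0.
have [d2 d20 H2] := continuous_modulus x cv eps0.
have [d3 d30 H3] := continuous_modulus d cv eps0.
have [e [e0 ee e1 ed1 [ed2 ed3]]] : exists e : R, [/\ 0 < e, e <= eps, e <= 1, e <= d1 & e <= d2 /\ e <= d3].
  exists (Num.min eps (Num.min 1 (Num.min d1 (Num.min d2 d3)))).
  by split; rewrite ?lt_min ?ge_min ?lexx ?eps0 ?d10 ?d20 ?d30 ?ltr01 ?orbT//; split; rewrite ?ge_min lexx ?orbT.
have [b hb] := bump_exists e0.
have [sb b0 bn bp b1] := hb.
pose comb (f : R -> R) y := al * f (- c + 1 * y) - (al + be) * f (- x + 1 * y) + be * f (- d + 1 * y).
have comb_derive f f' y : (forall z : R, is_derive z (1 : R) f (f' z)) ->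
    is_derive y (1 : R) (comb f) (comb f' y).
  move=> df.
  have E g : comb g = (fun y => (al * g (- c + 1 * y) + (- (al + be)) * g (- x + 1 * y)) + be * g (- d + 1 * y)).
    by apply/funext => z; rewrite /comb mulNr.
  have t1 k a : is_derive y (1 : R) (fun y => k * f (a + 1 * y)) (k * f' (a + 1 * y)).
    have := is_deriveM1 (is_derive_cst k y (1 : R)) (is_derive_affine (df (a + 1 * y))).
    by rewrite mul0r add0r mul1r.
  have := is_deriveD1 (is_deriveD1 (t1 al (- c)) (t1 (- (al + be)) (- x))) (t1 be (- d)).
  by rewrite !E.
pose xi := comb (ramp b).
have sxi : smooth1 xi.
  have sr := smooth1_ramp hb.
  have -> : xi = (fun y => (al * ramp b (- c + 1 * y) + (- (al + be)) * ramp b (- x + 1 * y)) + be * ramp b (- d + 1 * y)).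
    by apply/funext => z; rewrite /xi /comb mulNr.
  by move=> k; apply: CnD; [apply: CnD|]; apply: CnZ; apply: Cn_affine.
have dxi : derive1 (derive1 xi) = comb b.
  rewrite (derive1_eq (fun y => comb_derive _ _ y (ramp_derive hb))).
  by rewrite (derive1_eq (fun y => comb_derive _ _ y (step_derive hb))).
(* Past [d + e] all three ramps are affine with slope 1, and what remains is
   [al * (x - c) - be * (d - x)], which is 0. The support exceeds [d] by at most [e <= 1], whence
   the bound [d + 1]. *)
have supp y : ~~ (c <= y <= d + 1) -> xi y = 0.
  rewrite negb_and -!ltNge => /orP[yc|yd]; rewrite /xi /comb.
    by rewrite !(ramp_nonpos hb) ?mulr0 ?subrr ?addr0//; lra.
  rewrite !(ramp_affine e0 hb (y := _ + 1 * y)); [|lra..].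
  transitivity (al * (x - c) - be * (d - x)); first by ring.
  by rewrite !mulVf ?subrr// subr_eq0 gt_eqF.
have := weak xi sxi supp; rewrite dxi => {}weak.
have lv := continuous_lbm cv.
have lb a : lbm (fun y => b (- a + 1 * y)).
  by apply: continuous_lbm; apply: smooth1_continuous => k; apply: Cn_affine.
have lbv a := lbmM (lb a) lv.
have E1 : itg leb c (d + 1) (fun y => comb b y * v y) =
    al * itg leb c (d + 1) (fun y => b (- c + 1 * y) * v y) -
    (al + be) * itg leb c (d + 1) (fun y => b (- x + 1 * y) * v y) +
    be * itg leb c (d + 1) (fun y => b (- d + 1 * y) * v y).
  rewrite -!(itgZ leb_lf _ _ _ (lbv _)).
  rewrite -(itgB leb_lf _ _ (lbmZ al (lbv c)) (lbmZ (al + be) (lbv x))).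
  rewrite -(itgD leb_lf _ _ (lbmB (lbmZ al (lbv c)) (lbmZ (al + be) (lbv x))) (lbmZ be (lbv d))).
  by apply: eq_itg => y _; rewrite /comb; ring.
have near_a a d' : e <= d' -> (forall y, `|y - a| <= d' -> `|v y - v a| <= eps) ->
    forall y, a <= y <= a + e -> `|v y - v a| <= eps.
  move=> ed h y /andP[ay ya]; apply: h; rewrite ger0_norm ?subr_ge0//; lra.
have A1 : `|itg leb c (d + 1) (fun y => b (- c + 1 * y) * v y) - v c| <= eps.
  by apply: (shifted_bump_average e0 hb cv) => //; [lra|exact: near_a H1].
have A2 : `|itg leb c (d + 1) (fun y => b (- x + 1 * y) * v y) - v x| <= eps.
  by apply: (shifted_bump_average e0 hb cv) => //; [exact: ltW|lra|exact: near_a H2].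
have A3 : `|itg leb c (d + 1) (fun y => b (- d + 1 * y) * v y) - v d| <= eps.
  by apply: (shifted_bump_average e0 hb cv) => //; [lra|lra|exact: near_a H3].
have lh := lbm_hat c x d.
pose h0 y := if y <= d then hat c x d y else 0.
have E2 : itg m c d (fun z => hat c x d z * w z) = itg m c (d + 1) (fun y => (y <= d)%R%:R * (hat c x d y * w y)).
  by rewrite itg_le_cut//; lra.
have lcut : lbm (fun y => (y <= d)%R%:R * (hat c x d y * w y)) by apply: lbm_le; exact: lbmM.
have lxw : lbm (fun y => xi y * w y).
  by apply: lbmM => //; apply: continuous_lbm; exact: smooth1_continuous.
have A4 : `|itg m c (d + 1) (fun y => xi y * w y) - itg m c d (fun z => hat c x d z * w z)| <= 2 * (al + be) * eps * W * M1.
  rewrite E2 -(itgB m_lf _ _ lxw lcut); apply: (itg_bound m_lf); first exact: lbmB.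
  move=> y ycd; have /andP[cy yd] := ycd.
  have -> : (y <= d)%R%:R * (hat c x d y * w y) = (if y <= d then hat c x d y else 0) * w y.
    by case: ifP; rewrite ?mul1r ?mul0r.
  rewrite -mulrBl normrM; apply: ler_pM => //; last exact: HW.
  rewrite -(hat_ramp cx xd cy) -/al -/be /xi /comb.
  have := ramp_close e0 hb (- c + 1 * y); have := ramp_close e0 hb (- x + 1 * y).
  have := ramp_close e0 hb (- d + 1 * y).
  set r1 := ramp b _; set r2 := ramp b _; set r3 := ramp b _.
  set q1 := Num.max _ _; set q2 := Num.max _ _; set q3 := Num.max _ _ => B1 B2 B3.
  have -> : al * r3 - (al + be) * r2 + be * r1 - (al * q3 - (al + be) * q2 + be * q1) =
     al * (r3 - q3) - (al + be) * (r2 - q2) + be * (r1 - q1) by ring.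
  have abe0 : 0 < al + be by exact: addr_gt0.
  have := ler_normD (al * (r3 - q3) - (al + be) * (r2 - q2)) (be * (r1 - q1)).
  have := ler_normB (al * (r3 - q3)) ((al + be) * (r2 - q2)).
  rewrite !normrM (gtr0_norm al0) (gtr0_norm be0) (gtr0_norm abe0).
  have C1 := ler_wpM2l (ltW al0) (le_trans B3 ee).
  have C2 := ler_wpM2l (ltW abe0) (le_trans B2 ee).
  have C3 := ler_wpM2l (ltW be0) (le_trans B1 ee).
  move: C1 C2 C3; clear; set u := `|_ - _ + _|; set u' := `|_ - _|.
  lra.
rewrite E1 in weak.
move: A1 A2 A3 A4 weak; rewrite /=.
set I1 := itg leb _ _ _; set I2 := itg leb _ _ _; set I3 := itg leb _ _ _.
set I4 := itg m c (d + 1) _; set I5 := itg m c d _ => A1 A2 A3 A4 weak.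
have -> : v c / (x - c) + v d / (d - x) - (al + be) * v x - 2 * I5 =
    2 * (I4 - I5) - (al * (I1 - v c) - (al + be) * (I2 - v x) + be * (I3 - v d)).
  rewrite -/al -/be !mulrBr weak; ring.
have abe0 : 0 < al + be by exact: addr_gt0.
have := ler_normB (2 * (I4 - I5)) (al * (I1 - v c) - (al + be) * (I2 - v x) + be * (I3 - v d)).
have := ler_normD (al * (I1 - v c) - (al + be) * (I2 - v x)) (be * (I3 - v d)).
have := ler_normB (al * (I1 - v c)) ((al + be) * (I2 - v x)).
rewrite !normrM (gtr0_norm al0) (gtr0_norm be0) (gtr0_norm abe0) (@ger0_norm _ 2)//.
have C1 := ler_wpM2l (ltW al0) A1.
have C2 := ler_wpM2l (ltW abe0) A2.
have C3 := ler_wpM2l (ltW be0) A3.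
have -> : 2 * (al + be) * (1 + 2 * W * M1) * eps = 2 * (al + be) * eps + 2 * (2 * (al + be) * eps * W * M1) by ring.
move: A4 C1 C2 C3; clear.
set u := `|_ - (_ - _ + _)|; set u1 := `|_ - _ + _|; set u2 := `|_ * _ - _|; set u3 := 2 * _ * _ * _ * _.
lra.
Qed.

End WeakHat.

Section MollifiedSolution.
Context {R : realType} (m : {measure set (measurableTypeR R) -> \bar R}).
Hypothesis m_lf : locally_finite m.
Variable U : R * R -> R.
Hypothesis U_continuous : {within [set p : R * R | 0 <= p.2], continuous U}.
Hypothesis U_equation : distributional_solution m U.

Lemma smooth_solution_mollified e k : 0 < e -> bump_on e k ->
  smooth_solution m (mollified U e k).
Proof.
move=> e0 [sk k0 kn kp k1].
have hk u : ~~ (0 <= u <= e) -> k u = 0.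
  by rewrite negb_and -!ltNge => /orP[/ltW/kn|/ltW/kp].
split=> [n|n x t|n t c x d t0 cx xd].
- exact: mollified_continuous.
- exact: mollified_derive.
have cm j : continuous (fun y => mollified U e k j y t).
  by apply: (continuous_col t (h := fun p => mollified U e k j p.1 p.2)); exact: mollified_continuous.
apply: (weak_hat_identity m_lf) => //; first exact: continuous_lbm.
by move=> xi sxi hxi; apply: mollified_weak.
Qed.

End MollifiedSolution.

(** * Limits of mollified solutions *)

Section Limits.
Context {R : realType}.
Local Notation seq_cvg u l := (u%function @ \oo --> (l : R)).

Lemma cvg_norm_le (u : nat -> R) (l C : R) : seq_cvg u l -> (forall j, `|u j| <= C) -> `|l| <= C.
Proof.
move=> ul uC; have nl : seq_cvg (fun j => `|u j|) `|l| by apply: cvg_norm.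
have <- : lim (`|u j| @[j --> \oo]) = `|l| by exact: (cvg_lim (@norm_hausdorff _ _) nl).
by apply: limr_le; [apply/cvg_ex; exists `|l| | near=> j].
Unshelve. all: end_near. Qed.

(** Uniformly bounded second derivatives give a Taylor remainder uniform in [j]. It forces the first
    derivatives at [t] to converge and survives in the limit as the remainder of [g]. *)
Lemma derivative_limit (f f1 f2 : nat -> R -> R) (g : R -> R) (t d M : R) : 0 < d ->
  (forall j (x : R), is_derive x (1 : R) (f j) (f1 j x)) ->
  (forall j (x : R), is_derive x (1 : R) (f1 j) (f2 j x)) ->
  (forall j x, `|x - t| <= d -> `|f2 j x| <= M) ->
  (forall x, `|x - t| <= d -> seq_cvg (fun j => f j x) (g x)) ->
  exists2 l, seq_cvg (fun j => f1 j t) l & is_derive t (1 : R) g l.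
Proof.
move=> d0 d1 d2 HM fg.
have M0 : 0 <= M by apply: le_trans (HM 0%N t _) => //; rewrite subrr normr0 ltW.
have T j h : `|h| <= d -> `|f j (t + h) - f j t - h * f1 j t| <= M * h ^+ 2.
  by move=> hd; apply: (taylor2 (d1 j) (d2 j)) => x xh; apply: HM; exact: le_trans hd.
have tt : `|t - t| <= d by rewrite subrr normr0 ltW.
have th h : `|h| <= d -> `|t + h - t| <= d by rewrite addrAC subrr add0r.
have /cvg_ex[l fl] : cvg (f1 j t @[j --> \oo]).
  apply: cauchy_cvg; apply: cauchy_exP => eps eps0.
  (* The centre of the Cauchy ball will be the difference quotient of [g] with this step, chosen so
     that the Taylor error [M * h] is at most [eps / 4]; only then is [j] taken large. *)
  pose h := Num.min d (eps / (4 * (M + 1))).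
  have M1 : 0 < 4 * (M + 1) by apply: mulr_gt0 => //; apply: ltr_wpDl.
  have h0 : 0 < h by rewrite lt_min d0 divr_gt0.
  have hd : `|h| <= d by rewrite gtr0_norm// ge_min lexx.
  have Mh : M * h <= eps / 4.
    apply: (@le_trans _ _ ((M + 1) * h)); first by apply: ler_wpM2r; [exact: ltW|rewrite lerDl].
    have : h <= eps / (4 * (M + 1)) by rewrite ge_min lexx orbT.
    rewrite ler_pdivlMr// ler_pdivlMr// => E.
    by have -> : (M + 1) * h * 4 = h * (4 * (M + 1)) by ring.
  exists ((g (t + h) - g t) / h).
  have e1 : 0 < h * eps / 4 by apply: divr_gt0 => //; exact: mulr_gt0.
  have /cvgrPdist_lt/(_ _ e1) C1 := fg _ (th _ hd).
  have /cvgrPdist_lt/(_ _ e1) C2 := fg _ tt.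
  change (\forall j \near \oo, ball ((g (t + h) - g t) / h) eps (f1 j t)); near=> j.
  have B1 : `|g (t + h) - f j (t + h)| < h * eps / 4 by near: j.
  have B2 : `|g t - f j t| < h * eps / 4 by near: j.
  rewrite /ball /= -(ltr_pM2l h0) -{1}(gtr0_norm h0) -normrM.
  have -> : h * ((g (t + h) - g t) / h - f1 j t) =
    (f j (t + h) - f j t - h * f1 j t) + ((g (t + h) - f j (t + h)) - (g t - f j t)).
    by field; rewrite gt_eqF.
  have B3 := T j h hd.
  have B4 : M * h ^+ 2 <= h * eps / 4.
    have -> : h * eps / 4 = eps / 4 * h by ring.
    by rewrite expr2 mulrA; apply: ler_wpM2r Mh; exact: ltW.
  have := ler_normD (f j (t + h) - f j t - h * f1 j t) ((g (t + h) - f j (t + h)) - (g t - f j t)).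
  have := ler_normB (g (t + h) - f j (t + h)) (g t - f j t).
  have e2 : 0 < h * eps by exact: mulr_gt0.
  lra.
exists l => //.
apply: (@is_derive_quadratic _ _ _ _ M d) => // h /ltW hd.
apply: (@cvg_norm_le (fun j => f j (t + h) - f j t - h * f1 j t)); last by move=> j; exact: T.
apply: cvgB; first by apply: cvgB; apply: fg => //; exact: th.
by apply: cvgM => //; exact: cvg_cst.
Unshelve. all: end_near. Qed.

Lemma derive1n_near (f : R -> R) (g : nat -> R -> R) :
  (forall n (t : R), 0 < t -> is_derive t (1 : R) (g n) (g n.+1 t)) ->
  (forall t, 0 < t -> f t = g 0%N t) ->
  forall n (t : R), 0 < t -> derive1n n f t = g n t /\ derivable (derive1n n f) t 1.
Proof.
move=> dg fg.
have key n : (forall t, 0 < t -> derive1n n f t = g n t) ->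
    forall t : R, 0 < t -> is_derive t (1 : R) (derive1n n f) (g n.+1 t).
  move=> E t t0; have := dg n t t0; apply: near_eq_is_derive.
  by near=> s; apply/esym/E; near: s; exact: lt_nbhsr.
have E n : forall t, 0 < t -> derive1n n f t = g n t.
  elim: n => [//|n ih t t0]; have [_] := key n ih t t0.
  by rewrite -derive1E.
by move=> n t t0; split; [exact: E|have [] := key n (E n) t t0].
Unshelve. all: end_near. Qed.

End Limits.

Section HatLipschitz.
Context {R : realType} (m : {measure set (measurableTypeR R) -> \bar R}).
Hypothesis m_lf : locally_finite m.

(** A hat with feet [x] and [y + 1] and peak [y]: its identity expresses the slope between [x] and
    [y] through the slope over the unit interval and an integral of [w], both bounded however close
    [x] and [y] are. *)
Lemma hat_lipschitz (v w : R -> R) (x y A B M : R) : lbm w -> x < y ->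
  hat_identity m v w x y (y + 1) -> `|v y| <= A -> `|v (y + 1)| <= A ->
  (forall z, x <= z <= y + 1 -> `|w z| <= B) -> itg m x (y + 1) (fun=> 1) <= M ->
  `|v x - v y| <= (2 * A + 2 * B * M) * (y - x).
Proof.
move=> lw xy H vy vy1 wB mM.
have yx0 : 0 < y - x by rewrite subr_gt0.
have y1 : y < y + 1 by rewrite ltrDl.
have B0 : 0 <= B by apply: le_trans (wB y _) => //; rewrite !ltW.
have l1 : lbm (fun z => hat x y (y + 1) z * w z) by apply: lbmM => //; exact: lbm_hat.
have I : `|itg m x (y + 1) (fun z => hat x y (y + 1) z * w z)| <= B * M.
  have h z : x <= z <= y + 1 -> `|hat x y (y + 1) z * w z| <= B.
    move=> xz; have /andP[h0 h1] := hat01 xy y1 xz.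
    rewrite normrM ger0_norm// -[B]mul1r; apply: ler_pM => //; exact: wB.
  by apply: le_trans (itg_bound m_lf l1 h) _; apply: ler_wpM2l.
move: H I; rewrite /hat_identity; set J := itg _ _ _ _ => H I.
have E : v x - v y = (2 * J - (v (y + 1) - v y)) * (y - x).
  rewrite -H; have -> : y + 1 - y = 1 by ring.
  by field; rewrite gt_eqF.
rewrite E normrM (gtr0_norm yx0); apply: ler_wpM2r; first exact: ltW.
have := ler_normB (2 * J) (v (y + 1) - v y).
have := ler_normB (v (y + 1)) (v y).
rewrite normrM (@ger0_norm _ 2)// -mulrA; set P := B * M in I *.
move: vy vy1 I; clear; lra.
Qed.

(** Support points beyond distance [r + 2] have neighbourhoods inside the regions beyond [r + 1],
    and neighbourhoods of support points are charged. *)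
Lemma two_sided_of_support :
  (forall b : R, 0 < b -> msupport m `&` `]-oo, - b] !=set0) ->
  (forall b : R, 0 < b -> msupport m `&` `[b, +oo[ !=set0) -> two_sided m.
Proof.
move=> hl hr r r0; have r2 : 0 < r + 2 by lra.
have [p [sp /=]] := hr _ r2; rewrite in_itv/= andbT => pr.
have [q [sq /=]] := hl _ r2; rewrite in_itv/= => qr.
have pos a b z : msupport m z -> a < z -> z < b -> 0 < itg m a b (fun=> 1).
  move=> sz az zb; rewrite itg1.
  have oV : open_nbhs z [set` `]a, b[].
    by split; [exact: interval_open|rewrite /= in_itv/= az zb].
  apply: fine_gt0; apply/andP; split; last exact: locally_finite_itv.
  apply: lt_le_trans (sz _ oV) _; apply: le_measure; rewrite ?inE//=.
  by apply: subset_itv_oo_cc.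
exists (Num.max p (- q) + 1); split.
- have : p <= Num.max p (- q) by rewrite le_max lexx.
  by lra.
- apply: (pos _ _ p) => //; first lra.
  have : p <= Num.max p (- q) by rewrite le_max lexx.
  by lra.
- apply: (pos _ _ q) => //; last lra.
  have : - q <= Num.max p (- q) by rewrite le_max lexx orbT.
  lra.
Qed.

End HatLipschitz.

Section LimitsOfSolutions.
Context {R : realType} (m : {measure set (measurableTypeR R) -> \bar R}).
Hypothesis m_lf : locally_finite m.
Hypothesis m2 : two_sided m.
Variable F : nat -> nat -> R -> R -> R.
Hypothesis sF : forall j, smooth_solution m (F j).
Hypothesis bF : forall r T : R, exists2 mu : R, 0 < mu &
  forall j x t, `|x| <= r -> 0 <= t <= T -> `|F j 0%N x t| <= mu.
Variable V : R -> R -> R.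
Hypothesis FV : forall x t : R, 0 < t -> F j 0%N x t @[j --> \oo] --> V x t.

Lemma derivatives_bounded n (r s T : R) : 0 < r -> 0 < s -> s < T ->
  exists2 C, 0 < C & forall j x t, `|x| <= r -> s <= t <= T -> `|F j n x t| <= C.
Proof.
move=> r0 s0 sT.
have [r' [s' [T' [C [[rr s'0 ss TT C0] H]]]]] := sup_gain m_lf m2 n r0 s0 sT.
have [mu mu0 hmu] := bF r' T'.
exists (C * mu); first exact: mulr_gt0.
move=> j x t xr st; apply: (H _ (sF j)) => // z u zr /andP[su uT].
by apply: hmu => //; rewrite uT (le_trans (ltW s'0) su).
Qed.

Definition limit_derivative n (x t : R) : R := lim (F j n x t @[j --> \oo]).

(** Induction on the order: convergence at order [k] for all positive times, with a bound on order
    [k.+2] uniform in [j] near the given time, yields convergence at order [k.+1] by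
    [derivative_limit]. *)
Lemma limit_derivativeP n x t : 0 < t ->
  F j n x t @[j --> \oo] --> limit_derivative n x t /\
  is_derive t (1 : R) (limit_derivative n x) (limit_derivative n.+1 x t).
Proof.
have limE k y s (l : R) : F j k y s @[j --> \oo] --> l -> limit_derivative k y s = l.
  by move=> h; apply: (cvg_lim (@norm_hausdorff _ _) h).
have step k : (forall t, 0 < t -> F j k x t @[j --> \oo] --> limit_derivative k x t) ->
    forall t, 0 < t -> F j k.+1 x t @[j --> \oo] --> limit_derivative k.+1 x t /\
      is_derive t (1 : R) (limit_derivative k x) (limit_derivative k.+1 x t).
  move=> ih s s0.
  have r0 : 0 < `|x| + 1 by apply: ltr_wpDl.
  have s2 : 0 < s / 2 by exact: divr_gt0.
  have s3 : s / 2 < 2 * s by lra.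
  have [C _ HC] := derivatives_bounded k.+2 r0 s2 s3.
  have [l fl dl] : exists2 l, F j k.+1 x s @[j --> \oo] --> (l : R) &
      is_derive s (1 : R) (limit_derivative k x) l.
    apply: (@derivative_limit _ (fun j => F j k x) (fun j => F j k.+1 x) (fun j => F j k.+2 x) _ s (s / 2) C s2).
    - by move=> j y; have [_ h _] := sF j; exact: h.
    - by move=> j y; have [_ h _] := sF j; exact: h.
    - move=> j y; rewrite ler_norml => /andP[y1 y2]; apply: HC; first by rewrite lerDl.
      by apply/andP; split; lra.
    - move=> y; rewrite ler_norml => /andP[y1 y2]; apply: ih; lra.
  by rewrite (limE _ _ _ _ fl).
have conv k : forall t, 0 < t -> F j k x t @[j --> \oo] --> limit_derivative k x t.
  elim: k => [s s0|k ih s s0]; last by have [] := step k ih s s0.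
  by rewrite (limE _ _ _ _ (@FV x s s0)); exact: FV.
by move=> t0; split; [exact: conv|have [] := step n (conv n) t t0].
Qed.

Lemma limit_derivative0 x t : 0 < t -> limit_derivative 0 x t = V x t.
Proof. by move=> t0; apply: (cvg_lim (@norm_hausdorff _ _) (@FV x t t0)). Qed.

(** The estimates are proved for each [j] with constants free of [j] and then pass to the limit:
    [hat_lipschitz] in [x], and the bound on order [n.+1] with the mean value theorem in [t]. *)
Lemma limit_locally_lipschitz n (W : R * R -> R) :
  (forall x t, 0 < t -> F j n x t @[j --> \oo] --> W (x, t)) ->
  locally_lipschitz upper_half_plane W.
Proof.
move=> FW [x0 t0] /= t00; rewrite /upper_half_plane /= in t00.
(* Room for the unit neighbourhood of [x0] and for the right foot [y + 1] of the hat. *)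
pose r := `|x0| + 3.
have r0 : 0 < r by apply: ltr_wpDl.
have s0 : 0 < t0 / 4 by exact: divr_gt0.
have sT : t0 / 4 < 2 * t0 by lra.
have [A A0 HA] := derivatives_bounded n r0 s0 sT.
have [B B0 HB] := derivatives_bounded n.+1 r0 s0 sT.
pose M := itg m (- r) r (fun=> 1).
have M0 : 0 <= M by apply: itg_ge0.
have xr x : `|x - x0| < 2 -> `|x| <= r - 1.
  move=> xx; have := ler_normD (x - x0) x0; rewrite subrK /r; lra.
have K1 j x y t : `|x - x0| < 1 -> `|y - x0| < 1 -> x < y -> t0 / 4 <= t <= 2 * t0 ->
    `|F j n x t - F j n y t| <= (2 * A + 2 * B * M) * (y - x).
  move=> x1 y1 xy tt.
  have tp : 0 < t by case/andP: tt => + _; exact: lt_le_trans.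
  have /xr xR : `|x - x0| < 2 by lra.
  have /xr yR : `|y - x0| < 2 by lra.
  have y1R : `|y + 1| <= r.
    by have := ler_normD y 1; rewrite normr1; lra.
  have [_ _ H] := sF j.
  have := H n t x y (y + 1) tp xy; rewrite ltrDl ltr01 => /(_ isT) {}H.
  apply: (hat_lipschitz m_lf (sol_lbm_x (sF j) n.+1 t) xy H).
  - by apply: HA => //; lra.
  - exact: HA.
  - move=> z /andP[xz zy]; apply: HB => //.
    move: xR y1R; rewrite !ler_norml => /andP[? _] /andP[_ ?]; apply/andP; split; lra.
  - apply: (itg_subset m_lf) => //; first exact: lbm_cst.
      by move: xR; rewrite ler_norml => /andP[? _]; lra.
    by move: y1R; rewrite ler_norml => /andP[_ ?].
have K2 j x t s : `|x - x0| < 1 -> `|t - t0| < t0 / 4 -> `|s - t0| < t0 / 4 ->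
    `|F j n x t - F j n x s| <= B * `|t - s|.
  move=> x1 tt ss; have [_ D _] := sF j.
  have [c cs ->] := mean_value (D n x) s t.
  rewrite normrM; apply: ler_wpM2r => //; apply: HB.
    have /xr : `|x - x0| < 2 by lra.
    by lra.
  have ts : `|t - s| <= t0 / 2.
    by have := ler_normB (t - t0) (s - t0); rewrite opprB addrA subrK; lra.
  move: (le_trans cs ts) ss; rewrite ler_norml ltr_norml => /andP[? ?] /andP[? ?].
  apply/andP; split; lra.
exists [set q : R * R | `|q.1 - x0| < 1 /\ `|q.2 - t0| < t0 / 4].
  exists (ball x0 1, ball t0 (t0 / 4)); first by split; exact: nbhsx_ballx.
  by move=> [x t] [/= b1 b2]; split; rewrite distrC.
apply: (@klipschitzW _ _ _ (2 * A + 2 * B * M + B)).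
  apply: (@globally_properfilter _ _ ((x0, t0), (x0, t0))).
  by split; split; rewrite //= !subrr !normr0.
move=> [[x t] [y s]] [[[/= x1 t1] _] [[/= y1 s1] _]].
set D := `|(x, t) - (y, s)|.
have [Dx Dt] : `|x - y| <= D /\ `|t - s| <= D.
  by rewrite /D prod_normE /= !le_max !lexx orbT.
have tpos u : `|u - t0| < t0 / 4 -> t0 / 4 <= u <= 2 * t0.
  by rewrite ltr_norml => /andP[? ?]; apply/andP; split; lra.
have tpos0 u : `|u - t0| < t0 / 4 -> 0 < u.
  by move=> /tpos/andP[+ _]; exact: lt_le_trans.
apply: (@cvg_norm_le _ (fun j => F j n x t - F j n y s)).
  by apply: cvgB; apply: FW; exact: tpos0.
move=> j; have -> : F j n x t - F j n y s = (F j n x t - F j n y t) + (F j n y t - F j n y s) by ring.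
apply: le_trans (ler_normD _ _) _; rewrite [leRHS]mulrDl; apply: lerD; last first.
  by apply: le_trans (K2 _ _ _ _ y1 t1 s1) _; apply: ler_wpM2l; first exact: ltW.
have K0 : 0 <= 2 * A + 2 * B * M.
  by apply: addr_ge0; [apply: mulr_ge0 => //; exact: ltW|apply: mulr_ge0 => //; apply: mulr_ge0 => //; exact: ltW].
apply: (@le_trans _ _ ((2 * A + 2 * B * M) * `|x - y|)); last exact: ler_wpM2l.
have tt := tpos t t1.
have [xy|yx|->] := ltgtP x y.
- by rewrite (ltr0_norm (x := x - y)) ?subr_lt0// opprB; exact: K1.
- by rewrite distrC (gtr0_norm (x := x - y)) ?subr_gt0//; exact: K1.
- by rewrite !subrr normr0 mulr0.
Qed.

End LimitsOfSolutions.

(** * Convergence of the mollified solutions and conclusion *)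

Section Regularity.
Context {R : realType} (m : {measure set (measurableTypeR R) -> \bar R}).
Variable U : R * R -> R.
Hypothesis U_continuous : {within [set p : R * R | 0 <= p.2], continuous U}.

Lemma mollified_near e k (x t c eps : R) : bump_on e k ->
  (forall u, 0 <= u <= e -> `|extended U (x, t + u) - c| <= eps) ->
  `|mollified U e k 0 x t - c| <= eps.
Proof.
move=> hk H.
have -> : mollified U e k 0 x t = itg leb 0 e (fun u => extended U (x, t + u) * k u).
  by apply: eq_itg => u _; rewrite /kernel_n /= expr0 mul1r.
apply: bump_average H => //; apply: continuous_lbm.
have := continuous_shift (u := t) (continuous_row x (continuous_extended U_continuous)).
by under eq_fun do rewrite addrC.
Qed.

End Regularity.

Theorem theorem8p1 (R : realType)
  (m : {measure set (measurableTypeR R) -> \bar R})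
  (m_locally_finite : locally_finite m)
  (msupport_left : forall b : R, 0 < b -> msupport m `&` `]-oo, - b] !=set0)
  (msupport_right : forall b : R, 0 < b -> msupport m `&` `[b, +oo[ !=set0)
  (g : R -> R) (g_continuous : continuous g)
  (g_growth : littleo_infty g (Psi m))
  (gbar : R -> R) (gbarP : affine_interpolation m g gbar)
  (U : R * R -> R)
  (U_continuous : {within [set p : R * R | 0 <= p.2], continuous U})
  (U_growth : littleo_infty_locally_uniformly U (Psi m))
  (U_equation : distributional_solution m U)
  (U_initial : forall x : R, U (x, 0) = gbar x) :
  infinitely_differentiable_in_t U /\
  (forall n : nat, locally_lipschitz upper_half_plane (dtn n U)).
Proof.
pose e (j : nat) : R := j.+1%:R^-1.
have e0 j : 0 < e j by rewrite invr_gt0.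
have [k hk] := choice (fun j => bump_exists (e0 j)).
have m2 := two_sided_of_support m_locally_finite msupport_left msupport_right.
have cE := continuous_extended U_continuous.
pose F j := mollified U (e j) (k j).
have sF j : smooth_solution m (F j).
  exact: smooth_solution_mollified.
have bF r T : exists2 mu : R, 0 < mu &
    forall j x t, `|x| <= r -> 0 <= t <= T -> `|F j 0%N x t| <= mu.
  (* Mollification looks ahead by [e j <= 1], so the supremum of the solution up to time [T + 1]
     bounds all [F j] up to time [T]. *)
  have [mu mu0 hmu] := lbm2_bounded (Num.max r (T + 1)) (continuous_lbm2 cE).
  exists mu => // j x t xr /andP[t0 tT]; rewrite -[F j _ _ _]subr0.
  apply: mollified_near => // u /andP[u0 ue]; rewrite subr0; apply: hmu.
    by rewrite le_max xr.
  have e1 : e j <= 1 by rewrite invf_le1 ?ler1n.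
  by rewrite le_max ger0_norm ?addr_ge0// (lerD tT (le_trans ue e1)) orbT.
have FV (x t : R) : 0 < t -> F j 0%N x t @[j --> \oo] --> U (x, t).
  move=> t0; rewrite -(extendedE U x (ltW t0)).
  apply/cvgrPdist_le => eps eps0.
  have [d d0 hd] := continuous_modulus t (continuous_row x cE) eps0.
  have : e j @[j --> \oo] --> (0 : R) by exact: cvg_harmonic.
  move=> /cvgrPdist_le/(_ d d0); apply: filterS => j.
  rewrite sub0r normrN gtr0_norm// => ed; rewrite distrC.
  apply: mollified_near => // u /andP[u0 ue]; apply: hd.
  by rewrite addrAC subrr add0r ger0_norm// (le_trans ue).
have P n (x t : R) t0 := @limit_derivativeP _ _ m_locally_finite m2 F sF bF _ FV n x t t0.
(* At positive times the limits of the derivatives are the derivatives of the limit [U], so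
   differentiability and Lipschitz bounds carry over to [dtn n U]. *)
have D n (x t : R) : 0 < t -> dtn n U (x, t) = limit_derivative F n x t /\
    derivable (fun s => dtn n U (x, s)) t 1.
  apply: (@derive1n_near _ (fun s => U (x, s)) (fun n => limit_derivative F n x)).
    by move=> i s s0; have [] := P i x s s0.
  by move=> s s0; rewrite (@limit_derivative0 _ F (fun x t => U (x, t)) FV).
split=> [n x t t0|n]; first by have [] := D n x t t0.
apply: (limit_locally_lipschitz m_locally_finite m2 sF bF (n := n)) => x t t0.
by have [-> _] := D n x t t0; have [] := P n x t t0.
Qed.
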